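(* Let $(\mathfrak{g},\mathfrak{u},\varphi)$ be a seven-dimensional almost Abelian Lie algebra with a cocalibrated $\mathrm{G}_2$-structure $\varphi\in\Lambda^3\mathfrak{g}^*$ (i.e. $d\star_\varphi\varphi=0$), with induced data $X,\alpha,f,g,J,\sigma,\rho$. Let $\mathfrak{a}$ be an $f$-invariant subspace of $\mathfrak{u}$ and let $\omega=\omega_0+\alpha\wedge\nu\in\Lambda^2\mathfrak{g}^*\otimes\mathfrak{a}$ with $\omega_0\in\Lambda^2\mathfrak{u}^*\otimes\mathfrak{a}$, $\nu\in\mathfrak{u}^*\otimes\mathfrak{a}\subset\operatorname{End}(\mathfrak{u})$, $\omega_0\neq0$ and $\omega_0|_{\mathfrak{a}\otimes\mathfrak{u}}=0$. (a) If $\omega_0\in[\Lambda_0^{1,1}\mathfrak{u}^*]\otimes\mathfrak{a}$, then $(\mathrm{inc},\mathrm{id}_{\mathfrak{a}},\omega)$ shears $(\mathfrak{g},\varphi)$ to a cocalibrated structure if and only if $\dim(\mathfrak{a})\leq2$, $\nu\in\mathfrak{sp}(\mathfrak{u},\sigma)$ and either (i) $\dim(\operatorname{im}(\omega_0))=1$, $f.\omega_0=0$ and $\nu|_{\operatorname{im}(\omega_0)}=-f|_{\operatorname{im}(\omega_0)}$, or (ii) $\dim(\operatorname{im}(\omega_0))=2$, $\omega_0=\sum_{i=1}^2\tilde\omega_i\otimes Y_i$ with $Y_1,Y_2\in\mathfrak{a}$ a basis, $\tilde\omega_i\wedge\tilde\omega_j=\delta_{ij}\,\tilde\omega_1^2$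 for $i,j\in\{1,2\}$, $f.\tilde\omega_1=a\,\tilde\omega_2$, $f.\tilde\omega_2=-a\,\tilde\omega_1$, $\nu(Y_1)=aY_2-f(Y_1)$ and $\nu(Y_2)=-aY_1-f(Y_2)$ for some $a\in\mathbb{R}$. (b) If $\dim(\mathfrak{a})=4$ and $J(\operatorname{im}(\omega_0))\perp\mathfrak{a}$, then $(\mathrm{inc},\mathrm{id}_{\mathfrak{a}},\omega)$ shears $(\mathfrak{g},\varphi)$ to a cocalibrated structure if and only if $f|_{\operatorname{im}(\omega_0)}=-\operatorname{tr}(f|_{\mathfrak{a}})\,\mathrm{id}_{\operatorname{im}(\omega_0)}$ and $$\nu\in\tilde\nu+\{\hat\nu\in\mathfrak{sp}(\mathfrak{u},\sigma)\mid\hat\nu(\mathfrak{u})\subset\mathfrak{a},\ \hat\nu|_{\operatorname{im}(\omega_0)}=0\},$$ where $\tilde\nu\in\operatorname{End}(\mathfrak{u})$ is given by $\tilde\nu(W)=-\rho(JW,\kappa(J\circ\omega_0)^{\sharp},\cdot)^{\sharp}$ for $W\in J\operatorname{im}\omega_0$ and $\tilde\nu|_{(J\operatorname{im}\omega_0)^{\perp}}=0$. (c) If $\dim(\mathfrak{a})=4$ and $J(\operatorname{im}(\omega_0))\subset\mathfrak{a}$, then $(\mathrm{inc},\mathrm{id}_{\mathfrak{a}},\omega)$ shears $(\mathfrak{g},\varphi)$ to a cocalibrated structure if and only if $\mathfrak{a}$ is a $\sigma$-degenerate subspace of $\mathfrak{u}$ and $$\nu\in\tilde\nu+\{\hat\nu\in\mathfrak{sp}(\mathfrak{u},\sigma)\mid\hat\nu(\mathfrak{u})\subset\mathfrak{a},\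 \hat\nu|_{\operatorname{im}(\omega_0)}=0\},$$ where $\tilde\nu$ is given, for $Y\in\operatorname{im}(\omega_0)$ with $\|Y\|=1$, by $$\tilde\nu(Y)=-\operatorname{tr}(f|_{\mathfrak{a}})Y-f(Y),\qquad\tilde\nu(JY)=\bigl(-\sigma(f(Y),JY)+\operatorname{tr}(f|_{\mathfrak{a}})-\mu\bigr)JY,$$ $$\tilde\nu|_{\mathfrak{a}^{\perp}}=-\sigma(f(Y),\cdot)|_{\mathfrak{a}^{\perp}}\,JY,$$ and $\tilde\nu|_U=\mu\,\mathrm{id}_U$ on $U=(\operatorname{im}\omega_0+J\operatorname{im}\omega_0)^{\perp}\cap\mathfrak{a}$, with $\mu\in\mathbb{R}$ fixed by $\kappa(\omega_0\wedge\rho)|_{\Lambda^4\operatorname{span}(Y,JY)^{\perp}}=-\mu\,\sigma^2|_{\Lambda^4\operatorname{span}(Y,JY)^{\perp}}$.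
   Context: $\mathfrak{g}$ almost Abelian means that it has a codimension one Abelian ideal $\mathfrak{u}$. With the metric induced by $\varphi$, $\alpha\in\mathfrak{g}^*$ is of unit length with $\alpha(\mathfrak{u})=0$, $X\in\mathfrak{u}^{\perp}$ satisfies $\alpha(X)=1$, and $f=\operatorname{ad}(X)|_{\mathfrak{u}}\in\operatorname{End}(\mathfrak{u})$. Forms on $\mathfrak{u}$ are viewed as forms on $\mathfrak{g}$ annihilated by $X$. $d$ is the Chevalley--Eilenberg differential. Special almost Hermitian structure on $\mathfrak{u}$: $\star_\varphi\varphi=\tfrac12\sigma^2+\rho\wedge\alpha$ with $\sigma\in\Lambda^2\mathfrak{u}^*$, $\rho\in\Lambda^3\mathfrak{u}^*$; $g$ is the induced metric on $\mathfrak{u}$ and $\sigma=g(\cdot,J\cdot)$. In a suitable orthonormal basis $\sigma=e^{14}+e^{25}+e^{36}$, $\rho=e^{123}-e^{156}+e^{246}-e^{345}$, $Je_{i+3}=e_i$, $Je_i=-e_{i+3}$ ($i=1,2,3$). Notation: for $A\in\operatorname{End}(\mathfrak{u})$ and a $k$-form $\beta$ on $\mathfrak{u}$ (possibly vector-valued), $(A.\beta)(Y_1,\dots,Y_k)=-\sum_i\beta(Y_1,\dots,AY_i,\dots,Y_k)$; $\mathfrak{sp}(\mathfrak{u},\sigma)=\{A\mid A.\sigma=0\}$; $[\Lambda_0^{1,1}\mathfrak{u}^*]$ is the space of real primitive (i.e. orthogonal to $\sigma$) two-forms of type $(1,1)$ with respect to $J$; $\operatorname{im}(\omega_0)$ is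 the span of all values of $\omega_0$; $\kappa\colon\Lambda^k\mathfrak{u}^*\otimes\mathfrak{u}\to\Lambda^{k-1}\mathfrak{u}^*$ is the linear map with $\kappa(\beta\otimes A)=A\lrcorner\,\beta$; $\sharp\colon\mathfrak{u}^*\to\mathfrak{u}$ is the metric isomorphism; $\perp$ is taken in $\mathfrak{u}$; a subspace is $\sigma$-degenerate if the restriction of $\sigma$ to it is degenerate. Shearing: let $G$ be the simply-connected Lie group of $\mathfrak{g}$; $\mathrm{inc}\colon\mathfrak{a}\to\mathfrak{g}$ is the inclusion. Take $E=F=G\times\mathfrak{a}$ as vector bundles, with left-invariant flat connections $\nabla^E_Ye=Y(e)+\gamma(Y)e$, $\nabla^F_Ye=Y(e)+\eta(Y)e$, $\gamma,\eta\in\mathfrak{g}^*\otimes\mathfrak{gl}(\mathfrak{a})$. $(\mathrm{inc},\mathrm{id}_{\mathfrak{a}},\omega)$ is left-invariant shear data if, with $\xi=\mathrm{inc}$ (as a bundle map $E\to TG$), $a=\mathrm{id}_{\mathfrak{a}}$: (1) $\xi(\nabla_{\xi e_1}e_2-\nabla_{\xi e_2}e_1)=[\xi e_1,\xi e_2]$ for all $e_1,e_2\in\Gamma(E)$; (2) $d^{\nabla}\omega=d\omega+\eta\wedge\omega=0$; (3) $\xi\lrcorner\,\omega=-d^\nabla a$, i.e. $\gamma(Y)Z=\omega(Z,Y)+\eta(Y)Z$ for $Y\in\mathfrak{g}$, $Z\in\mathfrak{a}$; (4) $\omega|_{\Lambda^2\mathfrak{a}}=0$; (5) $\mathcal{L}^\nabla_\xi\beta=0$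 for all $\beta\in\mathfrak{g}^*$, i.e. $[Z,Y]=-\gamma(Y)Z$ for all $Z\in\mathfrak{a}$, $Y\in\mathfrak{g}$. For $\omega$ as in the claim, this forces $\gamma=\alpha\otimes f|_{\mathfrak{a}}$ and $\eta=\alpha\otimes(f+\nu)|_{\mathfrak{a}}$, and these are the connections used. The shear is $\mathfrak{h}=\mathfrak{p}/\{(Z,Z)\mid Z\in\mathfrak{a}\}$, where $\mathfrak{p}=\mathfrak{g}\oplus\mathfrak{a}$ with $\mathfrak{a}=0\oplus\mathfrak{a}$ an Abelian ideal, $[Y_1,Y_2]_{\mathfrak{p}}=[Y_1,Y_2]_{\mathfrak{g}}-\omega(Y_1,Y_2)$ and $[Y,Z]_{\mathfrak{p}}=\eta(Y)Z$ for $Y,Y_1,Y_2\in\mathfrak{g}$, $Z\in 0\oplus\mathfrak{a}$. The composition $k\colon\mathfrak{g}\hookrightarrow\mathfrak{p}\to\mathfrak{h}$ is a linear isomorphism, and the $\mathcal{H}$-related (sheared) form of $\psi\in\Lambda^r\mathfrak{g}^*$ is $\psi_{\mathfrak{h}}=(k^{-1})^*\psi$. ''$(\mathrm{inc},\mathrm{id}_{\mathfrak{a}},\omega)$ shears $(\mathfrak{g},\varphi)$ to a cocalibrated structure'' means that it is left-invariant shear data and the $\mathrm{G}_2$-structure $\varphi_{\mathfrak{h}}$ on $\mathfrak{h}$ is cocalibrated, i.e. $d_{\mathfrak{h}}\bigl((\star_\varphi\varphi)_{\mathfrak{h}}\bigr)=0$. *)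

(* Defs.v *)
From HB Require Import structures.
From mathcomp Require Import all_boot all_order all_algebra.
From mathcomp Require Import perm reals complex.

Set Implicit Arguments.
Unset Strict Implicit.
Unset Printing Implicit Defensive.

Import Order.TTheory GRing.Theory Num.Theory.
Local Open Scope ring_scope.

(* Exterior algebra.  A k-form on V with values in W is a function
   ('I_k -> V) -> W satisfying [is_form]; real-valued forms have W = R^o. *)

Definition is_form (R : realType) (V W : vectType R) (k : nat)
    (b : ('I_k -> V) -> W) : Prop :=
  (forall (v : 'I_k -> V) (i : 'I_k) (c : R) (x y : V),
     b [eta v with i |-> c *: x + y]
     = c *: b [eta v with i |-> x] + b [eta v with i |-> y])
  /\ (forall (v : 'I_k -> V) (i j : 'I_k), i != j -> v i = v j -> b v = 0).

Definition fcat (V : Type) (k l : nat) (v : 'I_k -> V) (w : 'I_l -> V) :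
    'I_(k + l) -> V :=
  fun m => match split m with inl i => v i | inr j => w j end.

Definition interior (V W : Type) (k : nat) (x : V)
    (b : ('I_k.+1 -> V) -> W) : ('I_k -> V) -> W :=
  fun v => b (fcat (fun _ : 'I_1 => x) v).

(* Wedge product along a pairing [m], with the normalisation for which
   (a /\ b)(x, y) = m (a x) (b y) - m (a y) (b x) on one-forms. *)
Definition wedge (R : realType) (V : Type) (U1 U2 : Type) (W : vectType R)
    (k l : nat) (m : U1 -> U2 -> W)
    (b : ('I_k -> V) -> U1) (c : ('I_l -> V) -> U2) : ('I_(k + l) -> V) -> W :=
  fun v => ((k`! * l`!)%:R : R)^-1 *:
    \sum_(s : 'S_(k + l))
      ((-1) ^+ s : R) *: m (b (fun i => v (s (lshift l i))))
                           (c (fun j => v (s (rshift k j)))).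

Definition smul (R : realType) (c d : R^o) : R^o := c * d.

Definition vscale (R : realType) (V : vectType R) (c : R^o) (w : V) : V :=
  (c : R) *: w.

Definition form1 (V W : Type) (h : V -> W) : ('I_1 -> V) -> W :=
  fun v => h (v ord0).

(* Chevalley--Eilenberg differential (trivial coefficients):
   (d b)(v_0, .., v_{k+1})
     = \sum_(i < j) (-1)^(i+j) b([v_i, v_j], v_0, .. omit i, j .., v_{k+1}). *)
Definition dCE (R : realType) (V W : vectType R) (br : V -> V -> V) (k : nat)
    (b : ('I_k.+1 -> V) -> W) : ('I_k.+2 -> V) -> W :=
  fun v => \sum_(j < k.+2) \sum_(i < k.+1 | (i < j)%N)
    ((-1) ^+ (i + j) : R) *:
      interior (br (v (widen_ord (leqnSn k.+1) i)) (v j)) b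
               (fun m : 'I_k => v (lift j (lift i m))).

(* A.b, written [lie_act A b]: A acts on the arguments of b only. *)
Definition lie_act (R : realType) (V W : vectType R) (k : nat) (A : V -> V)
    (b : ('I_k -> V) -> W) : ('I_k -> V) -> W :=
  fun v => - \sum_(i < k) b [eta v with i |-> A (v i)].

Definition is_span_of_values (R : realType) (V W : vectType R) (k : nat)
    (b : ('I_k -> V) -> W) (I : {vspace W}) : Prop :=
  (forall v, b v \in I)
  /\ (forall I' : {vspace W}, (forall v, b v \in I') -> (I <= I')%VS).

(* S \otimes a, for a set S of real-valued k-forms. *)
Definition in_tensor (R : realType) (V W : vectType R) (k : nat)
    (S : (('I_k -> V) -> R^o) -> Prop) (a : {vspace W})
    (b : ('I_k -> V) -> W) : Prop :=
  exists (n : nat) (s : 'I_n -> ('I_k -> V) -> R^o) (A : 'I_n -> W),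
    (forall i, S (s i) /\ A i \in a)
    /\ (forall v, b v = \sum_(i < n) vscale (s i v) (A i)).

(* The contraction (b \otimes A) |-> interior A b on u-valued forms:
   b = \sum_i b^i \otimes u_i  for the basis u_i of u. *)
Definition kappa (R : realType) (V : vectType R) (u : {vspace V}) (k : nat)
    (b : ('I_k.+1 -> V) -> V) : ('I_k -> V) -> R^o :=
  fun v => \sum_(i < \dim u)
    interior (vbasis u)`_i (fun w => coord (vbasis u) i (b w) : R^o) v.

Definition trace_on (R : realType) (V : vectType R) (a : {vspace V})
    (A : V -> V) : R :=
  \sum_(i < \dim a) coord (vbasis a) i (A (vbasis a)`_i).

(* The metric and orientation for which the basis e is oriented orthonormal. *)

Definition metric (R : realType) (V : vectType R) (n : nat) (e : n.-tuple V)
    (x y : V) : R :=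
  \sum_(i < n) coord e i x * coord e i y.

Definition sharp (R : realType) (V : vectType R) (n : nat) (e : n.-tuple V)
    (theta : ('I_1 -> V) -> R^o) : V :=
  \sum_(i < n) vscale (theta (fun _ => e`_i)) e`_i.

Definition form_inner (R : realType) (V : vectType R) (n : nat)
    (e : n.-tuple V) (k : nat) (b c : ('I_k -> V) -> R^o) : R :=
  (k`!%:R)^-1 * \sum_(s : {ffun 'I_k -> 'I_n})
    (b (fun i => e`_(s i)) * c (fun i => e`_(s i)) : R).

Definition volume (R : realType) (V : vectType R) (n : nat) (e : n.-tuple V) :
    ('I_n -> V) -> R^o :=
  fun v => \det (\matrix_(i, j) coord e i (v j)).

(* Normalised by  b' /\ hodge e b = form_inner e b' b . volume e. *)
Definition hodge (R : realType) (V : vectType R) (k l : nat)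
    (e : (k + l).-tuple V) (b : ('I_k -> V) -> R^o) : ('I_l -> V) -> R^o :=
  fun v => (k`!%:R)^-1 * \sum_(s : {ffun 'I_k -> 'I_(k + l)})
    (b (fun i => e`_(s i)) : R) * volume e (fcat (fun i => e`_(s i)) v).

Definition is_orth (R : realType) (V : vectType R) (n : nat) (e : n.-tuple V)
    (x : V) (S : {vspace V}) : Prop :=
  forall y, y \in S -> metric e x y = 0.

(* e^{ijk}; as usual, indices are counted from 1. *)
Definition monomial (R : realType) (V : vectType R) (e : 7.-tuple V)
    (i j k : nat) (v : 'I_3 -> V) : R^o :=
  \det (\matrix_(r < 3, c < 3)
          coord e (inord (tnth [tuple i; j; k] r).-1) (v c)).

(* phi is a G_2-structure iff it admits such a basis, which is then oriented
   orthonormal for the induced metric and orientation.  The sign conventions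
   are those for which
     star phi = e^{1234} + e^{1256} + e^{3456}
                + (e^{136} + e^{145} + e^{235} - e^{246}) /\ e^7. *)
Definition G2_adapted_basis (R : realType) (V : vectType R)
    (phi : ('I_3 -> V) -> R^o) (e : 7.-tuple V) : Prop :=
  basis_of fullv e
  /\ (forall v : 'I_3 -> V,
       phi v = monomial e 1 2 7 v + monomial e 3 4 7 v
             + monomial e 5 6 7 v + monomial e 1 3 5 v
             - monomial e 1 4 6 v - monomial e 2 3 6 v
             - monomial e 2 4 5 v).

Definition is_lie_bracket (R : realType) (V : vectType R)
    (br : V -> V -> V) : Prop :=
  [/\ forall c x y z, br (c *: x + y) z = c *: br x z + br y z,
      forall c x y z, br z (c *: x + y) = c *: br z x + br z y,
      forall x, br x x = 0
    & forall x y z, br x (br y z) + br y (br z x) + br z (br x y) = 0].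

Definition is_codim1_abelian_ideal (R : realType) (V : vectType R)
    (br : V -> V -> V) (u : {vspace V}) : Prop :=
  [/\ (\dim u).+1 = \dim {:V},
      forall x y, y \in u -> br x y \in u
    & forall x y, x \in u -> y \in u -> br x y = 0].

Definition ad (R : realType) (V : vectType R) (br : V -> V -> V) (x : V) :
    'End(V) := linfun (br x).

(* Objects on u, extended to the whole space V = <X> (+) u.  Forms on u are the
   forms annihilated by X, endomorphisms of u are extended by X |-> 0. *)

Definition form_on (R : realType) (V W : vectType R) (X : V) (k : nat)
    (b : ('I_k -> V) -> W) : Prop :=
  is_form b /\ (forall v i, v i = X -> b v = 0).

Definition endo_on (R : realType) (V : vectType R) (X : V) (u : {vspace V})
    (A : 'End(V)) : Prop :=
  A X = 0 /\ (A @: u <= u)%VS.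

Definition in_sp (R : realType) (V : vectType R) (X : V) (u : {vspace V})
    (sigma : ('I_2 -> V) -> R^o) (A : 'End(V)) : Prop :=
  endo_on X u A /\ (forall v, lie_act A sigma v = 0).

Definition app2 (V W : Type) (b : ('I_2 -> V) -> W) (x y : V) : W :=
  b (tnth [tuple x; y]).

Definition app3 (V W : Type) (b : ('I_3 -> V) -> W) (x y z : V) : W :=
  b (tnth [tuple x; y; z]).

(* Complex bilinear extension; the pair (x, y) stands for x + i y. *)
Definition complex_ext (R : realType) (V : vectType R)
    (b : ('I_2 -> V) -> R^o) (z w : V * V) : R[i] :=
  Complex (app2 b z.1 w.1 - app2 b z.2 w.2 : R)
          (app2 b z.1 w.2 + app2 b z.2 w.1 : R).

(* b vanishes on pairs of (1,0)-vectors y - i J y and on pairs of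
   (0,1)-vectors y + i J y. *)
Definition is_type11 (R : realType) (V : vectType R) (u : {vspace V})
    (J : 'End(V)) (b : ('I_2 -> V) -> R^o) : Prop :=
  forall y z, y \in u -> z \in u ->
    complex_ext b (y, - J y) (z, - J z) = 0
    /\ complex_ext b (y, J y) (z, J z) = 0.

Definition is_primitive11 (R : realType) (V : vectType R) (X : V)
    (u : {vspace V}) (n : nat) (e : n.-tuple V) (J : 'End(V))
    (sigma b : ('I_2 -> V) -> R^o) : Prop :=
  [/\ form_on X b, is_type11 u J b & form_inner e b sigma = 0].

Definition is_degenerate_on (R : realType) (V : vectType R)
    (sigma : ('I_2 -> V) -> R^o) (a : {vspace V}) : Prop :=
  exists z, [/\ z \in a, z != 0 & forall w, w \in a -> app2 sigma z w = 0].

(* Shears.  The Lie algebra a is [subvs_of a], its inclusion is [vsval]. *)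

Definition restrict_endo (R : realType) (V : vectType R) (a : {vspace V})
    (A : 'End(V)) : 'End(subvs_of a) :=
  linfun (fun z : subvs_of a => vsproj a (A (vsval z))).

Definition tensor_endo (R : realType) (V W : vectType R)
    (alpha : 'Hom(V, R^o)) (A : 'End(W)) : 'Hom(V, 'End(W)) :=
  linfun (fun y => vscale (alpha y) A).

Definition is_flat (R : realType) (V W : vectType R) (br : V -> V -> V)
    (gam : 'Hom(V, 'End(W))) : Prop :=
  forall x y z, gam (br x y) z = gam x (gam y z) - gam y (gam x z).

(* Left-invariant shear data (inc, id_a, omega) with respect to the
   left-invariant connections given by gam (on E) and eta (on F).  The torsion
   condition is stated on left-invariant sections: both of its sides have the
   same defect of C^infty(G)-linearity, and these sections span. *)
Definition is_shear_data (R : realType) (V : vectType R) (br : V -> V -> V)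
    (a : {vspace V}) (omega : ('I_2 -> V) -> subvs_of a)
    (gam eta : 'Hom(V, 'End(subvs_of a))) : Prop :=
  [/\ is_form omega /\ is_flat br gam /\ is_flat br eta,
      (forall z1 z2 : subvs_of a,
        vsval (gam (vsval z1) z2 - gam (vsval z2) z1)
        = br (vsval z1) (vsval z2))
      /\ (forall v : 'I_3 -> V,
        dCE br omega v
        + wedge (fun (A : 'End(subvs_of a)) z => A z) (form1 eta) omega v = 0),
      forall y (z : subvs_of a), gam y z = app2 omega (vsval z) y + eta y z,
      forall z1 z2 : subvs_of a, app2 omega (vsval z1) (vsval z2) = 0
    & forall (z : subvs_of a) y, br (vsval z) y = - vsval (gam y z)].

Definition p_bracket (R : realType) (V : vectType R) (br : V -> V -> V)
    (a : {vspace V}) (omega : ('I_2 -> V) -> subvs_of a)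
    (eta : 'Hom(V, 'End(subvs_of a))) (p q : V * subvs_of a) :
    V * subvs_of a :=
  (br p.1 q.1, - app2 omega p.1 q.1 + eta p.1 q.2 - eta q.1 p.2).

(* (h, brh), with projection pi, is the quotient of p by {(Z, Z) | Z \in a}. *)
Definition is_shear (R : realType) (V : vectType R) (br : V -> V -> V)
    (a : {vspace V}) (omega : ('I_2 -> V) -> subvs_of a)
    (eta : 'Hom(V, 'End(subvs_of a)))
    (h : vectType R) (brh : h -> h -> h)
    (pi : 'Hom((V * subvs_of a)%type, h)) : Prop :=
  [/\ is_lie_bracket brh,
      limg pi = fullv,
      forall p, pi p = 0 <-> p.1 = vsval p.2
    & forall p q, pi (p_bracket br omega eta p q) = brh (pi p) (pi q)].

Definition shear_map (R : realType) (V : vectType R) (a : {vspace V})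
    (h : vectType R) (pi : 'Hom((V * subvs_of a)%type, h)) : 'Hom(V, h) :=
  linfun (fun y => pi (y, 0)).

(* The pull-back of psi by the inverse of [shear_map pi]. *)
Definition sheared_form (R : realType) (V : vectType R) (a : {vspace V})
    (h : vectType R) (pi : 'Hom((V * subvs_of a)%type, h)) (k : nat)
    (psi : ('I_k -> V) -> R^o) : ('I_k -> h) -> R^o :=
  fun v => psi (fun i => ((shear_map pi)^-1)%VF (v i)).

Definition shears_to_cocalibrated (R : realType) (V : vectType R)
    (br : V -> V -> V) (phi : ('I_3 -> V) -> R^o) (e : 7.-tuple V)
    (a : {vspace V}) (omega : ('I_2 -> V) -> subvs_of a)
    (gam eta : 'Hom(V, 'End(subvs_of a))) : Prop :=
  is_shear_data br omega gam eta
  /\ exists (h : vectType R) (brh : h -> h -> h)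
            (pi : 'Hom((V * subvs_of a)%type, h)),
       is_shear br omega eta brh pi
       /\ (forall v, dCE brh (sheared_form pi (@hodge R V 3 4 e phi)) v = 0).

(* Main.v *)
Require Import Defs.
From HB Require Import structures.
From mathcomp Require Import all_boot all_order all_algebra.
From mathcomp Require Import perm reals complex.
From mathcomp Require Import boolp.
From mathcomp Require Import ring lra.

Set Implicit Arguments.
Unset Strict Implicit.
Unset Printing Implicit Defensive.

Import Order.TTheory GRing.Theory Num.Theory.
Local Open Scope ring_scope.

(** Write star phi = Q + rho /\ alpha with Q = sigma^2 / 2. The shear is
    isomorphic to g with the bracket [x, y]' = [x, y] + omega (x, y), through
    the projection (y, z) |-> y - z of the extension p. This bracket restricts
    to omega_0 on u and satisfies ad'(X) = f + nu. Hence the condition on the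
    shear data is the Jacobi identity of the new bracket, and the sheared
    four-form is closed iff its differential vanishes both on u and after
    contraction with X. This gives three equations on u ([shears_iff]):
    - (S) (f + nu) (omega_0 (x, y)) = omega_0 (f x, y) + omega_0 (x, f y);
    - (A) the alternating sum of the Q (omega_0 (x_i, x_j), ...) over the
      pairs taken from five arguments is zero;
    - (B) (nu.sigma) /\ sigma is the alternating sum of the
      rho (omega_0 (x_i, x_j), ...) over the pairs taken from four arguments.
    The same computation for omega = 0 turns the hypothesis on phi into
    (f.sigma) /\ sigma = 0. Wedging with sigma is injective on the two-forms
    of the six-dimensional space u ([lefschetz_inj]); therefore f lies in
    sp (u, sigma), and (B) determines nu modulo sp (u, sigma) ([tau_eq]).

    The G_2-structure enters the frame computations only through three facts:
    J is a complex structure on u, it is skew for the metric, and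
    rho (J x, y, z) = rho (x, J y, z). They come from the cross product x * y
    defined by <x * y, z> = phi (x, y, z): a computation on basis vectors gives
    star phi (x, y, z, w) = <x * y, z * w> - <x, z> <y, w> + <x, w> <y, z>,
    and putting z = x yields the norm identity for the cross product
    ([cross_norm]), so that X * _ is an orthogonal complex structure on u. The
    two-form sigma is determined up to sign by sigma^2 = 2 star phi on u,
    whence J is X * _ or its opposite ([J_eq_J0]); and rho is star phi
    contracted with X.

    All three parts of the theorem are then read off in a unitary frame
    b_0, b_1 = J b_0, b_2, b_3 = J b_2, b_4, b_5 = J b_4 of u whose first
    vector is a unit vector of im omega_0.

    If dim a = 4, then omega_0 descends to the plane u / a and has a single
    component. If J (im omega_0) is orthogonal to a, the frame can be chosen
    with a = <b_0, b_3, b_4, b_5>. If J (im omega_0) lies in a, equation (A)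
    makes the orthogonal complement of <b_0, b_1> in a totally real, hence a
    degenerate; the frame can then be chosen with a = <b_0, b_1, b_3, b_5>. In
    both situations (A) holds, (S) only concerns the value of f + nu at b_0
    because f is traceless on each complex line of the frame, and (B) is solved
    by one explicit endomorphism.

    If omega_0 is primitive of type (1,1), its components are anti-self-dual
    forms of <b_2, ..., b_5>, because they are annihilated by b_0. A nonzero
    such form is nondegenerate there, so a is contained in <b_0, b_1>. Now (A)
    holds, the right-hand side of (B) is zero, and (S) is left. The algebra
    sp (u, sigma) acts on anti-self-dual forms by skew endomorphisms for the
    wedge product ([asd_skew]): if omega_0 has one component up to scale, f
    annihilates it ([jacobi_line]), and if it has two independent ones, f
    rotates an orthogonal pair ([jacobi_plane]). *)

(** * Forms of small arity and their wedge products *)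

Section SmallArity.

Variables (R : realType) (V W : vectType R).

Definition ofl (n : nat) (l : seq V) : 'I_n -> V := fun i => nth 0 l i.

Definition app4 (T : Type) (b : ('I_4 -> V) -> T) (x y z w : V) : T :=
  b (tnth [tuple x; y; z; w]).

Lemma fun2E (T : Type) (b : ('I_2 -> V) -> T) (h : 'I_2 -> V) :
  b h = app2 b (h ord0) (h (lift ord0 ord0)).
Proof.
congr b; apply: funext => i; rewrite (tnth_nth 0).
by case: i => [[|[|//]] p] /=; congr h; apply: val_inj.
Qed.

Lemma fun3E (T : Type) (b : ('I_3 -> V) -> T) (h : 'I_3 -> V) :
  b h = app3 b (h ord0) (h (lift ord0 ord0)) (h (lift ord0 (lift ord0 ord0))).
Proof.
congr b; apply: funext => i; rewrite (tnth_nth 0).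
by case: i => [[|[|[|//]]] p] /=; congr h; apply: val_inj.
Qed.

Lemma fun4E (T : Type) (b : ('I_4 -> V) -> T) (h : 'I_4 -> V) :
  b h = app4 b (h ord0) (h (lift ord0 ord0)) (h (lift ord0 (lift ord0 ord0)))
           (h (lift ord0 (lift ord0 (lift ord0 ord0)))).
Proof.
congr b; apply: funext => i; rewrite (tnth_nth 0).
by case: i => [[|[|[|[|//]]]] p] /=; congr h; apply: val_inj.
Qed.

Lemma fcat_ord0 n (x : V) (v : 'I_n -> V) : fcat (fun _ : 'I_1 => x) v ord0 = x.
Proof.
rewrite /fcat; case: splitP => [//|k]; by [].
Qed.

Lemma fcat_lift n (x : V) (v : 'I_n -> V) i :
  fcat (fun _ : 'I_1 => x) v (lift ord0 i) = v i.
Proof.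
rewrite /fcat; case: splitP => [j|k]; first by rewrite (ord1 j).
by rewrite lift0 => -[] /val_inj ->.
Qed.

(** A permutation of n+1 letters is the image of 0 together with a permutation
    of n letters; this recursion makes the sum defining a wedge product computable. *)
Lemma sum_perm_recl n (F : 'S_n.+1 -> W) :
  \sum_s F s = \sum_(i < n.+1) \sum_(t : 'S_n) F (lift_perm ord0 i t).
Proof.
rewrite pair_big /= (reindex (fun p => lift_perm ord0 p.1 p.2)) //=.
apply: onW_bij; apply: inj_card_bij => [[i s] [j t] /= E|]; last first.
  by rewrite card_prod card_ord !card_Sn factS.
have ij : i = j by rewrite -(lift_perm_id ord0 i s) E lift_perm_id.
congr (_, _) => //; rewrite -ij in E; apply/permP=> k; apply: (@lift_inj _ i).
by rewrite -!(lift_perm_lift ord0) E.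
Qed.

(** The alternating sum over the permutations of a list, unfolded along its
    first entry so that it reduces to an explicit expression on a list of known
    length. *)
Fixpoint altl (n : nat) (l : seq V) (G : seq V -> W) : W :=
  if n is m.+1 then
    foldr (fun i acc => ((-1) ^+ i : R) *:
             altl m (take i l ++ drop i.+1 l) (fun l' => G (nth 0 l i :: l'))
             + acc) 0 (iota 0 n)
  else G [::].

Lemma nth_take_drop (l : seq V) i j : (i < size l)%N ->
  nth 0 (take i l ++ drop i.+1 l) j = nth 0 l (bump i j).
Proof.
move=> il; rewrite nth_cat size_take il /bump; case: ltnP => ij.
  by rewrite nth_take // leqNgt ij.
by rewrite nth_drop; congr nth; rewrite /= addSn add1n subnKC.
Qed.

Lemma sum_perm_altl n (l : seq V) (G : ('I_n -> V) -> W) : size l = n ->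
  \sum_(s : 'S_n) ((-1) ^+ s : R) *: G (fun i => nth 0 l (s i))
  = altl n l (fun l' => G (ofl l')).
Proof.
elim: n l G => [|n IH] l G sl.
  have U (t : 'S_0) : t = 1%g by apply/permP => -[].
  rewrite (bigD1 (1%g : 'S_0)) //= big1 ?addr0 => [|t]; last by rewrite (U t) eqxx.
  by rewrite odd_perm1 expr0 scale1r; congr G; apply: funext => -[].
rewrite sum_perm_recl.
transitivity (\sum_(i < n.+1) ((-1) ^+ i : R) *:
   altl n (take i l ++ drop i.+1 l) (fun l' => G (ofl (nth 0 l i :: l')))).
  apply: eq_bigr => i _.
  have il : (i < size l)%N by rewrite sl.
  have sl' : size (take i l ++ drop i.+1 l) = n.
    by rewrite size_cat size_take il size_drop sl subSS subnKC // -ltnS.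
  pose G' (h : 'I_n -> V) := G (fun k => if unlift ord0 k is Some k' then h k' else nth 0 l i).
  transitivity (((-1) ^+ i : R) *: \sum_(t : 'S_n) ((-1) ^+ t : R) *:
     G' (fun k => nth 0 (take i l ++ drop i.+1 l) (t k))).
    rewrite scaler_sumr; apply: eq_bigr => t _.
    rewrite scalerA odd_lift_perm /= signr_addb signr_odd; congr (_ *: _).
    rewrite /G'; congr G; apply: funext => k.
    case: unliftP => [k'|] ->; first by rewrite lift_perm_lift nth_take_drop.
    by rewrite lift_perm_id.
  rewrite IH //; congr (_ *: altl _ _ _); apply: funext => l'.
  rewrite /G'; congr G; apply: funext => k.
  by case: unliftP => [k'|] ->; rewrite /ofl ?lift0.
rewrite [RHS]/= -/(iota 0 n.+1).
have -> : iota 1 n = behead (iota 0 n.+1) by [].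
rewrite -(big_mkord xpredT (fun i => ((-1) ^+ i : R) *:
   altl n (take i l ++ drop i.+1 l) (fun l' => G (ofl (nth 0 l i :: l'))))).
rewrite big_ltn // drop1 take0 /=; congr (_ + _).
rewrite /index_iota subSS subn0; elim: (iota 1 n) => [|k s IHs]; rewrite ?big_nil //=.
by rewrite big_cons IHs.
Qed.

(** Turns a wedge product evaluated at explicit vectors into the computable
    alternating sum; all the formulas below follow by simplification. *)
Lemma wedge_ofl (U1 U2 : Type) k l (m : U1 -> U2 -> W)
    (b : ('I_k -> V) -> U1) (c : ('I_l -> V) -> U2) (s : seq V) :
  size s = (k + l)%N ->
  wedge m b c (ofl s)
  = ((k`! * l`!)%:R : R)^-1 *: altl (k + l) s (fun s' =>
      m (b (fun i => nth 0 s' (lshift l i))) (c (fun j => nth 0 s' (rshift k j)))).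
Proof.
move=> ss; rewrite /wedge; congr (_ *: _).
exact: (@sum_perm_altl _ s (fun h => m (b (fun i => h (lshift l i))) (c (fun j => h (rshift k j))))).
Qed.

End SmallArity.

Section Alternating.
Variables (R : realType) (V W : vectType R).

Lemma form_swap k (b : ('I_k -> V) -> W) : is_form b ->
  forall (v : 'I_k -> V) (i j : 'I_k), i != j ->
  b [eta v with i |-> v j, j |-> v i] = - b v.
Proof.
case=> bL bA v i j ij; apply/eqP; rewrite -addr_eq0; apply/eqP.
pose F x y := b [eta v with i |-> x, j |-> y].
have FL c x y z : F (c *: x + y) z = c *: F x z + F y z.
  have := bL [eta v with j |-> z] i c x y.
  have E t : ([eta [eta v with j |-> z] with i |-> t] : 'I_k -> V) = [eta v with i |-> t, j |-> z].
    by apply: funext.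
  by rewrite !E.
have FR c x y z : F z (c *: x + y) = c *: F z x + F z y.
  have := bL [eta v with i |-> z] j c x y.
  have E t : ([eta [eta v with i |-> z] with j |-> t] : 'I_k -> V) = [eta v with i |-> z, j |-> t].
    apply: funext => k0 /=; case: eqP => [->|//].
    by rewrite eq_sym (negbTE ij).
  by rewrite !E.
have FA x : F x x = 0.
  by apply: (bA _ i j ij); rewrite /= eqxx eq_sym (negbTE ij) eqxx.
have FD x y z : F (x + y) z = F x z + F y z by rewrite -[x in LHS]scale1r FL scale1r.
have FDr x y z : F z (x + y) = F z x + F z y by rewrite -[x in LHS]scale1r FR scale1r.
have -> : b v = F (v i) (v j).
  rewrite /F; congr b; apply: funext => k0 /=.
  by case: eqP => [->|_]//; case: eqP => [->|].
have := FA (v j + v i); rewrite FD !FDr !FA add0r addr0.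
by [].
Qed.

End Alternating.

Section FormRules.

Variables (R : realType) (V W : vectType R).

Lemma set2_0 (x y z : V) :
  ([eta tnth [tuple x; y] with ord0 |-> z] : 'I_2 -> V) = tnth [tuple z; y].
Proof. by apply: funext => -[[|[|//]] p]; rewrite !(tnth_nth 0). Qed.

Lemma set2_1 (x y z : V) :
  ([eta tnth [tuple x; y] with lift ord0 ord0 |-> z] : 'I_2 -> V) = tnth [tuple x; z].
Proof. by apply: funext => -[[|[|//]] p]; rewrite !(tnth_nth 0). Qed.

Lemma set3_0 (x y z t : V) :
  ([eta tnth [tuple x; y; z] with ord0 |-> t] : 'I_3 -> V) = tnth [tuple t; y; z].
Proof. by apply: funext => -[[|[|[|//]]] p]; rewrite !(tnth_nth 0). Qed.

Lemma set4_0 (x y z w t : V) :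
  ([eta tnth [tuple x; y; z; w] with ord0 |-> t] : 'I_4 -> V) = tnth [tuple t; y; z; w].
Proof. by apply: funext => -[[|[|[|[|//]]]] p]; rewrite !(tnth_nth 0). Qed.

Lemma is_form2 (b : ('I_2 -> V) -> W) :
  (forall c x y z, app2 b (c *: x + y) z = c *: app2 b x z + app2 b y z) ->
  (forall c x y z, app2 b z (c *: x + y) = c *: app2 b z x + app2 b z y) ->
  (forall x, app2 b x x = 0) -> is_form b.
Proof.
move=> bL bR bA; have C (i : 'I_2) : i = ord0 \/ i = lift ord0 ord0.
  by case: i => [[|[|//]] p]; [left | right]; apply: val_inj.
split=> [v i c x y|v i j ij vij]; rewrite !(fun2E b).
  by case: (C i) => ->; rewrite /= ?bL ?bR.
have -> : v ord0 = v (lift ord0 ord0); last exact: bA.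
by case: (C i) (C j) ij vij => -> [->|->].
Qed.

Section Form2.
Variables (b : ('I_2 -> V) -> W).
Hypothesis (bF : is_form b).

Lemma form2_lin c x y z :
  app2 b (c *: x + y) z = c *: app2 b x z + app2 b y z.
Proof.
have := bF.1 (tnth [tuple x; z]) ord0 c x y.
by rewrite !set2_0.
Qed.

Lemma form2_alt x : app2 b x x = 0.
Proof. exact: (bF.2 (tnth [tuple x; x]) ord0 (lift ord0 ord0)). Qed.

Lemma form2_linr c x y z :
  app2 b z (c *: x + y) = c *: app2 b z x + app2 b z y.
Proof.
have := bF.1 (tnth [tuple z; x]) (lift ord0 ord0) c x y.
by rewrite !set2_1.
Qed.

Lemma form2C x y : app2 b y x = - app2 b x y.
Proof.
rewrite /app2 -(form_swap bF (tnth [tuple x; y]) (i := ord0) (j := lift ord0 ord0)) //.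
by congr b; apply: funext => -[[|[|//]] p]; rewrite /= !(tnth_nth 0).
Qed.

End Form2.

Section Form3.
Variables (b : ('I_3 -> V) -> W).
Hypothesis (bF : is_form b).

Lemma form3_lin c x y z t :
  app3 b (c *: x + y) z t = c *: app3 b x z t + app3 b y z t.
Proof.
have := bF.1 (tnth [tuple x; z; t]) ord0 c x y.
by rewrite !set3_0.
Qed.

End Form3.

End FormRules.

Section Rules3.
Variables (R : realType) (V W : vectType R) (b : ('I_3 -> V) -> W).
Hypothesis (bF : is_form b).

Lemma form3C x y z : app3 b y x z = - app3 b x y z.
Proof.
rewrite /app3 -(form_swap bF (tnth [tuple x; y; z]) (i := ord0) (j := lift ord0 ord0)) //.
by congr b; apply: funext => -[[|[|[|//]]] p]; rewrite /= !(tnth_nth 0).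
Qed.

Lemma form3Cr x y z : app3 b x z y = - app3 b x y z.
Proof.
rewrite /app3 -(form_swap bF (tnth [tuple x; y; z]) (i := lift ord0 ord0)
  (j := lift ord0 (lift ord0 ord0))) //.
by congr b; apply: funext => -[[|[|[|//]]] p]; rewrite /= !(tnth_nth 0).
Qed.

Lemma form3S x y z :
  (app3 b y x z = - app3 b x y z) * (app3 b x z y = - app3 b x y z)
  * (app3 b y z x = app3 b x y z) * (app3 b z x y = app3 b x y z)
  * (app3 b z y x = - app3 b x y z).
Proof.
have e1 := form3C; have e2 := form3Cr.
do !split => //; rewrite ?(e1 z y x, e2 y x z, e1 x y z) ?opprK //.
- by rewrite e2 e1 opprK.
- by rewrite e1 e2 opprK.
- by rewrite e1 e2 e1 opprK.
Qed.

End Rules3.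

Section Wedges.
Variables (R : realType) (V W : vectType R).

Lemma tnth_ofl n (t : n.-tuple V) : tnth t = ofl t.
Proof. by apply: funext => i; rewrite (tnth_nth 0). Qed.

Lemma wedge11E (U1 U2 : Type) (m : U1 -> U2 -> W) (p : V -> U1) (q : V -> U2) x y :
  app2 (wedge m (form1 p) (form1 q)) x y = m (p x) (q y) - m (p y) (q x).
Proof.
rewrite /app2 tnth_ofl wedge_ofl //= /form1 /= !expr0 !expr1 !invr1 !scale1r.
by rewrite !addr0 scaleN1r.
Qed.

Lemma wedge22E (s t : ('I_2 -> V) -> R^o) x y z w : is_form s -> is_form t ->
  app4 (wedge (@smul R) s t) x y z w
  = app2 s x y * app2 t z w - app2 s x z * app2 t y w + app2 s x w * app2 t y z
  + app2 s z w * app2 t x y - app2 s y w * app2 t x z + app2 s y z * app2 t x w :> R.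
Proof.
move=> sF tF; rewrite /app4 tnth_ofl wedge_ofl //=.
rewrite !(fun2E s) !(fun2E t) /= !expr0 !expr1 !scale1r !addr0.
rewrite (form2C sF x y) (form2C sF x z) (form2C sF x w) (form2C sF y z) (form2C sF y w) (form2C sF z w).
rewrite (form2C tF x y) (form2C tF x z) (form2C tF x w) (form2C tF y z) (form2C tF y w) (form2C tF z w).
move: (app2 s x y) (app2 s x z) (app2 s x w) (app2 s y z) (app2 s y w) (app2 s z w) => a1 a2 a3 a4 a5 a6.
move: (app2 t x y) (app2 t x z) (app2 t x w) (app2 t y z) (app2 t y w) (app2 t z w) => b1 b2 b3 b4 b5 b6.
rewrite /smul /factorial /= /GRing.scale /=.
by field.
Qed.

Definition app5 (T : Type) (b : ('I_5 -> V) -> T) (x y z w t : V) : T :=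
  b (tnth [tuple x; y; z; w; t]).

Lemma wedge31E (r : ('I_3 -> V) -> R^o) (p : V -> R^o) x y z w : is_form r ->
  app4 (wedge (@smul R) r (form1 p)) x y z w
  = app3 r x y z * p w - app3 r x y w * p z + app3 r x z w * p y
  - app3 r y z w * p x :> R.
Proof.
move=> rF; rewrite /app4 tnth_ofl wedge_ofl //=.
rewrite !(fun3E r) /= !expr0 !expr1 !scale1r !addr0 /form1 /=.
rewrite !(form3S rF x y z, form3S rF x y w, form3S rF x z w, form3S rF y z w).
move: (app3 r x y z) (app3 r x y w) (app3 r x z w) (app3 r y z w) (p x) (p y) (p z) (p w).
move=> a1 a2 a3 a4 b1 b2 b3 b4.
rewrite /smul /factorial /= /GRing.scale /=.
by field.
Qed.

Lemma wedge12E (A : V -> 'End(W)) (om : ('I_2 -> V) -> W) x y z : is_form om ->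
  app3 (wedge (fun (A : 'End(W)) z => A z) (form1 A) om) x y z
  = A x (app2 om y z) - A y (app2 om x z) + A z (app2 om x y).
Proof.
move=> oF; rewrite /app3 tnth_ofl wedge_ofl //=.
rewrite !(fun2E om) /= !expr0 !expr1 !scale1r !addr0 /form1 /=.
rewrite (form2C oF x y) (form2C oF x z) (form2C oF y z) !linearN /= !scaleN1r !opprK.
rewrite sqrrN expr1n scale1r -!mulr2n -mulNrn -!mulrnDl -scaler_nat scalerA.
by rewrite mulVf ?pnatr_eq0 // scale1r addrA.
Qed.

Lemma dCE2E (br : V -> V -> V) (om : ('I_2 -> V) -> W) x y z :
  app3 (dCE br om) x y z
  = - app2 om (br x y) z + app2 om (br x z) y - app2 om (br y z) x.
Proof.
rewrite /app3 tnth_ofl /dCE.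
under eq_bigr do rewrite big_mkcond.
rewrite !big_ord_recl !big_ord0 /= /interior !(fun2E om) !fcat_ord0 !fcat_lift /=.
rewrite /bump /= !expr1 !addr0 !add0r !scaleN1r.
by rewrite sqrrN expr1n scale1r -signr_odd expr1 scaleN1r addrA.
Qed.

Lemma dCE4E (br : V -> V -> V) (b : ('I_4 -> V) -> R^o) x1 x2 x3 x4 x5 :
  app5 (dCE br b) x1 x2 x3 x4 x5
  = - app4 b (br x1 x2) x3 x4 x5 + app4 b (br x1 x3) x2 x4 x5
    - app4 b (br x1 x4) x2 x3 x5 + app4 b (br x1 x5) x2 x3 x4
    - app4 b (br x2 x3) x1 x4 x5 + app4 b (br x2 x4) x1 x3 x5
    - app4 b (br x2 x5) x1 x3 x4 - app4 b (br x3 x4) x1 x2 x5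
    + app4 b (br x3 x5) x1 x2 x4 - app4 b (br x4 x5) x1 x2 x3 :> R.
Proof.
rewrite /app5 tnth_ofl /dCE.
under eq_bigr do rewrite big_mkcond.
rewrite !big_ord_recl !big_ord0 /= /interior !(fun4E b) !fcat_ord0 !fcat_lift /=.
rewrite /bump /= /GRing.scale /=.
by ring.
Qed.

Lemma wedge23E (s : ('I_2 -> V) -> R^o) (r : ('I_3 -> V) -> R^o) x1 x2 x3 x4 x5 :
  is_form s -> is_form r ->
  app5 (wedge (@smul R) s r) x1 x2 x3 x4 x5
  = app2 s x1 x2 * app3 r x3 x4 x5 - app2 s x1 x3 * app3 r x2 x4 x5
  + app2 s x1 x4 * app3 r x2 x3 x5 - app2 s x1 x5 * app3 r x2 x3 x4
  + app2 s x2 x3 * app3 r x1 x4 x5 - app2 s x2 x4 * app3 r x1 x3 x5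
  + app2 s x2 x5 * app3 r x1 x3 x4 + app2 s x3 x4 * app3 r x1 x2 x5
  - app2 s x3 x5 * app3 r x1 x2 x4 + app2 s x4 x5 * app3 r x1 x2 x3 :> R.
Proof.
move=> sF rF; rewrite /app5 tnth_ofl wedge_ofl //.
set G := (G in altl _ _ G).
have -> : G = fun l => smul (app2 s l`_0 l`_1) (app3 r l`_2 l`_3 l`_4).
  by apply: funext => l; rewrite /G fun2E fun3E.
rewrite /=.
rewrite !(form3S rF x1 x2 x3, form3S rF x1 x2 x4, form3S rF x1 x2 x5,
  form3S rF x1 x3 x4, form3S rF x1 x3 x5, form3S rF x1 x4 x5, form3S rF x2 x3 x4,
  form3S rF x2 x3 x5, form3S rF x2 x4 x5, form3S rF x3 x4 x5).
rewrite !(form2C sF x1 x2, form2C sF x1 x3, form2C sF x1 x4, form2C sF x1 x5,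
  form2C sF x2 x3, form2C sF x2 x4, form2C sF x2 x5, form2C sF x3 x4,
  form2C sF x3 x5, form2C sF x4 x5).
move: (app3 r x1 x2 x3) (app3 r x1 x2 x4) (app3 r x1 x2 x5) (app3 r x1 x3 x4)
  (app3 r x1 x3 x5) (app3 r x1 x4 x5) (app3 r x2 x3 x4) (app3 r x2 x3 x5)
  (app3 r x2 x4 x5) (app3 r x3 x4 x5) => a1 a2 a3 a4 a5 a6 a7 a8 a9 a10.
move: (app2 s x1 x2) (app2 s x1 x3) (app2 s x1 x4) (app2 s x1 x5) (app2 s x2 x3)
  (app2 s x2 x4) (app2 s x2 x5) (app2 s x3 x4) (app2 s x3 x5) (app2 s x4 x5)
  => b1 b2 b3 b4 b5 b6 b7 b8 b9 b10.
rewrite /smul /factorial /= /GRing.scale /=.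
by field.
Qed.

End Wedges.

(** * The metric of an orthonormal basis *)

Section Metric.

Variables (R : realType) (V : vectType R) (n : nat) (e : n.-tuple V).
Hypothesis (eB : basis_of fullv e).

Lemma metricC x y : metric e x y = metric e y x.
Proof. by apply: eq_bigr => i _; rewrite mulrC. Qed.

Lemma metricDl x y z : metric e (x + y) z = metric e x z + metric e y z.
Proof. by rewrite -big_split; apply: eq_bigr => i _; rewrite linearD mulrDl. Qed.

Lemma metricZl c x z : metric e (c *: x) z = c * metric e x z.
Proof. by rewrite mulr_sumr; apply: eq_bigr => i _; rewrite linearZ /= mulrA. Qed.

Lemma metricDr x y z : metric e z (x + y) = metric e z x + metric e z y.
Proof. by rewrite !(metricC z) metricDl. Qed.

Lemma metricZr c x z : metric e z (c *: x) = c * metric e z x.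
Proof. by rewrite !(metricC z) metricZl. Qed.

Lemma metric0l z : metric e 0 z = 0.
Proof. by have := metricZl 0 0 z; rewrite scale0r mul0r. Qed.

Lemma metric0r z : metric e z 0 = 0.
Proof. by rewrite metricC metric0l. Qed.

Lemma metricNl x z : metric e (- x) z = - metric e x z.
Proof. by rewrite -scaleN1r metricZl mulN1r. Qed.

Lemma metricNr x z : metric e z (- x) = - metric e z x.
Proof. by rewrite metricC metricNl metricC. Qed.

Definition metricE := (metricDl, metricDr, metricZl, metricZr, metricNl, metricNr,
  metric0l, metric0r).

Lemma metric_suml m (F : 'I_m -> V) z :
  metric e (\sum_i F i) z = \sum_i metric e (F i) z.
Proof.
by apply: (big_morph (fun x => metric e x z)); [move=> x y; rewrite metricDl|rewrite metric0l].
Qed.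

Lemma coord_self (i j : 'I_n) : coord e i e`_j = (i == j)%:R.
Proof. by rewrite eq_sym; apply: coord_free; exact: basis_free eB. Qed.

Lemma coord_metric i x : coord e i x = metric e e`_i x.
Proof.
rewrite /metric (bigD1 i) //= coord_self eqxx mul1r big1 ?addr0 // => j ji.
by rewrite coord_self (negbTE ji) mul0r.
Qed.

Lemma coord_expand x : x = \sum_i coord e i x *: e`_i.
Proof. exact: (coord_basis eB (memvf x)). Qed.

Lemma metric_ge0 x : 0 <= metric e x x.
Proof. by apply: sumr_ge0 => i _; rewrite -expr2 sqr_ge0. Qed.

Lemma metric_eq0 x : metric e x x = 0 -> x = 0.
Proof.
move=> /eqP; rewrite psumr_eq0 => [/allP x0|i _]; last by rewrite -expr2 sqr_ge0.
rewrite [x]coord_expand big1 // => i _.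
by have := x0 i (mem_index_enum i); rewrite /= -expr2 sqrf_eq0 => /eqP ->; rewrite scale0r.
Qed.

(** Identities between vectors are proved below by pairing both sides with a
    test vector, which reduces them to polynomial identities. *)
Lemma metric_inj x y : (forall z, metric e x z = metric e y z) -> x = y.
Proof.
move=> E; apply/eqP; rewrite -subr_eq0; apply/eqP; apply: metric_eq0.
by rewrite metricDl metricNl E subrr.
Qed.

Lemma metric_sharp (t : ('I_1 -> V) -> R^o) z :
  (forall c x y, t (fun=> c *: x + y) = c * t (fun=> x) + t (fun=> y) :> R) ->
  metric e (sharp e t) z = t (fun=> z).
Proof.
move=> tl.
have t0 : t (fun=> 0) = 0 :> R.
  have := tl 1 0 0; rewrite scaler0 addr0 mul1r => E.
  by apply: (addrI (t (fun=> 0) : R)); rewrite addr0 -E.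
have tD x y : t (fun=> x + y) = t (fun=> x) + t (fun=> y) :> R.
  by rewrite -[x in LHS]scale1r tl mul1r.
have tZ c x : t (fun=> c *: x) = c * t (fun=> x) :> R.
  by rewrite -[c *: x]addr0 tl t0 addr0.
rewrite /sharp metric_suml [z in RHS]coord_expand.
rewrite (big_morph (fun x => t (fun=> x) : R) tD t0); apply: eq_bigr => i _.
by rewrite /vscale metricZl tZ coord_metric mulrC.
Qed.

End Metric.

Section Forms4.
Variables (R : realType) (V W : vectType R) (b : ('I_4 -> V) -> W).
Hypothesis (bF : is_form b).

Lemma form4C0 x y z w : app4 b y x z w = - app4 b x y z w.
Proof.
rewrite /app4 -(form_swap bF (tnth [tuple x; y; z; w]) (i := ord0) (j := lift ord0 ord0)) //.
by congr b; apply: funext => -[[|[|[|[|//]]]] p]; rewrite /= !(tnth_nth 0).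
Qed.

Lemma form4C1 x y z w : app4 b x z y w = - app4 b x y z w.
Proof.
rewrite /app4 -(form_swap bF (tnth [tuple x; y; z; w]) (i := lift ord0 ord0)
  (j := lift ord0 (lift ord0 ord0))) //.
by congr b; apply: funext => -[[|[|[|[|//]]]] p]; rewrite /= !(tnth_nth 0).
Qed.

Lemma form4C2 x y z w : app4 b x y w z = - app4 b x y z w.
Proof.
rewrite /app4 -(form_swap bF (tnth [tuple x; y; z; w]) (i := lift ord0 (lift ord0 ord0))
  (j := lift ord0 (lift ord0 (lift ord0 ord0)))) //.
by congr b; apply: funext => -[[|[|[|[|//]]]] p]; rewrite /= !(tnth_nth 0).
Qed.

Lemma form4_lin c x y z t w :
  app4 b (c *: x + y) z t w = c *: app4 b x z t w + app4 b y z t w.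
Proof.
have := bF.1 (tnth [tuple x; z; t; w]) ord0 c x y.
by rewrite !set4_0.
Qed.

End Forms4.

Section SortedBasis.
Variables (R : realType) (V : vectType R) (n : nat) (e : n.-tuple V).
Hypothesis (eB : basis_of fullv e).

Lemma lin_expand (F : V -> R) :
  (forall c x y, F (c *: x + y) = c * F x + F y) ->
  forall x, F x = \sum_i coord e i x * F e`_i.
Proof.
move=> FL x; have F0 : F 0 = 0.
  have := FL 1 0 0; rewrite scaler0 addr0 mul1r => E.
  by apply: (addrI (F 0)); rewrite addr0 -E.
have FD y z : F (y + z) = F y + F z by rewrite -[y in LHS]scale1r FL mul1r.
rewrite [x in LHS](coord_expand eB) (big_morph F FD F0); apply: eq_bigr => i _.
by rewrite -[_ *: _]addr0 FL F0 addr0.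
Qed.

Lemma lin_eq0 (F : V -> R) :
  (forall c x y, F (c *: x + y) = c * F x + F y) ->
  (forall i : 'I_n, F e`_i = 0) -> forall x, F x = 0.
Proof.
by move=> FL F0 x; rewrite (lin_expand FL) big1 // => i _; rewrite F0 mulr0.
Qed.

Lemma sort4 (Z : nat -> nat -> nat -> nat -> Prop) (P : nat -> Prop) :
  (forall a b c d, Z a b c d -> Z b a c d) ->
  (forall a b c d, Z a b c d -> Z a c b d) ->
  (forall a b c d, Z a b c d -> Z a b d c) ->
  (forall a b c d, P a -> P b -> P c -> P d -> (a <= b <= c)%N -> (c <= d)%N -> Z a b c d) ->
  forall a b c d, P a -> P b -> P c -> P d -> Z a b c d.
Proof.
move=> s0 s1 s2 srt.
have A a b c d : P a -> P b -> P c -> P d -> (a <= b <= c)%N -> Z a b c d.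
  move=> Pa Pb Pc Pd /andP[ab bc]; case: (leqP c d) => [cd|/ltnW dc].
    by apply: srt; rewrite ?ab.
  apply: s2; case: (leqP b d) => [bd|/ltnW db]; first by apply: srt; rewrite ?ab.
  apply: s1; case: (leqP a d) => [ad|/ltnW da]; first by apply: srt; rewrite ?ad.
  by apply: s0; apply: srt; rewrite ?da.
have B a b c d : P a -> P b -> P c -> P d -> (a <= b)%N -> Z a b c d.
  move=> Pa Pb Pc Pd ab; case: (leqP b c) => [bc|/ltnW cb]; first by apply: A; rewrite ?ab.
  apply: s1; case: (leqP a c) => [ac|/ltnW ca]; first by apply: A; rewrite ?ac.
  by apply: s0; apply: A; rewrite ?ca.
move=> a b c d Pa Pb Pc Pd; case: (leqP a b) => [ab|/ltnW ba]; first exact: B.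
by apply: s0; apply: B.
Qed.

(** An alternating four-linear map is determined by its values on increasing
    quadruples of basis vectors, which leaves 35 numerical checks in dimension 7. *)
Lemma alt4_eq0 (D : V -> V -> V -> V -> R) :
  (forall c x y z t w, D (c *: x + y) z t w = c * D x z t w + D y z t w) ->
  (forall x y z w, D y x z w = - D x y z w) ->
  (forall x y z w, D x z y w = - D x y z w) ->
  (forall x y z w, D x y w z = - D x y z w) ->
  (forall a b c d, (a < n)%N -> (b < n)%N -> (c < n)%N -> (d < n)%N ->
     (a < b < c)%N -> (c < d)%N -> D e`_a e`_b e`_c e`_d = 0) ->
  forall x y z w, D x y z w = 0.
Proof.
move=> DL C0 C1 C2 srt.
have Z := @sort4 (fun a b c d => D e`_a e`_b e`_c e`_d = 0) (fun a => (a < n)%N).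
have {}Z : forall a b c d, (a < n)%N -> (b < n)%N -> (c < n)%N -> (d < n)%N -> D e`_a e`_b e`_c e`_d = 0.
  apply: Z => // a b c d.
  - by rewrite (C0 e`_a) => ->; rewrite oppr0.
  - by rewrite (C1 _ e`_b) => ->; rewrite oppr0.
  - by rewrite (C2 _ _ e`_c) => ->; rewrite oppr0.
  move=> an bn cn dn /andP[]; rewrite (leq_eqVlt a) (leq_eqVlt b) (leq_eqVlt c).
  have N0 (t : R) : t = - t -> t = 0 by move=> h; lra.
  case/orP=> [/eqP <-|ab]; first by move=> _ _; apply: N0; rewrite -C0.
  case/orP=> [/eqP <-|bc]; first by move=> _; apply: N0; rewrite -C1.
  case/orP=> [/eqP <-|cd]; first by apply: N0; rewrite -C2.
  by apply: srt; rewrite ?ab.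
move=> x y z w; apply: (lin_eq0 (F := fun x => D x y z w)) => [|i]; first by move=> *; exact: DL.
apply: (lin_eq0 (F := fun y => D e`_i y z w)) => [c a b|j]; first by rewrite !(C0 _ e`_i) DL; ring.
apply: (lin_eq0 (F := fun z => D e`_i e`_j z w)) => [c a b|k].
  by rewrite !(C1 _ _ e`_j) !(C0 _ e`_i) DL; ring.
apply: (lin_eq0 (F := fun w => D e`_i e`_j e`_k w)) => [c a b|l].
  by rewrite !(C2 _ _ _ e`_k) !(C1 _ _ e`_j) !(C0 _ e`_i) DL; ring.
exact: Z.
Qed.

End SortedBasis.

(** * The Hodge dual of the three-form *)

Section Levi.

Definition unb (x y : nat) : nat := if (x < y)%N then y.-1 else y.

(** The Levi-Civita symbol as a computable integer, by expansion along the first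
    column: [unb] renumbers the rows that remain. *)
Fixpoint levi (l : seq nat) (n : nat) : int :=
  match n, l with
  | n'.+1, x :: l' =>
      if x \in l' then 0 else
        let t := levi (map (unb x) l') n' in if odd x then - t else t
  | _, _ => 1
  end.

(** Evaluates the volume form on basis vectors. *)
Lemma det_delta (R : comNzRingType) n (l : seq nat) :
  size l = n -> all (fun x => x < n)%N l ->
  \det (\matrix_(i < n, j < n) ((i : nat) == nth 0%N l j)%:R) = (levi l n)%:~R :> R.
Proof.
elim: n l => [|n IH] [|x l] // sl; first by rewrite det_mx00.
move=> /= /andP[xn ln]; case: ifPn => [xl|xl].
  have jn : (index x l < n)%N by move: sl; rewrite -index_mem in xl => -[<-].
  rewrite -det_tr (@determinant_alternate _ _ _ ord0 (lift ord0 (Ordinal jn))) //.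
  by move=> i; rewrite !mxE /= nth_index.
rewrite (expand_det_col _ ord0) (bigD1 (Ordinal xn)) //= big1 ?addr0; last first.
  move=> i ix; rewrite mxE /= (_ : (i : nat) == x = false) ?mul0r //.
  by apply: contraNF ix => /eqP ix; apply/eqP/val_inj.
rewrite mxE /= eqxx mul1r /cofactor addn0.
transitivity ((-1) ^+ x * \det (\matrix_(i < n, j < n)
    ((i : nat) == nth 0%N (map (unb x) l) j)%:R) : R).
  congr (_ * \det _); apply/matrixP => i j; rewrite !mxE lift0 /=.
  have jl : (j < size l)%N by case: sl => ->.
  rewrite (nth_map 0%N) //; congr (_%:R).
  have xN : nth 0%N l j != x by apply: contraNneq xl => <-; apply: mem_nth.
  rewrite /unb /bump; case: (ltnP x (nth 0%N l j)) => h.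
    case: (nth 0%N l j) h xN => // m xm _ /=; rewrite ltnS in xm.
    case: leqP => xi; rewrite ?add1n ?add0n ?eqSS //.
    by rewrite !ltn_eqF // (leq_trans xi) // ltnW.
  have {}h : (nth 0%N l j < x)%N by rewrite ltn_neqAle xN.
  case: leqP => xi //; rewrite !gtn_eqF //; first exact: leq_trans h xi.
  by rewrite add1n ltnS ltnW // (leq_trans h).
rewrite IH; first by rewrite -signr_odd; case: odd; rewrite ?rmorphN ?expr1 ?mulN1r ?mul1r.
  by rewrite size_map; case: sl.
apply/allP => _ /mapP[y yl ->]; have yn := allP ln _ yl.
have yx : y != x by apply: contraNneq xl => <-.
rewrite /unb; case: (ltnP x y) => h; first by case: y h yn {yl yx} => // y.
have {}h : (y < x)%N by rewrite ltn_neqAle yx.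
exact: leq_trans h _.
Qed.

End Levi.

Section Polys.
Variable (S : comNzRingType).
Implicit Types x y z w : nat -> S.

Definition dl (p i : nat) : S := (i == p)%:R.

(** The polynomial expressions in this section are written over an arbitrary
    commutative ring so that the identities for the standard three-form can be
    checked by computation over the integers and transferred to the real numbers. *)
Definition mono (i j k : nat) x y z : S :=
  x i * (y j * z k - y k * z j) - x j * (y i * z k - y k * z i)
  + x k * (y i * z j - y j * z i).

Definition phiP x y z : S :=
  mono 0 1 6 x y z + mono 2 3 6 x y z + mono 4 5 6 x y z + mono 0 2 4 x y z
  - mono 0 3 5 x y z - mono 1 2 5 x y z - mono 1 3 4 x y z.

Definition ip x y : S :=
  x 0%N * y 0%N + x 1%N * y 1%N + x 2 * y 2 + x 3 * y 3 + x 4 * y 4 + x 5 * y 5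
  + x 6 * y 6.

(** The four-form <x * y, z * w> - <x, z> <y, w> + <x, w> <y, z>, where
    [phiP x y (dl k)] is the k-th coordinate of the cross product x * y. *)
Definition PhiP x y z w : S :=
  phiP x y (dl 0) * phiP z w (dl 0) + phiP x y (dl 1) * phiP z w (dl 1)
  + phiP x y (dl 2) * phiP z w (dl 2) + phiP x y (dl 3) * phiP z w (dl 3)
  + phiP x y (dl 4) * phiP z w (dl 4) + phiP x y (dl 5) * phiP z w (dl 5)
  + phiP x y (dl 6) * phiP z w (dl 6)
  - ip x z * ip y w + ip x w * ip y z.

End Polys.

Lemma rmorph_mono (S T : comNzRingType) (h : {rmorphism S -> T}) i j k x y z :
  h (mono i j k x y z) = mono i j k (h \o x) (h \o y) (h \o z).
Proof. by rewrite /mono !(rmorphD, rmorphN, rmorphM). Qed.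

Lemma rmorph_dl (S T : comNzRingType) (h : {rmorphism S -> T}) p : h \o dl S p = dl T p.
Proof. by apply: funext => i; rewrite /= rmorph_nat. Qed.

Lemma rmorph_phiP (S T : comNzRingType) (h : {rmorphism S -> T}) x y z :
  h (phiP x y z) = phiP (h \o x) (h \o y) (h \o z).
Proof. by rewrite /phiP -!(rmorph_mono h) -!(rmorphB h, rmorphD h). Qed.

Lemma rmorph_PhiP (S T : comNzRingType) (h : {rmorphism S -> T}) x y z w :
  h (PhiP x y z w) = PhiP (h \o x) (h \o y) (h \o z) (h \o w).
Proof.
rewrite /PhiP -!(rmorph_dl h) -!(rmorph_phiP h) /ip.
by rewrite -!(rmorphM h, rmorphD h, rmorphB h).
Qed.

Definition sumZ (F : nat -> int) : int := foldr (fun i s => F i + s) 0 (iota 0 7).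

Lemma sumZE (F : nat -> int) : sumZ F = \sum_(i < 7) F i.
Proof. by rewrite -(big_mkord xpredT) /index_iota subn0 unlock. Qed.

Definition phiZ (i j k : nat) : int := phiP (dl int i) (dl int j) (dl int k).

(** Six times a component of the Hodge dual of the standard three-form: the
    Hodge star sums over ordered triples and divides by 3!. Triples of sign zero
    are skipped to keep the computation short. *)
Definition hodgeZ (a b c d : nat) : int :=
  sumZ (fun i => sumZ (fun j => sumZ (fun k =>
    let t := levi [:: i; j; k; a; b; c; d] 7 in
    if t == 0 then 0 else phiZ i j k * t))).

Definition hodge_check : bool :=
  all (fun a => all (fun b => all (fun c => all (fun d =>
    hodgeZ a b c d == 6%:Z * PhiP (dl int a) (dl int b) (dl int c) (dl int d))
    (iota c.+1 (6 - c))) (iota b.+1 (6 - b))) (iota a.+1 (6 - a))) (iota 0 7).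

Lemma hodge_check_true : hodge_check.
Proof. by vm_compute. Qed.

Lemma hodgeZ_sorted a b c d : (a < b < c)%N -> (c < d < 7)%N ->
  hodgeZ a b c d = 6%:Z * PhiP (dl int a) (dl int b) (dl int c) (dl int d).
Proof.
move=> /andP[ab bc] /andP[cd d7].
have c7 := ltn_trans cd d7; have b7 := ltn_trans bc c7; have a7 := ltn_trans ab b7.
have in_iota p q : (p < q)%N -> (q < 7)%N -> q \in iota p.+1 (6 - p).
  by move=> pq q7; rewrite mem_iota pq addSn subnKC // -ltnS (ltn_trans pq).
have a0 : a \in iota 0 7 by rewrite mem_iota.
have /allP/(_ b (in_iota _ _ ab b7)) := allP hodge_check_true a a0.
by move/allP/(_ c (in_iota _ _ bc c7))/allP/(_ d (in_iota _ _ cd d7))/eqP.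
Qed.

Section G2.

Variables (R : realType) (V : vectType R) (e : 7.-tuple V) (phi : ('I_3 -> V) -> R^o).
Hypothesis (G2 : G2_adapted_basis phi e).
Let eB : basis_of fullv e := G2.1.

Definition cf (x : V) (i : nat) : R := coord e (inord i) x.

Lemma cf_lin c x y i : cf (c *: x + y) i = c * cf x i + cf y i.
Proof. by rewrite /cf linearP. Qed.

Lemma cf_basis p i : (p < 7)%N -> (i < 7)%N -> cf e`_p i = dl R p i.
Proof.
by move=> p7 i7; rewrite /cf -[p]/(val (Ordinal p7)) coord_self // -val_eqE /= inordK.
Qed.

Lemma phiP_ext x y z x' y' z' : (forall i, (i < 7)%N -> x i = x' i) ->
  (forall i, (i < 7)%N -> y i = y' i) -> (forall i, (i < 7)%N -> z i = z' i) ->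
  phiP x y z = phiP x' y' z' :> R.
Proof. by move=> Ex Ey Ez; rewrite /phiP /mono !Ex // !Ey // !Ez. Qed.

Lemma ip_ext x y x' y' : (forall i, (i < 7)%N -> x i = x' i) ->
  (forall i, (i < 7)%N -> y i = y' i) -> ip x y = ip x' y' :> R.
Proof. by move=> Ex Ey; rewrite /ip !Ex // !Ey. Qed.

Lemma PhiP_ext x y z w x' y' z' w' : (forall i, (i < 7)%N -> x i = x' i) ->
  (forall i, (i < 7)%N -> y i = y' i) -> (forall i, (i < 7)%N -> z i = z' i) ->
  (forall i, (i < 7)%N -> w i = w' i) -> PhiP x y z w = PhiP x' y' z' w' :> R.
Proof.
move=> Ex Ey Ez Ew; have Exy t : phiP x y t = phiP x' y' t by apply: phiP_ext.
have Ezw t : phiP z w t = phiP z' w' t by apply: phiP_ext.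
by rewrite /PhiP !Exy !Ezw (ip_ext Ex Ez) (ip_ext Ey Ew) (ip_ext Ex Ew) (ip_ext Ey Ez).
Qed.

Lemma metric_ip x y : metric e x y = ip (cf x) (cf y).
Proof.
rewrite /metric /ip /cf !big_ord_recl big_ord0 addr0 !addrA.
by do ![congr (_ + _)|congr (coord e _ _ * coord e _ _)|apply: val_inj; rewrite /= inordK].
Qed.

Lemma det3_nat (F : nat -> nat -> R) :
  \det (\matrix_(r < 3, c < 3) F r c)
  = F 0 0 * (F 1 1 * F 2 2 - F 2 1 * F 1 2) - F 1 0 * (F 0 1 * F 2 2 - F 2 1 * F 0 2)
    + F 2 0 * (F 0 1 * F 1 2 - F 1 1 * F 0 2) :> R.
Proof.
do ![rewrite (expand_det_col _ ord0) !big_ord_recl big_ord0 /cofactor].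
rewrite !det_mx00 !mxE /= /bump /=; ring.
Qed.

Lemma monomialE i j k x y z :
  monomial e i j k (tnth [tuple x; y; z]) = mono i.-1 j.-1 k.-1 (cf x) (cf y) (cf z) :> R.
Proof.
rewrite /monomial.
pose F r c := coord e (inord (nth 0%N [:: i; j; k] r).-1) (nth 0 [:: x; y; z] c) : R.
transitivity (\det (\matrix_(r < 3, c < 3) F r c)).
  by congr (\det _); apply/matrixP => r c; rewrite !mxE (tnth_nth (0 : V)) (tnth_nth 0%N).
rewrite det3_nat /F /mono /cf /=; ring.
Qed.

Lemma phi_phiP x y z : app3 phi x y z = phiP (cf x) (cf y) (cf z) :> R.
Proof. by rewrite /app3 G2.2 !monomialE. Qed.

Lemma sum_ffun3 (F : {ffun 'I_3 -> 'I_7} -> R) :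
  \sum_s F s = \sum_i \sum_j \sum_k F [ffun t => tnth [tuple i; j; k] t].
Proof.
rewrite pair_big pair_big /=.
rewrite (reindex (fun p : 'I_7 * 'I_7 * 'I_7 =>
  [ffun t => tnth [tuple p.1.1; p.1.2; p.2] t] : {ffun 'I_3 -> 'I_7})) //=.
apply: onW_bij; apply: inj_card_bij => [[[i j] k] [[i' j'] k'] /ffunP /= E|]; last first.
  by rewrite card_ffun !card_prod !card_ord.
move: (E ord0) (E (lift ord0 ord0)) (E (lift ord0 (lift ord0 ord0))).
by rewrite !ffunE !(tnth_nth ord0) /= => -> -> ->.
Qed.

Lemma volume_basis (l : seq nat) : size l = 7%N -> all (fun x => x < 7)%N l ->
  volume e (fun i => e`_(nth 0%N l i)) = (levi l 7)%:~R :> R.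
Proof.
move=> sl l7; rewrite -(det_delta R sl l7) /volume; congr (\det _).
apply/matrixP => i j; rewrite !mxE.
have jl : (nth 0%N l j < 7)%N by apply: (allP l7); rewrite mem_nth // sl.
by rewrite -[nth 0%N l j]/(val (Ordinal jl)) coord_self.
Qed.

Lemma volume_form : is_form (volume e).
Proof.
split=> [v i c x y|v i j ij vij]; last first.
  rewrite /volume -det_tr (@determinant_alternate _ _ _ i j) // => k.
  by rewrite !mxE vij.
rewrite /volume -!(det_tr (\matrix_(_, _) _)).
transitivity (c * \det (\matrix_(r, k) coord e k ([eta v with i |-> x] r))
  + 1 * \det (\matrix_(r, k) coord e k ([eta v with i |-> y] r)) : R).
  apply: (@determinant_multilinear _ _ _ _ _ i).
  - by apply/rowP => k; rewrite !mxE /= eqxx linearP mul1r.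
  - by apply/matrixP => r k; rewrite !mxE /= eq_sym (negbTE (neq_lift _ _)).
  - by apply/matrixP => r k; rewrite !mxE /= eq_sym (negbTE (neq_lift _ _)).
rewrite mul1r /GRing.scale /=.
by congr (_ * _ + _); congr (\det _); apply/matrixP => r k; rewrite !mxE.
Qed.

Lemma hodge_form : is_form (@hodge R V 3 4 e phi).
Proof.
have vF := volume_form.
have E (v : 'I_4 -> V) (w : 'I_3 -> V) i z :
    fcat w [eta v with i |-> z] = [eta fcat w v with rshift 3 i |-> z] :> ('I_7 -> V).
  apply: funext => m /=; rewrite /fcat; case: splitP => [j|j] mj.
    by case: eqP => // mi; have := ltn_ord j; rewrite -mj mi /=.
  case: eqP => [mi|mi] /=; case: (@eqP _ j i) => // ji.
    by case: ji; apply: val_inj; move: mj; rewrite mi /= => -[].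
  by case: mi; apply: val_inj; rewrite /= mj ji.
split=> [v i c x y|v i j ij vij].
  rewrite /hodge /GRing.scale /= [in RHS]mulrCA -mulrDr; congr (_ * _).
  rewrite [c * _]mulr_sumr -big_split /=.
  by apply: eq_bigr => s _; rewrite !E vF.1 /GRing.scale /=; ring.
rewrite /hodge big1 ?mulr0 // => s _.
rewrite (vF.2 _ (rshift 3 i) (rshift 3 j)) ?mulr0 //.
  have fcat_r k w : fcat w v (rshift 3 k) = v k.
    rewrite /fcat; case: splitP => l /= E'; last by congr v; apply: val_inj; case: E'.
    by have := ltn_ord l; rewrite -E'.
  by rewrite !fcat_r.
Qed.

Lemma hodge_basis a b c d : (a < 7)%N -> (b < 7)%N -> (c < 7)%N -> (d < 7)%N ->
  app4 (@hodge R V 3 4 e phi) e`_a e`_b e`_c e`_d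
  = (6%:R)^-1 * (hodgeZ a b c d)%:~R :> R.
Proof.
move=> a7 b7 c7 d7; rewrite /app4 /hodge; congr (_^-1 * _).
rewrite sum_ffun3 /hodgeZ sumZE rmorph_sum; apply: eq_bigr => i _; cbv beta.
rewrite sumZE rmorph_sum; apply: eq_bigr => j _; cbv beta.
rewrite sumZE rmorph_sum; apply: eq_bigr => k _; cbv beta zeta.
set l := [:: _; _; _; _; _; _; _].
have -> : (fcat (fun i0 : 'I_3 => e`_([ffun t => tnth [tuple i; j; k] t] i0))
      (tnth [tuple e`_a; e`_b; e`_c; e`_d])) = (fun m : 'I_7 => e`_(nth 0%N l m)).
  apply: funext => m; rewrite /fcat; case: splitP => t mt.
    rewrite ffunE (tnth_nth i); congr (e`_ _); rewrite mt.
    by case: t mt => [[|[|[|//]]] ?].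
  rewrite (tnth_nth 0) mt.
  by case: t mt => [[|[|[|[|//]]]] ?].
rewrite volume_basis //=; last by rewrite !ltn_ord a7 b7 c7 d7.
have -> : (phi (fun i0 : 'I_3 => e`_([ffun t => tnth [tuple i; j; k] t] i0)) : R)
   = (phiZ i j k)%:~R.
  rewrite fun3E !ffunE !(tnth_nth i) /= phi_phiP /phiZ (rmorph_phiP intr).
  by rewrite !(rmorph_dl intr); apply: phiP_ext => m m7; rewrite cf_basis.
case: eqP => [->|_]; first by rewrite mulr0.
by rewrite -intrM.
Qed.

Lemma phiP_lin1 c (x x' y z : nat -> R) :
  phiP (fun i => c * x i + x' i) y z = c * phiP x y z + phiP x' y z.
Proof. rewrite /phiP /mono; ring. Qed.

(** The Hodge dual of the standard three-form is a quadratic expression in the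
    cross product. Both sides are alternating four-forms, so that the finite check
    [hodgeZ_sorted] is enough. *)
Lemma hodge_PhiP x y z w :
  app4 (@hodge R V 3 4 e phi) x y z w = PhiP (cf x) (cf y) (cf z) (cf w) :> R.
Proof.
have hF := hodge_form; apply/eqP; rewrite -subr_eq0; apply/eqP.
have cfL c x0 y0 : cf (c *: x0 + y0) = fun i => c * cf x0 i + cf y0 i.
  by apply: funext => i; apply: cf_lin.
move: x y z w; apply: (alt4_eq0 eB).
- move=> c x y z t w; rewrite (form4_lin hF) cfL /GRing.scale /=.
  move: (cf x) (cf y) (cf z) (cf t) (cf w) (app4 _ x _ _ _ : R) (app4 _ y _ _ _ : R).
  by move=> ? ? ? ? ? ? ?; rewrite /PhiP !phiP_lin1 /ip; ring.
- move=> x y z w; rewrite (form4C0 hF).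
  move: (cf x) (cf y) (cf z) (cf w) (app4 _ x _ _ _ : R).
  by move=> ? ? ? ? ?; rewrite /PhiP /phiP /mono /ip /dl /=; ring.
- move=> x y z w; rewrite (form4C1 hF).
  move: (cf x) (cf y) (cf z) (cf w) (app4 _ x _ _ _ : R).
  by move=> ? ? ? ? ?; rewrite /PhiP /phiP /mono /ip /dl /=; ring.
- move=> x y z w; rewrite (form4C2 hF).
  move: (cf x) (cf y) (cf z) (cf w) (app4 _ x _ _ _ : R).
  by move=> ? ? ? ? ?; rewrite /PhiP /phiP /mono /ip /dl /=; ring.
move=> a b c d a7 b7 c7 d7 abc cd; rewrite hodge_basis // hodgeZ_sorted ?cd //.
rewrite intrM (rmorph_PhiP intr) mulrA mulVf ?mul1r ?pnatr_eq0 // !(rmorph_dl intr).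
apply/eqP; rewrite subr_eq0; apply/eqP.
by apply: PhiP_ext => i i7; rewrite cf_basis.
Qed.

End G2.

(** * The cross product *)

Section Cross.

Variables (R : realType) (V : vectType R) (e : 7.-tuple V) (phi : ('I_3 -> V) -> R^o).
Hypothesis (G2 : G2_adapted_basis phi e).
Let eB : basis_of fullv e := G2.1.
Local Notation Phi := (app4 (@hodge R V 3 4 e phi)).

Definition cross (x y : V) : V := \sum_(i < 7) (app3 phi x y e`_i : R) *: e`_i.

Lemma phi_lin1 c x y z t :
  app3 phi (c *: x + y) z t = c * app3 phi x z t + app3 phi y z t :> R.
Proof.
rewrite !(phi_phiP G2) -phiP_lin1; apply: phiP_ext => // i _; exact: cf_lin.
Qed.

Lemma phiC1 x y z : app3 phi y x z = - app3 phi x y z :> R.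
Proof. by rewrite !(phi_phiP G2) /phiP /mono; ring. Qed.

Lemma phiC2 x y z : app3 phi x z y = - app3 phi x y z :> R.
Proof. by rewrite !(phi_phiP G2) /phiP /mono; ring. Qed.

Lemma phi_cycle x y z : app3 phi y z x = app3 phi x y z :> R.
Proof. by rewrite phiC2 phiC1 opprK. Qed.

Lemma metric_cross x y z : metric e (cross x y) z = app3 phi x y z.
Proof.
rewrite /cross metric_suml -phi_cycle -phi_cycle.
rewrite (lin_expand eB (F := fun z => app3 phi z x y : R)); last by move=> *; exact: phi_lin1.
apply: eq_bigr => i _; rewrite metricZl -(coord_metric eB) mulrC; congr (_ * _).
by rewrite phi_cycle.
Qed.

Lemma crossC x y : cross y x = - cross x y.
Proof. by apply: (metric_inj eB) => z; rewrite metricNl !metric_cross phiC1. Qed.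

Lemma cross_linr c x y z : cross z (c *: x + y) = c *: cross z x + cross z y.
Proof.
apply: (metric_inj eB) => t; rewrite metricDl metricZl !metric_cross.
by rewrite !(phiC1 _ z t) phi_lin1; ring.
Qed.

(** The coordinate-free form of [hodge_PhiP]. *)
Lemma Phi_cross x y z w :
  Phi x y z w = metric e (cross x y) (cross z w) - metric e x z * metric e y w
    + metric e x w * metric e y z :> R.
Proof.
rewrite (hodge_PhiP G2) /PhiP !(metric_ip e).
have E (a b : V) i : (i < 7)%N -> phiP (cf e a) (cf e b) (dl R i) = cf e (cross a b) i.
  move=> i7; rewrite /cf (coord_metric eB) metricC metric_cross (phi_phiP G2).
  by apply: phiP_ext => // j j7; rewrite inordK // (cf_basis G2).
by rewrite !E // -/(ip _ _).
Qed.

(** The four-form vanishes when its first and third arguments agree; [Phi_cross]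
    then reads as this identity, the defining property of a vector cross product. *)
Lemma cross_norm x y z :
  metric e (cross x y) (cross x z)
  = metric e x x * metric e y z - metric e x y * metric e x z.
Proof.
have hF := hodge_form e phi.
have := Phi_cross x y x z.
have -> : Phi x y x z = 0 :> R.
  have H := form4C0 hF y x x z; have := form4C1 hF x y x z.
  have -> : Phi x x y z = 0 :> R by have := form4C0 hF x x y z => E; lra.
  by move=> E; lra.
rewrite (metricC e y x) => E; lra.
Qed.

(** Polarization of [cross_norm] in the first argument. *)
Lemma cross_polar x y z w :
  metric e (cross x y) (cross w z) + metric e (cross w y) (cross x z)
  = 2%:R * metric e x w * metric e y z - metric e x y * metric e w z
    - metric e w y * metric e x z.
Proof.
have H := cross_norm (1 *: x + w) y z.
have cl c a b d : cross (c *: a + b) d = c *: cross a d + cross b d.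
  by rewrite crossC cross_linr opprD -scalerN -!crossC.
rewrite !cl !scale1r !metricE !cross_norm (metricC e w x) in H.
lra.
Qed.

Variable (X : V).
Hypothesis (X1 : metric e X X = 1).

(** For a unit vector X, an orthogonal complex structure on its complement. *)
Definition J0 (x : V) : V := cross X x.

Lemma J0_lin c x y : J0 (c *: x + y) = c *: J0 x + J0 y.
Proof. exact: cross_linr. Qed.

Lemma J0X x : metric e X (J0 x) = 0.
Proof.
rewrite metricC metric_cross.
by have := phiC2 X x X; have := phiC1 X X x => E1 E2; have := phi_cycle X X x; lra.
Qed.

Lemma J0_skew x y : metric e (J0 x) y = - metric e x (J0 y).
Proof. by rewrite (metricC e x) !metric_cross phiC2. Qed.

Lemma J0_sq x : metric e X x = 0 -> J0 (J0 x) = - x.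
Proof.
move=> Xx; apply: (metric_inj eB) => z; rewrite J0_skew cross_norm X1 Xx metricNl; ring.
Qed.

(** The restriction of phi to the complement of X is the real part of a complex
    volume form, by polarization of the cross product identity. *)
Lemma phi_J0 x y z : metric e X x = 0 -> metric e X y = 0 -> metric e X z = 0 ->
  app3 phi (J0 x) y (J0 z) = - app3 phi x y z :> R.
Proof.
move=> Xx Xy Xz; have := cross_polar y (J0 z) x X.
rewrite -/(J0 x) -/(J0 (J0 z)) J0_sq // metricNl (metricC e z) !metric_cross.
rewrite (metricC e y X) Xy Xx J0X phi_cycle (phiC1 x y z) => E; lra.
Qed.

End Cross.

(** * Orthonormal and unitary frames *)

Section LinearTools.

Variables (R : realType) (V W : vectType R).

Lemma linfunE (F : V -> W) : (forall c x y, F (c *: x + y) = c *: F x + F y) ->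
  forall x, linfun F x = F x.
Proof.
move=> FL x.
pose L : {linear V -> W} := HB.pack F (GRing.isLinear.Build R V W *:%R F FL).
exact: (lfunE L x).
Qed.

Lemma linfun_exists (F : V -> W) : (forall c x y, F (c *: x + y) = c *: F x + F y) ->
  exists A : 'Hom(V, W), forall x, A x = F x.
Proof.
by move=> FL; exists (linfun F); apply: linfunE.
Qed.

End LinearTools.

Section Frames.

Variables (R : realType) (V : vectType R) (n : nat) (e : n.-tuple V).
Hypothesis (eB : basis_of fullv e).

(** Fewer linear conditions than the dimension have a common solution; this
    produces all the frame vectors below. *)
Lemma exists_unit_orth (u S : {vspace V}) : (\dim S < \dim u)%N ->
  exists W, [/\ W \in u, metric e W W = 1 & forall s, s \in S -> metric e s W = 0].
Proof.
move=> Su; have [A AE] : exists A : 'Hom(V, 'rV[R]_(\dim S)),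
    forall x, A x = \row_i metric e (vbasis S)`_i x.
  apply: linfun_exists => c x y; apply/rowP => i; rewrite !mxE.
  by rewrite metricDr metricZr.
have K0 : (u :&: lker A)%VS != 0%VS.
  rewrite -dimv_eq0 -lt0n -(ltn_add2r (\dim (A @: u)%VS)) limg_ker_dim add0n.
  apply: leq_ltn_trans Su; apply: leq_trans (dimvS (subvf _)) _.
  by rewrite dimvf /dim /= mul1n.
pose w := vpick (u :&: lker A)%VS.
have w0 : w != 0 by rewrite vpick0.
have /memv_capP[wu wA] : w \in (u :&: lker A)%VS by exact: memv_pick.
have ww : 0 < metric e w w.
  by rewrite lt_neqAle metric_ge0 andbT eq_sym; apply: contra_neq w0; exact: metric_eq0.
exists ((Num.sqrt (metric e w w))^-1 *: w); split.
- exact: memvZ.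
- rewrite metricZl metricZr mulrA -invfM -expr2 sqr_sqrtr ?metric_ge0 // mulVf //.
  by rewrite gt_eqF.
move=> s sS; rewrite metricZr; move: wA; rewrite memv_ker AE => /eqP /rowP wA.
rewrite (coord_vbasis sS) metric_suml big1 ?mulr0 // => i _.
by rewrite metricZl; have := wA i; rewrite !mxE => ->; rewrite mulr0.
Qed.

Lemma orthonormal_expand k (b : 'I_k -> V) (u : {vspace V}) : \dim u = k ->
  (forall i, b i \in u) -> (forall i j, metric e (b i) (b j) = (i == j)%:R) ->
  forall x, x \in u -> x = \sum_i metric e (b i) x *: b i.
Proof.
move=> du bu bo x xu; pose t := [tuple b i | i < k].
have tE (i : 'I_k) : t`_i = b i by rewrite -tnth_nth tnth_mktuple.
have orth (c : 'I_k -> R) i : metric e (b i) (\sum_j c j *: b j) = c i.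
  rewrite metricC metric_suml (bigD1 i) //= big1 => [|j ji]; rewrite metricZl bo.
    by rewrite eqxx mulr1 addr0.
  by rewrite (negbTE ji) mulr0.
have ft : free t.
  apply/freeP => c c0 i; rewrite -(orth c i) (_ : \sum_j _ = 0) ?metric0r // -[RHS]c0.
  by apply: eq_bigr => j _; rewrite tE.
have tB : basis_of u t.
  rewrite basisEfree ft size_tuple du leqnn andbT; apply/span_subvP => y /tnthP[i ->].
  by rewrite tnth_mktuple.
rewrite {1}(coord_basis tB xu); apply: eq_bigr => i _; rewrite tE; congr (_ *: _).
rewrite {2}(coord_basis tB xu) -(orth (fun i => coord t i x) i); congr (metric e _ _).
by apply: eq_bigr => j _; rewrite tE.
Qed.

(** [trace_on] is defined through an arbitrary basis of the subspace; expanding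
    that basis in an orthonormal one and exchanging the sums shows the
    independence. *)
Lemma trace_orthonormal k (b : 'I_k -> V) (a : {vspace V}) (f : 'End(V)) : \dim a = k ->
  (forall i, b i \in a) -> (forall i j, metric e (b i) (b j) = (i == j)%:R) ->
  (f @: a <= a)%VS ->
  trace_on a f = \sum_i metric e (b i) (f (b i)).
Proof.
move=> da ba bo fa; rewrite /trace_on.
have fm x : x \in a -> f x \in a by move=> xa; apply: subvP fa _ (memv_img f xa).
have va i : (vbasis a)`_i \in a.
  case: (ltnP i (\dim a)) => ia; last by rewrite nth_default ?mem0v // size_tuple.
  by apply: vbasis_mem; rewrite mem_nth // size_tuple.
transitivity (\sum_(i < \dim a) \sum_j metric e (b j) (vbasis a)`_i
    * coord (vbasis a) i (f (b j))).
  apply: eq_bigr => i _; rewrite {1}(orthonormal_expand da ba bo (va i)) linear_sum linear_sum.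
  by apply: eq_bigr => j _; rewrite !linearZ.
rewrite exchange_big; apply: eq_bigr => j _ /=.
rewrite [in RHS](coord_vbasis (fm _ (ba j))) metricC metric_suml.
by apply: eq_bigr => i _; rewrite metricZl mulrC metricC.
Qed.

End Frames.

Section UnitaryFrame.

Variables (R : realType) (V : vectType R) (n : nat) (e : n.-tuple V) (u : {vspace V})
  (J : V -> V).

(** The frame is indexed by nat, only the first six values being constrained:
    concrete indices then need no proof of their bound. *)
Record unitary_frame (b : nat -> V) : Prop := UnitaryFrame {
  frame_mem : forall i, (i < 6)%N -> b i \in u;
  frame_orth : forall i j, (i < 6)%N -> (j < 6)%N -> metric e (b i) (b j) = (i == j)%:R;
  frame_J0 : J (b 0%N) = b 1%N;
  frame_J2 : J (b 2%N) = b 3%N;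
  frame_J4 : J (b 4%N) = b 5%N }.

Hypotheses (eB : basis_of fullv e) (u6 : \dim u = 6%N)
  (Ju : forall x, x \in u -> J x \in u)
  (Jskew : forall x y, x \in u -> y \in u -> metric e (J x) y = - metric e x (J y))
  (Jsq : forall x, x \in u -> J (J x) = - x).

(** Since J is an isometry with J^2 = -1, the complex orthogonality of b_0, b_2
    and b_4 gives all the orthogonality relations. *)
Lemma unitary_frame_of b0 b2 b4 : b0 \in u -> b2 \in u -> b4 \in u ->
  metric e b0 b0 = 1 -> metric e b2 b2 = 1 -> metric e b4 b4 = 1 ->
  metric e b0 b2 = 0 -> metric e (J b0) b2 = 0 -> metric e b0 b4 = 0 ->
  metric e (J b0) b4 = 0 -> metric e b2 b4 = 0 -> metric e (J b2) b4 = 0 ->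
  unitary_frame (nth 0 [:: b0; J b0; b2; J b2; b4; J b4]).
Proof.
move=> m0 m2 m4 n0 n2 n4 o02 o12 o04 o14 o24 o34; split => //.
  by move=> [|[|[|[|[|[|i]]]]]] //= _; rewrite ?Ju.
have JJ x y : x \in u -> y \in u -> metric e (J x) (J y) = metric e x y.
  by move=> xu yu; rewrite Jskew ?Ju // Jsq // metricNr opprK.
have J1 x : x \in u -> metric e x (J x) = 0.
  by move=> xu; have := Jskew xu xu; rewrite metricC => E; lra.
have Js x y : x \in u -> y \in u -> metric e x (J y) = - metric e (J x) y.
  by move=> xu yu; rewrite Jskew ?opprK.
have p01 := J1 _ m0; have p23 := J1 _ m2; have p45 := J1 _ m4.
have p03 : metric e b0 (J b2) = 0 by rewrite Js // o12 oppr0.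
have p05 : metric e b0 (J b4) = 0 by rewrite Js // o14 oppr0.
have p25 : metric e b2 (J b4) = 0 by rewrite Js // o34 oppr0.
move=> [|[|[|[|[|[|i]]]]]] [|[|[|[|[|[|j]]]]]] //= _ _; rewrite ?JJ //.
all: by rewrite metricC.
Qed.

Lemma exists_unitary_frame b0 b2 : b0 \in u -> b2 \in u ->
  metric e b0 b0 = 1 -> metric e b2 b2 = 1 ->
  metric e b0 b2 = 0 -> metric e (J b0) b2 = 0 ->
  exists b, [/\ unitary_frame b, b 0%N = b0 & b 2%N = b2].
Proof.
move=> m0 m2 n0 n2 o02 o12.
have [b4 [m4 n4 o4]] : exists W, [/\ W \in u, metric e W W = 1 &
    forall s, s \in <<[:: b0; J b0; b2; J b2]>>%VS -> metric e s W = 0].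
  by apply: (exists_unit_orth eB); rewrite u6; apply: leq_ltn_trans (dim_span _) _.
exists (nth 0 [:: b0; J b0; b2; J b2; b4; J b4]); split=> //.
by apply: unitary_frame_of => //; apply: o4; apply: memv_span; rewrite !inE eqxx ?orbT.
Qed.

Section InFrame.

Variable (b : nat -> V).
Hypothesis (bF : unitary_frame b).

Lemma frame_J1 : J (b 1%N) = - b 0%N.
Proof. by rewrite -(frame_J0 bF) Jsq // (frame_mem bF). Qed.

Lemma frame_J3 : J (b 3%N) = - b 2%N.
Proof. by rewrite -(frame_J2 bF) Jsq // (frame_mem bF). Qed.

Lemma frame_J5 : J (b 5%N) = - b 4%N.
Proof. by rewrite -(frame_J4 bF) Jsq // (frame_mem bF). Qed.

Lemma frame_expand x : x \in u ->
  x = metric e (b 0%N) x *: b 0%N + metric e (b 1%N) x *: b 1%N + metric e (b 2%N) x *: b 2%N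
    + metric e (b 3%N) x *: b 3%N + metric e (b 4%N) x *: b 4%N + metric e (b 5%N) x *: b 5%N.
Proof.
move=> xu; have := @orthonormal_expand _ _ _ e _ (fun i : 'I_6 => b i) u u6 _ _ x xu.
rewrite !big_ord_recl big_ord0 addr0 !addrA; apply.
  by move=> i; apply: (frame_mem bF).
by move=> i j; apply: (frame_orth bF).
Qed.

Lemma metric_frame x y : x \in u -> y \in u ->
  metric e x y = metric e (b 0%N) x * metric e (b 0%N) y
    + metric e (b 1%N) x * metric e (b 1%N) y + metric e (b 2%N) x * metric e (b 2%N) y
    + metric e (b 3%N) x * metric e (b 3%N) y + metric e (b 4%N) x * metric e (b 4%N) y
    + metric e (b 5%N) x * metric e (b 5%N) y.
Proof.
move=> xu yu; rewrite {1}(frame_expand xu) !metricDl !metricZl; ring.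
Qed.

Lemma metricJ_frame x y : x \in u -> y \in u ->
  metric e x (J y)
  = - (metric e (b 0%N) x * metric e (b 1%N) y - metric e (b 1%N) x * metric e (b 0%N) y)
    - (metric e (b 2%N) x * metric e (b 3%N) y - metric e (b 3%N) x * metric e (b 2%N) y)
    - (metric e (b 4%N) x * metric e (b 5%N) y - metric e (b 5%N) x * metric e (b 4%N) y).
Proof.
move=> xu yu; have m i : (i < 6)%N -> b i \in u by exact: (frame_mem bF).
have JJ i : (i < 6)%N -> metric e (b i) (J y) = - metric e (J (b i)) y.
  by move=> i6; rewrite Jskew ?opprK // m.
rewrite (metric_frame xu (Ju yu)) !JJ // (frame_J0 bF) (frame_J2 bF) (frame_J4 bF).
rewrite frame_J1 frame_J3 frame_J5 !metricNl; ring.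
Qed.

Lemma bilinear_frame (s : V -> V -> R) x y :
  (forall c x y z, s (c *: x + y) z = c * s x z + s y z) ->
  (forall x y, s y x = - s x y) -> x \in u -> y \in u ->
  let c i j := metric e (b i) x * metric e (b j) y - metric e (b j) x * metric e (b i) y in
  s x y = s (b 0%N) (b 1%N) * c 0%N 1%N + s (b 0%N) (b 2%N) * c 0%N 2%N
    + s (b 0%N) (b 3%N) * c 0%N 3%N + s (b 0%N) (b 4%N) * c 0%N 4%N + s (b 0%N) (b 5%N) * c 0%N 5%N
    + s (b 1%N) (b 2%N) * c 1%N 2%N + s (b 1%N) (b 3%N) * c 1%N 3%N
    + s (b 1%N) (b 4%N) * c 1%N 4%N + s (b 1%N) (b 5%N) * c 1%N 5%N
    + s (b 2%N) (b 3%N) * c 2%N 3%N + s (b 2%N) (b 4%N) * c 2%N 4%N + s (b 2%N) (b 5%N) * c 2%N 5%N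
    + s (b 3%N) (b 4%N) * c 3%N 4%N + s (b 3%N) (b 5%N) * c 3%N 5%N + s (b 4%N) (b 5%N) * c 4%N 5%N.
Proof.
move=> sL sC xu yu /=.
have s0 z : s 0 z = 0 by have := sL 1 0 0 z; rewrite scaler0 addr0 mul1r => E; lra.
have sZ c x0 z : s (c *: x0) z = c * s x0 z by rewrite -[c *: x0]addr0 sL s0 addr0.
have sD x0 y0 z : s (x0 + y0) z = s x0 z + s y0 z by rewrite -[x0 in LHS]scale1r sL mul1r.
have sZr c x0 z : s z (c *: x0) = c * s z x0 by rewrite sC sZ (sC z x0) mulrN opprK.
have sDr x0 y0 z : s z (x0 + y0) = s z x0 + s z y0.
  by rewrite sC sD (sC z x0) (sC z y0) opprD !opprK.
have sA z : s z z = 0 by have := sC z z => E; lra.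
rewrite {1}(frame_expand xu) {1}(frame_expand yu).
rewrite !sD !sDr !sZ !sZr !sA.
rewrite (sC (b 0%N) (b 1%N)) (sC (b 0%N) (b 2%N)) (sC (b 0%N) (b 3%N)) (sC (b 0%N) (b 4%N))
  (sC (b 0%N) (b 5%N)) (sC (b 1%N) (b 2%N)) (sC (b 1%N) (b 3%N)) (sC (b 1%N) (b 4%N))
  (sC (b 1%N) (b 5%N)) (sC (b 2%N) (b 3%N)) (sC (b 2%N) (b 4%N)) (sC (b 2%N) (b 5%N))
  (sC (b 3%N) (b 4%N)) (sC (b 3%N) (b 5%N)) (sC (b 4%N) (b 5%N)).
ring.
Qed.

End InFrame.

End UnitaryFrame.

(** * The complex structure on the hyperplane *)

(** Half the square of a two-form. *)
Definition Qs (R : realType) (V : Type) (s : V -> V -> R) (x y z w : V) : R :=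
  s x y * s z w - s x z * s y w + s x w * s y z.

(** A relation of Pluecker type between a two-form and its square; it recovers
    the value of the two-form at a pair of vectors from its square as soon as the
    square is nonzero on a suitable quadruple. *)
Lemma Qs_pfaff (R : realType) (V : Type) (s : V -> V -> R) a b c d t :
  s a b * Qs s a c d t = s a c * Qs s a b d t - s a d * Qs s a b c t + s a t * Qs s a b c d.
Proof. rewrite /Qs; ring. Qed.

Section SU3.

Variables (R : realType) (V : vectType R) (e : 7.-tuple V) (phi : ('I_3 -> V) -> R^o)
  (u : {vspace V}) (X : V).
Hypothesis (G2 : G2_adapted_basis phi e).
Let eB : basis_of fullv e := G2.1.
Local Notation Phi := (app4 (@hodge R V 3 4 e phi)).
Hypotheses (u6 : \dim u = 6%N) (V7 : \dim {:V} = 7%N) (X1 : metric e X X = 1)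
  (Xu : forall x, x \in u -> metric e X x = 0).

Lemma orth_decomp z : z - metric e X z *: X \in u.
Proof.
have XN0 : X != 0 by apply: contra_eq_neq X1 => ->; rewrite metric0l eq_sym oner_neq0.
have cap0 : (u :&: <[X]>)%VS = 0%VS.
  apply/eqP; rewrite -subv0; apply/subvP => x /memv_capP[xu /vlineP[k xk]].
  have := Xu xu; rewrite xk metricZr X1 mulr1 => ->.
  by rewrite scale0r mem0v.
have full : (u + <[X]>)%VS = fullv.
  apply/eqP; rewrite eqEdim subvf V7 -(leq_add2r (\dim (u :&: <[X]>))).
  by rewrite dimv_sum_cap u6 dim_vline XN0 cap0 dimv0 addn0.
have : z \in (u + <[X]>)%VS by rewrite full memvf.
case/memv_addP => y yu [_ /vlineP[k ->] ->].
by rewrite metricDr Xu // metricZr X1 mulr1 add0r addrK.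
Qed.

Lemma orth_mem z : metric e X z = 0 -> z \in u.
Proof. by move=> Xz; have := orth_decomp z; rewrite Xz scale0r subr0. Qed.

Local Notation J0 := (J0 e phi X).

Lemma J0_mem x : J0 x \in u.
Proof. by apply: orth_mem; apply: J0X G2 _ _. Qed.

(** On a pair (c, J0 c) the cross product is X for a unit vector c, and
    [Phi_cross] becomes the Kaehler form of J0. *)
Lemma Phi_J0 c x y : c \in u -> x \in u -> y \in u -> metric e c c = 1 ->
  metric e c x = 0 -> metric e (J0 c) x = 0 ->
  Phi c (J0 c) x y = metric e (J0 x) y :> R.
Proof.
move=> cu xu yu c1 cx Jcx; rewrite (Phi_cross G2) cx Jcx.
have -> : cross e phi c (J0 c) = X.
  apply: (metric_inj eB) => z; rewrite (metric_cross G2) (phiC2 G2) -(metric_cross G2).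
  rewrite /J0 (crossC G2 c X) metricNr opprK (cross_norm G2) c1 (metricC e c X) Xu //.
  by rewrite mulr0 subr0 mul1r metricC.
rewrite metricC (metric_cross G2) (phi_cycle G2) -(metric_cross G2); ring.
Qed.

Variables (J : 'End(V)) (s : V -> V -> R) (r : V -> V -> V -> R).
Hypotheses
  (Ju : forall x, x \in u -> J x \in u)
  (sL : forall c x y z, s (c *: x + y) z = c * s x z + s y z)
  (sC : forall x y, s y x = - s x y)
  (sJ : forall x y, x \in u -> y \in u -> s x y = metric e x (J y))
  (QPhi : forall x y z w, x \in u -> y \in u -> z \in u -> w \in u ->
     Qs s x y z w = Phi x y z w)
  (rPhi : forall x y z, x \in u -> y \in u -> z \in u -> r x y z = Phi x y z X).

Lemma QsC a b c d : Qs s a b c d = Qs s c d a b.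
Proof. by rewrite /Qs (sC a c) (sC b d) (sC b c) (sC a d); ring. Qed.

Lemma Qs_swap a b c d : Qs s a b c d = - Qs s a c b d.
Proof. by rewrite /Qs (sC b c); ring. Qed.

(** Apply [Qs_pfaff] to c, x and the complex line of an auxiliary unit vector d
    orthogonal to both: the coefficient of s c x is 1 and every term on the other
    side vanishes. Such a d exists since u has complex dimension three. *)
Lemma s_off_diag c x d : c \in u -> x \in u -> d \in u ->
  metric e c c = 1 -> metric e d d = 1 ->
  metric e c x = 0 -> metric e (J0 c) x = 0 ->
  metric e c d = 0 -> metric e (J0 c) d = 0 ->
  metric e x d = 0 -> metric e (J0 x) d = 0 -> s c x = 0.
Proof.
move=> cu xu du c1 d1 cx Jcx cd Jcd xd Jxd.
have sk := J0_skew G2 X; have sq y yu := J0_sq G2 X1 (Xu (x := y) yu).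
have JJ y z : z \in u -> metric e (J0 y) (J0 z) = metric e y z.
  by move=> zu; rewrite sk sq // metricNr opprK.
have := Qs_pfaff s c x (J0 c) d (J0 d).
have -> : Qs s c (J0 c) d (J0 d) = 1 by rewrite QPhi ?J0_mem // Phi_J0 ?J0_mem // JJ.
have -> : Qs s c x d (J0 d) = 0.
  rewrite QsC QPhi ?J0_mem // Phi_J0 ?J0_mem //; first by rewrite metricC.
  by rewrite sk metricC Jcd oppr0.
have -> : Qs s c x (J0 c) d = 0 by rewrite Qs_swap QPhi ?J0_mem // Phi_J0 // Jxd oppr0.
have -> : Qs s c x (J0 c) (J0 d) = 0.
  by rewrite Qs_swap QPhi ?J0_mem // Phi_J0 ?J0_mem // JJ // xd oppr0.
by move=> E; lra.
Qed.

(** In a unitary frame for J0 the two-form s has only the diagonal entries p on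
    the three complex lines, and s^2 says that the pairwise products of these
    entries are 1. Hence they all agree and are 1 or -1. *)
Lemma J_eq_J0 : exists2 t : R, t ^+ 2 = 1 & forall x, x \in u -> J x = t *: J0 x.
Proof.
have [b0 [m0 n0 _]] : exists W, [/\ W \in u, metric e W W = 1 &
    forall s, s \in 0%VS -> metric e s W = 0].
  by apply: (exists_unit_orth eB); rewrite dimv0 u6.
have [b2 [m2 n2 o2]] : exists W, [/\ W \in u, metric e W W = 1 &
    forall s, s \in <<[:: b0; J0 b0]>>%VS -> metric e s W = 0].
  by apply: (exists_unit_orth eB); rewrite u6; apply: leq_ltn_trans (dim_span _) _.
have skew x y : x \in u -> y \in u -> metric e (J0 x) y = - metric e x (J0 y).
  by move=> _ _; apply: J0_skew G2 _ _ _.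
have sq x : x \in u -> J0 (J0 x) = - x by move=> xu; apply: (J0_sq G2 X1); apply: Xu.
have [b [bF _ _]] : exists b, [/\ unitary_frame e u J0 b, b 0%N = b0 & b 2%N = b2].
  apply: (exists_unitary_frame eB u6) => //; first by move=> *; apply: J0_mem.
    by apply: o2; apply: memv_span; rewrite !inE eqxx.
  by apply: o2; apply: memv_span; rewrite !inE eqxx orbT.
have m i : (i < 6)%N -> b i \in u by exact: (frame_mem bF).
have o i j : (i < 6)%N -> (j < 6)%N -> metric e (b i) (b j) = (i == j)%:R by exact: (frame_orth bF).
have E0 := frame_J0 bF; have E2 := frame_J2 bF; have E4 := frame_J4 bF.
have E1 := frame_J1 sq bF; have E3 := frame_J3 sq bF; have E5 := frame_J5 sq bF.
have off i j k : (i < 6)%N -> (j < 6)%N -> (k < 6)%N -> i != j -> i != k -> j != k ->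
    metric e (J0 (b i)) (b j) = 0 -> metric e (J0 (b i)) (b k) = 0 ->
    metric e (J0 (b j)) (b k) = 0 -> s (b i) (b j) = 0.
  move=> i6 j6 k6 /negbTE ij /negbTE ik /negbTE jk h1 h2 h3.
  by apply: (@s_off_diag _ _ (b k)); rewrite ?m // o ?eqxx ?ij ?ik ?jk.
have off' i j k : (i < 6)%N -> (j < 6)%N -> (k < 6)%N -> i != j -> i != k -> j != k ->
    i./2 != j./2 -> i./2 != k./2 -> j./2 != k./2 -> s (b i) (b j) = 0.
  move=> i6 j6 k6 ij ik jk hij hik hjk; apply: (off i j k) => //;
    clear ij ik jk; move: i6 j6 k6 hij hik hjk; move: i j k => [|[|[|[|[|[|i]]]]]] [|[|[|[|[|[|j]]]]]] [|[|[|[|[|[|k]]]]]] //= _ _ _ _ _ _;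
    by rewrite ?(E0, E1, E2, E3, E4, E5) ?metricNl o // oppr0.
pose p := s (b 0%N) (b 1%N).
have q (x y : nat) : (x < 6)%N -> (y < 6)%N -> b y = J0 (b x) -> (1 < x)%N ->
    Qs s (b 0%N) (b 1%N) (b x) (b y) = 1.
  move=> x6 y6 yE x1; rewrite QPhi ?m // -E0 Phi_J0 ?E0 ?m // ?o // -?yE ?o ?eqxx //;
    by case: x x1 {x6 yE} => [|[]].
have Q1 := q 2 3 erefl erefl (esym E2) erefl; have Q2 := q 4 5 erefl erefl (esym E4) erefl.
have Q3 : Qs s (b 2%N) (b 3%N) (b 4%N) (b 5%N) = 1.
  by rewrite QPhi ?m // -E2 Phi_J0 ?E2 ?m // ?o // E4 o.
have z02 : s (b 0%N) (b 2%N) = 0 by apply: (off' _ _ 4).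
have z03 : s (b 0%N) (b 3%N) = 0 by apply: (off' _ _ 4).
have z04 : s (b 0%N) (b 4%N) = 0 by apply: (off' _ _ 2).
have z05 : s (b 0%N) (b 5%N) = 0 by apply: (off' _ _ 2).
have z12 : s (b 1%N) (b 2%N) = 0 by apply: (off' _ _ 4).
have z13 : s (b 1%N) (b 3%N) = 0 by apply: (off' _ _ 4).
have z14 : s (b 1%N) (b 4%N) = 0 by apply: (off' _ _ 2).
have z15 : s (b 1%N) (b 5%N) = 0 by apply: (off' _ _ 2).
have z24 : s (b 2%N) (b 4%N) = 0 by apply: (off' _ _ 0%N).
have z25 : s (b 2%N) (b 5%N) = 0 by apply: (off' _ _ 0%N).
have z34 : s (b 3%N) (b 4%N) = 0 by apply: (off' _ _ 0%N).
have z35 : s (b 3%N) (b 5%N) = 0 by apply: (off' _ _ 0%N).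
move: Q1 Q2 Q3; rewrite /Qs z02 z03 z04 z05 z12 z13 z14 z15 z24 z25 z34 z35.
rewrite !mul0r !subr0 !addr0 -/p => Q1 Q2 Q3.
have p2 : p ^+ 2 = 1.
  have : p * (s (b 2%N) (b 3%N) * s (b 4%N) (b 5%N)) * p = 1.
    by rewrite mulrA Q1 mul1r mulrC.
  by rewrite Q3 mulr1 expr2.
have s23 : s (b 2%N) (b 3%N) = p by rewrite -[LHS]mul1r -p2 expr2 -mulrA Q1 mulr1.
have s45 : s (b 4%N) (b 5%N) = p by rewrite -[LHS]mul1r -p2 expr2 -mulrA Q2 mulr1.
exists (- p) => [|y yu]; first by rewrite sqrrN.
apply/eqP; rewrite -subr_eq0; apply/eqP; set d := J y - _.
have du : d \in u by rewrite memvB ?Ju // memvZ // J0_mem.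
apply: (metric_eq0 eB); rewrite {2}/d metricDr metricNr metricZr.
rewrite -sJ // (bilinear_frame u6 bF sL sC du yu) (metricJ_frame u6 _ skew sq bF du yu).
  rewrite z02 z03 z04 z05 z12 z13 z14 z15 z24 z25 z34 z35 s23 s45 -/p; ring.
by move=> *; apply: J0_mem.
Qed.

Lemma J_squared x : x \in u -> J (J x) = - x.
Proof.
move=> xu; have [t t2 JE] := J_eq_J0.
have h : J (J x) = t *: J0 (t *: J0 x) by rewrite JE ?Ju // JE.
have J0Z c y : J0 (c *: y) = c *: J0 y.
  have := J0_lin G2 X 1 0 0; rewrite scaler0 addr0 scale1r => E.
  have E0 : J0 0 = 0 by apply: (addrI (J0 0)); rewrite addr0 -E.
  by rewrite -[c *: y]addr0 (J0_lin G2) E0 addr0.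
by rewrite h J0Z scalerA -expr2 t2 scale1r (J0_sq G2 X1) // Xu.
Qed.

Lemma rho_J_symmetric x y z : x \in u -> y \in u -> z \in u -> r (J x) y z = r x (J y) z.
Proof.
move=> xu yu zu; have [t t2 JE] := J_eq_J0.
have rE a c d : a \in u -> c \in u -> d \in u -> r a c d = - app3 phi a c (J0 d).
  move=> au cu du; rewrite rPhi // (Phi_cross G2) (metricC e c X) (metricC e a X) !Xu //.
  rewrite (crossC G2 X d) metricNr (metric_cross G2); ring.
rewrite !rE ?Ju // !JE //.
have pZ c a b d : app3 phi (c *: a) b d = c * app3 phi a b d :> R.
  have := phi_lin1 G2 c a 0 b d; have := phi_lin1 G2 1 0 0 b d.
  by rewrite scaler0 !addr0 mul1r => E ->; lra.
rewrite pZ (phiC1 G2 (t *: J0 y) x) pZ !(phi_J0 G2 X1) ?Xu // (phiC1 G2 x y); ring.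
Qed.

End SU3.

(** * The shear as a new bracket on the same vector space *)

Section DPhi.

Variables (R : realType) (V : vectType R) (al : V -> R) (s : V -> V -> R)
  (r : V -> V -> V -> R).
Hypotheses (sL : forall c x y z, s (c *: x + y) z = c * s x z + s y z)
  (rL : forall c x y z t, r (c *: x + y) z t = c * r x z t + r y z t).

(** The four-form s^2/2 + r /\ al in terms of its values. *)
Definition PhiQ (x y z t : V) : R :=
  Qs s x y z t + (r x y z * al t - r x y t * al z + r x z t * al y - r y z t * al x).

(** The two-form - F.s; it vanishes iff F preserves s infinitesimally. *)
Definition tau (F : V -> V) (x y : V) : R := s (F x) y - s (F y) x.

(** The wedge product of two alternating bilinear forms in terms of its values. *)
Definition wedge2 (t s' : V -> V -> R) (x1 x2 x3 x4 : V) : R :=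
  t x1 x2 * s' x3 x4 - t x1 x3 * s' x2 x4 + t x1 x4 * s' x2 x3
  + t x3 x4 * s' x1 x2 - t x2 x4 * s' x1 x3 + t x2 x3 * s' x1 x4.

(** The contraction of the three-form r with the vector-valued two-form w: a sum
    over the shuffles of four arguments. *)
Definition contr_r (w : V -> V -> V) (x1 x2 x3 x4 : V) : R :=
  r (w x1 x2) x3 x4 - r (w x1 x3) x2 x4 + r (w x1 x4) x2 x3
  + r (w x2 x3) x1 x4 - r (w x2 x4) x1 x3 + r (w x3 x4) x1 x2.

(** The contraction of s^2/2 with the vector-valued two-form w, which is the
    differential of s^2/2 for the bracket w. *)
Definition contr_Q (w : V -> V -> V) (x1 x2 x3 x4 x5 : V) : R :=
  - Qs s (w x1 x2) x3 x4 x5 + Qs s (w x1 x3) x2 x4 x5 - Qs s (w x1 x4) x2 x3 x5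
  + Qs s (w x1 x5) x2 x3 x4 - Qs s (w x2 x3) x1 x4 x5 + Qs s (w x2 x4) x1 x3 x5
  - Qs s (w x2 x5) x1 x3 x4 - Qs s (w x3 x4) x1 x2 x5 + Qs s (w x3 x5) x1 x2 x4
  - Qs s (w x4 x5) x1 x2 x3.

(** The part of the differential of [PhiQ] that is multiplied by al. *)
Definition dPhi_alpha (F : V -> V) (w : V -> V -> V) (x1 x2 x3 x4 : V) : R :=
  - wedge2 (tau F) s x1 x2 x3 x4 - contr_r w x1 x2 x3 x4.

Definition dPhi (br : V -> V -> V) (x1 x2 x3 x4 x5 : V) : R :=
  - PhiQ (br x1 x2) x3 x4 x5 + PhiQ (br x1 x3) x2 x4 x5
    - PhiQ (br x1 x4) x2 x3 x5 + PhiQ (br x1 x5) x2 x3 x4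
    - PhiQ (br x2 x3) x1 x4 x5 + PhiQ (br x2 x4) x1 x3 x5
    - PhiQ (br x2 x5) x1 x3 x4 - PhiQ (br x3 x4) x1 x2 x5
    + PhiQ (br x3 x5) x1 x2 x4 - PhiQ (br x4 x5) x1 x2 x3.

(** The differential of [PhiQ] for a bracket al (x) F - F (x) al + w, sorted by
    the number of factors al. It covers both the almost Abelian bracket (w = 0) and
    the sheared one. *)
Lemma dPhiE (F : V -> V) (w : V -> V -> V) (br : V -> V -> V) x1 x2 x3 x4 x5 :
  (forall x y, br x y = al x *: F y - al y *: F x + w x y) ->
  (forall x y, al (br x y) = 0) ->
  dPhi br x1 x2 x3 x4 x5
  = contr_Q w x1 x2 x3 x4 x5 + al x1 * dPhi_alpha F w x2 x3 x4 x5 - al x2 * dPhi_alpha F w x1 x3 x4 x5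
    + al x3 * dPhi_alpha F w x1 x2 x4 x5 - al x4 * dPhi_alpha F w x1 x2 x3 x5
    + al x5 * dPhi_alpha F w x1 x2 x3 x4.
Proof.
move=> brE albr.
have s3 x y z : s (br x y) z = al x * s (F y) z - al y * s (F x) z + s (w x y) z.
  by rewrite brE -addrA -scaleNr !sL; ring.
have r3 x y z t : r (br x y) z t = al x * r (F y) z t - al y * r (F x) z t + r (w x y) z t.
  by rewrite brE -addrA -scaleNr !rL; ring.
rewrite /dPhi /PhiQ !albr /Qs !s3 !r3 /contr_Q /dPhi_alpha /contr_r /wedge2 /tau /Qs.
ring.
Qed.

End DPhi.

Section Shear.

Variables (R : realType) (g : vectType R) (br : g -> g -> g) (u : {vspace g})
  (e : 7.-tuple g) (alpha : 'Hom(g, R^o)) (X : g) (Phi : ('I_4 -> g) -> R^o)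
  (sigma : ('I_2 -> g) -> R^o) (rho : ('I_3 -> g) -> R^o)
  (a : {vspace g}) (omega0 : ('I_2 -> g) -> g) (nu : 'End(g)).

Local Notation f := (ad br X).
Local Notation al x := (alpha x : R).
Local Notation s := (fun x y => app2 sigma x y : R).
Local Notation r := (fun x y z => app3 rho x y z : R).
Local Notation w := (app2 omega0).

Hypotheses (eB : basis_of fullv e) (brL : is_lie_bracket br)
  (uI : is_codim1_abelian_ideal br u)
  (alu : forall Y, Y \in u -> alpha Y = 0) (alX : alpha X = 1)
  (alD : forall x, x - al x *: X \in u).

Lemma brC x y : br y x = - br x y.
Proof.
case: brL => bL bR bA _; apply/eqP; rewrite -addr_eq0; apply/eqP.
have := bA (1 *: y + x).
by rewrite bL !bR !bA scaler0 !add0r addr0 !scale1r.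
Qed.

Lemma adE x : f x = br X x.
Proof.
by case: brL => _ bR _ _; apply: linfunE => c y z; apply: bR.
Qed.

Lemma brX x y : br X (y - x *: X) = br X y.
Proof. by case: brL => _ bR bA _; rewrite addrC -scaleNr bR bA scaler0 add0r. Qed.

(** Since u is Abelian, the bracket is determined by ad (X). *)
Lemma brE x y : br x y = al x *: f y - al y *: f x.
Proof.
case: uI => _ _ uab; case: brL => bL bR bA _.
rewrite !adE; have E z : z = al z *: X + (z - al z *: X) by rewrite addrC subrK.
have h : br (x - al x *: X) y = - (al y *: br X x).
  by rewrite (brC y) {1}(E y) bL (uab (y - _)) // addr0 brX.
by rewrite {1}(E x) bL h.
Qed.

Lemma al_br x y : al (br x y) = 0.
Proof.
case: uI => _ uid _; apply: alu; rewrite brE memvB //; apply: memvZ.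
  by rewrite adE -(brX (al y)) uid.
by rewrite adE -(brX (al x)) uid.
Qed.

Lemma fX : f X = 0.
Proof. by case: brL => _ _ bA _; rewrite adE. Qed.

Hypotheses (sF : form_on X sigma) (rF : form_on X rho)
  (PhiE : forall v, Phi v = 2%:R^-1 * wedge (@smul R) sigma sigma v
                          + wedge (@smul R) rho (form1 alpha) v).

Lemma app4_Phi x y z t : app4 Phi x y z t = PhiQ alpha s r x y z t :> R.
Proof.
have := PhiE (tnth [tuple x; y; z; t]); rewrite -!/(app4 _ x y z t) => ->.
rewrite (wedge22E _ _ _ _ sF.1 sF.1) (wedge31E _ _ _ _ _ rF.1) /PhiQ /Qs.
move: (app2 sigma x y) (app2 sigma x z) (app2 sigma x t) (app2 sigma y z)
  (app2 sigma y t) (app2 sigma z t) (app3 rho x y z) (app3 rho x y t)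
  (app3 rho x z t) (app3 rho y z t) (alpha x) (alpha y) (alpha z) (alpha t).
move=> a1 a2 a3 a4 a5 a6 a7 a8 a9 b1 b2 b3 b4 b5.
by field.
Qed.

Hypotheses (au : (a <= u)%VS) (fa : (f @: a <= a)%VS)
  (wT : in_tensor (fun b => form_on X b) a omega0)
  (nuX : nu X = 0) (nua : (limg nu <= a)%VS)
  (wa0 : forall Z Y, Z \in a -> Y \in u -> app2 omega0 Z Y = 0).

Lemma omega0_form : is_form omega0.
Proof.
case: wT => m [t [A [tA tE]]]; split=> [v i c x y|v i j ij vij].
  rewrite !tE scaler_sumr -big_split; apply: eq_bigr => k _ /=.
  by rewrite ((tA k).1).1.1 /vscale scalerDl scalerA.
by rewrite tE big1 // => k _; rewrite (((tA k).1).1.2 v i j ij vij) /vscale scale0r.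
Qed.

Lemma omega0_mem v : omega0 v \in a.
Proof.
case: wT => m [t [A [tA tE]]]; rewrite tE; apply: memv_suml => k _.
by apply: memvZ; case: (tA k).
Qed.

Lemma omega0_X v i : v i = X -> omega0 v = 0.
Proof.
case: wT => m [t [A [tA tE]]] viX; rewrite tE big1 // => k _.
by rewrite ((tA k).1.2 v i viX) /vscale scale0r.
Qed.

Lemma wX x : w x X = 0.
Proof. exact: (@omega0_X _ (lift ord0 ord0)). Qed.

Lemma Xw x : w X x = 0.
Proof. exact: (@omega0_X _ ord0). Qed.

Lemma wL c x y z : w (c *: x + y) z = c *: w x z + w y z.
Proof. exact: form2_lin omega0_form _ _ _ _. Qed.

Lemma wC x y : w y x = - w x y.
Proof. exact: form2C omega0_form _ _. Qed.

Lemma wR c x y z : w z (c *: x + y) = c *: w z x + w z y.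
Proof. exact: form2_linr omega0_form _ _ _ _. Qed.

Lemma wa x y : x \in a -> w x y = 0.
Proof.
move=> xa; rewrite -[y](subrK (al y *: X)) addrC wR wX scaler0 add0r.
exact: wa0.
Qed.

Lemma wa' x y : y \in a -> w x y = 0.
Proof. by move=> ya; rewrite wC wa // oppr0. Qed.

Lemma nu_mem x : nu x \in a.
Proof. by apply: subvP nua _ _; apply: memv_img; exact: memvf. Qed.

Lemma f_mem x : x \in a -> f x \in a.
Proof. by move=> xa; apply: subvP fa _ _; apply: memv_img. Qed.

Lemma al_a x : x \in a -> al x = 0.
Proof. by move=> xa; apply: alu; apply: subvP xa. Qed.

Lemma al_f x : al (f x) = 0.
Proof. by rewrite adE al_br. Qed.

Definition shear_form : ('I_2 -> g) -> subvs_of a := fun v =>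
  vsproj a (omega0 v + wedge (@vscale R g) (form1 alpha) (form1 nu) v).

Local Notation omega := shear_form.
Local Notation gam := (tensor_endo alpha (restrict_endo a f)).
Local Notation eta := (tensor_endo alpha (restrict_endo a (f + nu))).

(** The bracket of the shear, transported to g by [shear_map]. *)
Definition br_sh x y : g := al x *: (f y + nu y) - al y *: (f x + nu x) + w x y.

Lemma vsval_omega x y : vsval (app2 omega x y) = w x y + al x *: nu y - al y *: nu x.
Proof.
rewrite /app2 /omega -!/(app2 _ x y) wedge11E vsprojK -?addrA // memvD ?omega0_mem //.
by rewrite memvB // memvZ // nu_mem.
Qed.

(** This is the bracket of the extension p composed with (y, z) |-> y - z: the
    cocycle enters p with a minus sign and the projection changes it again. *)
Lemma br_shE x y : br_sh x y = br x y + vsval (app2 omega x y).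
Proof.
rewrite vsval_omega brE /br_sh !scalerDr; apply: (metric_inj eB) => z.
by rewrite !metricE; ring.
Qed.

Lemma vsval_tensor (A : 'End(g)) y z : (forall x, x \in a -> A x \in a) ->
  vsval (tensor_endo alpha (restrict_endo a A) y z) = al y *: A (vsval z).
Proof.
move=> Aa; rewrite /tensor_endo linfunE => [|c x x']; last first.
  by rewrite /vscale linearP scalerDl scalerA.
rewrite /vscale scale_lfunE linearZ /= /restrict_endo linfunE => [|c x x'].
  by rewrite vsprojK // Aa // subvsP.
by rewrite !linearP.
Qed.

Lemma is_flat_tensor (A : 'End(g)) : (forall x, x \in a -> A x \in a) ->
  is_flat br (tensor_endo alpha (restrict_endo a A)).
Proof.
move=> Aa x y z; apply: (@subvs_inj _ _ a).
rewrite linearB /= !vsval_tensor // al_br.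
by rewrite !linearZ /= !scalerA mulrC scale0r scalerN subrr.
Qed.

Definition jacobi_eq (x y : g) : Prop := f (w x y) + nu (w x y) = w (f x) y + w x (f y).

Lemma omega_form : is_form omega.
Proof.
have wF : is_form (wedge (@vscale R g) (form1 alpha) (form1 nu) : ('I_2 -> g) -> g).
  have aL c x y : alpha (c *: x + y) = c * alpha x + alpha y :> R by rewrite linearP.
  apply: is_form2 => *; rewrite !wedge11E /vscale ?subrr // !aL !(linearP nu) /=.
    by apply: (metric_inj eB) => t; rewrite !metricE; ring.
  by apply: (metric_inj eB) => t; rewrite !metricE; ring.
split=> [v i c x y|v i j ij vij]; rewrite /omega.
  by rewrite omega0_form.1 wF.1 addrACA -scalerDr linearP.
by rewrite (omega0_form.2 v i j ij vij) (wF.2 v i j ij vij) addr0 linear0.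
Qed.

(** All the conditions on the shear data except the closedness of omega hold by
    the choice of the connections, since a lies in the Abelian ideal u. The
    closedness of omega has no component on u, because u is Abelian and eta vanishes
    on u; its contraction with X is the stated identity. *)
Lemma shear_data_iff : is_shear_data br omega gam eta <-> forall x y, jacobi_eq x y.
Proof.
have fna x : x \in a -> (f + nu) x \in a by move=> xa; rewrite lfunE /= memvD ?f_mem ?nu_mem.
pose D x y := f (w x y) + nu (w x y) - (w (f x) y + w x (f y)).
have dE x y z : vsval (app3 (dCE br omega) x y z
    + app3 (wedge (fun (A : 'End(subvs_of a)) z => A z) (form1 eta) omega) x y z)
    = al x *: D y z - al y *: D x z + al z *: D x y.
  rewrite dCE2E (wedge12E _ _ _ _ omega_form) !(linearD, linearN) /= !vsval_tensor //.
  rewrite !vsval_omega !brE !add_lfunE.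
  have w1 c p d q t : w (c *: p - d *: q) t = c *: w p t - d *: w q t.
    by rewrite -scaleNr wL -[_ *: q]addr0 wL (wa _ (mem0v _)) addr0 scaleNr.
  rewrite !w1 (wC (f y) x) (wC (f z) x) (wC (f z) y).
  rewrite -!brE !al_br !brE.
  have A3 (A : 'End(g)) p c q d t : A (p + c *: q - d *: t) = A p + c *: A q - d *: A t.
    by rewrite linearB linearD /= !linearZ.
  have A2 (A : 'End(g)) c q d t : A (c *: q - d *: t) = c *: A q - d *: A t.
    by rewrite linearB /= !linearZ.
  by rewrite !A3 !A2; apply: (metric_inj eB) => t; rewrite !metricE; ring.
have D0 y : D X y = 0.
  by rewrite /D fX !Xw !linear0 (wa _ (mem0v _)) addr0 subr0.
split=> [[_ [_ dom] _ _ _] x y|S].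
  have := dE X x y; rewrite /app3 dom linear0 !D0 alX scale1r !scaler0 subr0 addr0.
  by move/esym/eqP; rewrite subr_eq0 => /eqP.
split.
- by split; [exact: omega_form | split; apply: is_flat_tensor; [exact: f_mem | exact: fna]].
- split=> [z1 z2|v].
    rewrite linearB /= !vsval_tensor //; try exact: f_mem.
    by rewrite !al_a ?subvsP // !scale0r subrr brE !al_a ?subvsP // !scale0r subrr.
  have D1 x y : D x y = 0 by rewrite /D S subrr.
  apply: subvs_inj; rewrite linear0.
  have -> : v = tnth [tuple v ord0; v (lift ord0 ord0); v (lift ord0 (lift ord0 ord0))].
    exact: (fun3E id v).
  by have := dE (v ord0) (v (lift ord0 ord0)) (v (lift ord0 (lift ord0 ord0)));
    rewrite /app3 => ->; rewrite !D1 !scaler0 subr0 addr0.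
- move=> y z; apply: subvs_inj; rewrite linearD /= !vsval_tensor //; try exact: f_mem.
  rewrite vsval_omega wa ?subvsP // add_lfunE (al_a (subvsP z)) scale0r !add0r.
  by rewrite scalerDr addrCA addNr addr0.
- move=> z1 z2; apply: subvs_inj; rewrite vsval_omega wa ?subvsP // !al_a ?subvsP //.
  by rewrite !scale0r subr0 addr0 linear0.
move=> z y; rewrite vsval_tensor; last exact: f_mem.
by rewrite brE (al_a (subvsP z)) scale0r sub0r.
Qed.

Lemma fun5E (T : Type) (b : ('I_5 -> g) -> T) (h : 'I_5 -> g) :
  let i1 := lift ord0 ord0 : 'I_5 in let i2 := lift ord0 (lift ord0 ord0) : 'I_5 in
  let i3 := lift ord0 (lift ord0 (lift ord0 ord0)) : 'I_5 in
  let i4 := lift ord0 (lift ord0 (lift ord0 (lift ord0 ord0))) : 'I_5 in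
  b h = app5 b (h ord0) (h i1) (h i2) (h i3) (h i4).
Proof.
move=> /=; congr b; apply: funext => i; rewrite (tnth_nth 0).
by case: i => [[|[|[|[|[|//]]]]] p] /=; congr h; apply: val_inj.
Qed.

Lemma al_br_sh x y : al (br_sh x y) = 0.
Proof. by rewrite br_shE linearD /= al_br add0r; apply: al_a; apply: subvsP. Qed.

Lemma dCE_Phi (b : g -> g -> g) x1 x2 x3 x4 x5 :
  app5 (dCE b Phi) x1 x2 x3 x4 x5 = dPhi alpha s r b x1 x2 x3 x4 x5 :> R.
Proof. by rewrite dCE4E !app4_Phi. Qed.

Section Sheared.

Variables (h : vectType R) (brh : h -> h -> h) (pi : 'Hom((g * subvs_of a)%type, h)).
Hypothesis (hS : is_shear br omega eta brh pi).

Let k := shear_map pi.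

Lemma shear_mapE y : k y = pi (y, 0).
Proof.
rewrite /k /shear_map linfunE // => c x x'.
by rewrite -linearP; congr (pi _); apply/pair_equal_spec; split=> //=; rewrite scaler0 addr0.
Qed.

Lemma shear_mapK y : ((k)^-1)%VF (k y) = y.
Proof.
apply: lker0_lfunK; rewrite -subv0; apply/subvP => z; rewrite memv_ker shear_mapE memv0.
case: hS => _ _ /(_ (z, 0)) H _; apply/implyP/implyP => /eqP /H /= zE.
by rewrite zE.
Qed.

(** Every Lie algebra that satisfies the definition of the shear is isomorphic to
    g with [br_sh]; the choice of the model is thus irrelevant. *)
Lemma brh_shear x y : brh (k x) (k y) = k (br_sh x y).
Proof.
case: hS => _ _ H hom; have e0 t : eta t 0 = 0 by rewrite linear0.
rewrite !shear_mapE -hom /p_bracket /= !e0 addr0 subr0.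
apply/eqP; rewrite -subr_eq0 -linearB; apply/eqP/H => /=.
by rewrite br_shE opprD addrA subrr add0r subr0.
Qed.

Lemma sheared_dCE x1 x2 x3 x4 x5 :
  app5 (dCE brh (sheared_form pi Phi)) (k x1) (k x2) (k x3) (k x4) (k x5)
  = dPhi alpha s r br_sh x1 x2 x3 x4 x5 :> R.
Proof.
have E y1 y2 y3 y4 : app4 (sheared_form pi Phi) (k y1) (k y2) (k y3) (k y4)
    = app4 Phi y1 y2 y3 y4 :> R.
  rewrite /app4 /sheared_form; congr Phi; apply: funext => i; rewrite !(tnth_nth 0).
  by case: i => [[|[|[|[|//]]]] p] /=; apply: shear_mapK.
by rewrite dCE4E !brh_shear !E -dCE4E dCE_Phi.
Qed.

End Sheared.

(** The new bracket satisfies the Jacobi identity exactly by [jacobi_eq], because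
    its double brackets only involve f + nu and omega_0 with values in a. *)
Lemma br_sh_is_shear : (forall x y, jacobi_eq x y) -> exists pi : 'Hom((g * subvs_of a)%type, g),
  is_shear br omega eta br_sh pi /\ (forall y, pi (y, 0) = y).
Proof.
move=> S; have [pi piE] : exists pi : 'Hom((g * subvs_of a)%type, g),
    forall p, pi p = p.1 - vsval p.2.
  apply: linfun_exists => c [x1 x2] [y1 y2] /=; rewrite linearP.
  by apply: (metric_inj eB) => t; rewrite !metricE; ring.
have aL c x y : alpha (c *: x + y) = c * alpha x + alpha y :> R by rewrite linearP.
exists pi; split=> [|y]; last by rewrite piE /= subr0.
have fna x : x \in a -> (f + nu) x \in a by move=> xa; rewrite add_lfunE memvD ?f_mem ?nu_mem.
split.
- split.
  + move=> c x y z; rewrite /br_sh aL !linearP wL /=.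
    by apply: (metric_inj eB) => t; rewrite !metricE; ring.
  + move=> c x y z; rewrite /br_sh aL !linearP wR /=.
    by apply: (metric_inj eB) => t; rewrite !metricE; ring.
  + move=> x; rewrite /br_sh subrr add0r.
    exact: form2_alt omega0_form _.
  move=> x y z; have Sd p q := S p q; rewrite /jacobi_eq in Sd.
  pose G := f + nu; have GE p : f p + nu p = G p by rewrite add_lfunE.
  have wG p q : w p (G q) = w p (f q) by rewrite -GE addrC -[nu q]scale1r wR (wa' _ (nu_mem q)) scaler0 add0r.
  have wb p q t : w p (br_sh q t) = al q *: w p (f t) - al t *: w p (f q).
    rewrite /br_sh !GE addrC -[w q t]scale1r wR (wa' _ (omega0_mem _)) scaler0 add0r.
    by rewrite addrC -scaleNr wR -[_ *: G t]addr0 wR (wa' _ (mem0v _)) addr0 !wG scaleNr addrC.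
  have Gb p q : G (br_sh p q) = al p *: G (G q) - al q *: G (G p) + (w (f p) q + w p (f q)).
    by rewrite -Sd -[f (w p q) + _]add_lfunE /br_sh !GE linearD linearB /= !linearZ.
  have out p q t : br_sh p (br_sh q t) = al p *: G (br_sh q t) + w p (br_sh q t).
    by rewrite {1}/br_sh al_br_sh scale0r subr0 GE.
  rewrite !out !Gb !wb (wC z (f y)) (wC x (f z)) (wC y (f x)).
  by apply: (metric_inj eB) => t; rewrite !metricE; ring.
- apply/vspaceP => y; rewrite memvf.
  have -> : y = pi (y, 0) by rewrite piE /= subr0.
  exact: memv_img (memvf _).
- move=> p; rewrite piE; split=> [/eqP|->]; last by rewrite subrr.
  by rewrite subr_eq0 => /eqP.
move=> [x1 x2] [y1 y2]; rewrite !piE /p_bracket /=.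
rewrite linearB linearD linearN /= !vsval_tensor // vsval_omega.
have aB p q : q \in a -> al (p - q) = al p by move=> qa; rewrite linearB /= (al_a qa) subr0.
have wB p q t : q \in a -> w (p - q) t = w p t.
  by move=> qa; rewrite addrC -scaleN1r wL wa // scaler0 add0r.
have wB' p q t : q \in a -> w t (p - q) = w t p.
  by move=> qa; rewrite addrC -scaleN1r wR wa' // scaler0 add0r.
rewrite /br_sh !aB ?subvsP // wB ?wB' ?subvsP // brE !add_lfunE !linearB /=.
by apply: (metric_inj eB) => t; rewrite !metricE; ring.
Qed.

Lemma sX x : s x X = 0.
Proof. exact: (sF.2 _ (lift ord0 ord0)). Qed.

Lemma Xs x : s X x = 0.
Proof. exact: (sF.2 _ ord0). Qed.

Lemma rX1 x y : r X x y = 0.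
Proof. exact: (rF.2 _ ord0). Qed.

Lemma rX2 x y : r x X y = 0.
Proof. exact: (rF.2 _ (lift ord0 ord0)). Qed.

Lemma s_lin c x y z : s (c *: x + y) z = c * s x z + s y z.
Proof. exact: form2_lin sF.1 _ _ _ _. Qed.

Lemma r_lin c x y z t : r (c *: x + y) z t = c * r x z t + r y z t.
Proof. exact: form3_lin rF.1 _ _ _ _ _. Qed.

(** The component without al is the equation on u; inserting X for one argument
    isolates the component with al. *)
Lemma dPhi_eq0 (F : g -> g) (v : g -> g -> g) (b : g -> g -> g) :
  F X = 0 -> (forall x, v X x = 0) -> (forall x, v x X = 0) -> s 0 =1 (fun=> 0) ->
  r 0 =2 (fun _ _ => 0) ->
  (forall x y, b x y = al x *: F y - al y *: F x + v x y) ->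
  (forall x y, al (b x y) = 0) ->
  (forall x1 x2 x3 x4 x5, dPhi alpha s r b x1 x2 x3 x4 x5 = 0) <->
  (forall x1 x2 x3 x4 x5, contr_Q s v x1 x2 x3 x4 x5 = 0)
  /\ (forall x1 x2 x3 x4, dPhi_alpha s r F v x1 x2 x3 x4 = 0).
Proof.
move=> FX vX vX' s0 r0 bE alb.
have dE x1 x2 x3 x4 x5 := dPhiE s_lin r_lin x1 x2 x3 x4 x5 bE alb.
split=> [H|[HA HB] x1 x2 x3 x4 x5]; last by rewrite dE HA !HB; ring.
have B x1 x2 x3 x4 : dPhi_alpha s r F v x1 x2 x3 x4 = 0.
  have := H X x1 x2 x3 x4; rewrite dE alX /contr_Q /Qs !vX.
  have eX y1 y2 y3 : dPhi_alpha s r F v X y1 y2 y3 = 0.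
    by rewrite /dPhi_alpha /wedge2 /contr_r /tau FX !vX !s0 !r0 !Xs !sX !rX2; ring.
  by rewrite !eX !s0 !Xs !sX => E; rewrite -[RHS]E; ring.
by split=> // x1 x2 x3 x4 x5; have := H x1 x2 x3 x4 x5; rewrite dE !B => E; rewrite -[RHS]E; ring.
Qed.

(** The first conclusion is the hypothesis that the structure is cocalibrated,
    and it cancels the contribution of f in the equation for f + nu. *)
Lemma shears_iff :
  (forall v, dCE br Phi v = 0) ->
  (forall x1 x2 x3 x4, wedge2 (tau s f) s x1 x2 x3 x4 = 0) /\
  ((is_shear_data br omega gam eta
    /\ exists (h : vectType R) (brh : h -> h -> h) (pi : 'Hom((g * subvs_of a)%type, h)),
       is_shear br omega eta brh pi /\ (forall v, dCE brh (sheared_form pi Phi) v = 0))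
   <-> [/\ forall x y, jacobi_eq x y,
          forall x1 x2 x3 x4 x5, contr_Q s w x1 x2 x3 x4 x5 = 0
        & forall x1 x2 x3 x4,
            wedge2 (tau s nu) s x1 x2 x3 x4 = - contr_r r w x1 x2 x3 x4]).
Proof.
move=> coc.
have s0 x : s 0 x = 0.
  have := s_lin 1 0 0 x; rewrite scaler0 addr0 mul1r => E.
  by apply: (addrI (s 0 x)); rewrite addr0 -E.
have r0 x y : r 0 x y = 0.
  have := r_lin 1 0 0 x y; rewrite scaler0 addr0 mul1r => E.
  by apply: (addrI (r 0 x y)); rewrite addr0 -E.
have tf x1 x2 x3 x4 : wedge2 (tau s f) s x1 x2 x3 x4 = 0.
  have [|_ /(_ x1 x2 x3 x4)] := (dPhi_eq0 (F := f) (v := fun _ _ => 0) (b := br)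
    fX (fun=> erefl) (fun=> erefl) s0 r0 (fun x y => etrans (brE x y) (esym (addr0 _))) al_br).1.
    by move=> y1 y2 y3 y4 y5; rewrite -dCE_Phi /app5 coc.
  by rewrite /dPhi_alpha /contr_r !r0 => E; apply: (@oppr_inj R); rewrite oppr0 -[RHS]E; ring.
split=> //.
have GX : f X + nu X = 0 by rewrite fX nuX addr0.
have [H1 H2] := dPhi_eq0 (F := fun x => f x + nu x) (v := w) (b := br_sh)
  GX Xw wX s0 r0 (fun _ _ => erefl) al_br_sh.
have sp p q t : s (p + q) t = s p t + s q t.
  by have := s_lin 1 p q t; rewrite scale1r mul1r.
have eqBE x1 x2 x3 x4 : dPhi_alpha s r (fun x => f x + nu x) w x1 x2 x3 x4
   = - wedge2 (tau s nu) s x1 x2 x3 x4 - contr_r r w x1 x2 x3 x4.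
  rewrite /dPhi_alpha; congr (_ - _); congr (- _).
  rewrite -[RHS](add0r _) -[X in X + _](tf x1 x2 x3 x4) /wedge2 /tau !sp; ring.
split=> [[sd [h [brh [pi [hS hd]]]]]|[S A B]].
  have [|A B] := H1.
    by move=> x1 x2 x3 x4 x5; rewrite -(sheared_dCE hS) /app5 hd.
  split=> // [|x1 x2 x3 x4]; first by apply/shear_data_iff.
  by have := B x1 x2 x3 x4; rewrite eqBE => E; apply/eqP; rewrite -addr_eq0 -oppr_eq0 opprD E.
split; first by apply/shear_data_iff.
have [pi [hS piE]] := br_sh_is_shear S.
exists g, br_sh, pi; split=> // v.
have kE y : shear_map pi y = y by rewrite shear_mapE piE.
have D : forall x1 x2 x3 x4 x5, dPhi alpha s r br_sh x1 x2 x3 x4 x5 = 0.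
  by apply: H2; split=> // x1 x2 x3 x4; rewrite eqBE B opprK subrr.
rewrite (fun5E (dCE br_sh (sheared_form pi Phi))).
move: (v _) (v _) (v _) (v _) (v _) => x5 x4 x3 x2 x1.
by have := sheared_dCE hS x1 x2 x3 x4 x5; rewrite !kE D.
Qed.
End Shear.

(** * The two-form and the three-form in a unitary frame *)

(** The facts about the induced structure on u on which the remaining arguments
    rest; the forms are curried and extended to g by their vanishing on X. *)
Record su3_setting (R : realType) (V : vectType R) (n : nat) (e : n.-tuple V)
    (u : {vspace V}) (X : V) (J : 'End(V)) (s : V -> V -> R) (r : V -> V -> V -> R) : Prop :=
  Su3Setting {
    su3_basis : basis_of fullv e;
    su3_dim : \dim u = 6%N;
    su3_X : forall x, x \in u -> metric e X x = 0;
    su3_proj : forall x, x - metric e X x *: X \in u;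
    su3_JX : J X = 0;
    su3_Ju : forall x, J x \in u;
    su3_JJ : forall x, x \in u -> J (J x) = - x;
    su3_skew : forall x y, metric e (J x) y = - metric e x (J y);
    su3_s : forall x y, s x y = metric e x (J y);
    su3_rL : forall c x y z t, r (c *: x + y) z t = c * r x z t + r y z t;
    su3_rC1 : forall x y z, r y x z = - r x y z;
    su3_rC2 : forall x y z, r x z y = - r x y z;
    su3_rX : forall x y, r X x y = 0;
    su3_rJ : forall x y z, r (J x) y z = r x (J y) z }.

Section Su3.

Variables (R : realType) (V : vectType R) (n : nat) (e : n.-tuple V)
  (u : {vspace V}) (X : V) (J : 'End(V)) (s : V -> V -> R) (r : V -> V -> V -> R).
Hypothesis (su3 : su3_setting e u X J s r).

Let eB := su3_basis su3.
Let u6 := su3_dim su3.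
Let skew x y (_ : x \in u) (_ : y \in u) := su3_skew su3 x y.
Let JJ := su3_JJ su3.
Let Ju x (_ : x \in u) := su3_Ju su3 x.

Lemma s_linear c x y z : s (c *: x + y) z = c * s x z + s y z.
Proof. by rewrite !(su3_s su3) metricDl metricZl. Qed.

Lemma s_anti x y : s y x = - s x y.
Proof. by rewrite !(su3_s su3) metricC (su3_skew su3). Qed.

Lemma s_X y : s X y = 0.
Proof. by rewrite (su3_s su3) (su3_X su3) // (su3_Ju su3). Qed.

Section InFrame.

Variable (b : nat -> V).
Hypothesis (bF : unitary_frame e u J b).
Local Notation c := (fun i x => metric e (b i) x).

Let m i : (i < 6)%N -> b i \in u. Proof. exact: (frame_mem bF). Qed.
Let o i j : (i < 6)%N -> (j < 6)%N -> metric e (b i) (b j) = (i == j)%:R.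
Proof. exact: (frame_orth bF). Qed.
Let E0 : J (b 0%N) = b 1%N. Proof. exact: (frame_J0 bF). Qed.
Let E2 : J (b 2%N) = b 3%N. Proof. exact: (frame_J2 bF). Qed.
Let E4 : J (b 4%N) = b 5%N. Proof. exact: (frame_J4 bF). Qed.
Let E1 : J (b 1%N) = - b 0%N. Proof. exact: (frame_J1 JJ bF). Qed.
Let E3 : J (b 3%N) = - b 2%N. Proof. exact: (frame_J3 JJ bF). Qed.
Let E5 : J (b 5%N) = - b 4%N. Proof. exact: (frame_J5 JJ bF). Qed.

Lemma coord_X i : (i < 6)%N -> metric e (b i) X = 0.
Proof. by move=> i6; rewrite metricC (su3_X su3) // m. Qed.

Lemma coord_proj i x k : (i < 6)%N -> metric e (b i) (x - k *: X) = metric e (b i) x.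
Proof. by move=> i6; rewrite !metricE coord_X // mulr0 subr0. Qed.

Lemma coordJ x : (c 0%N (J x) = - c 1%N x) * (c 1%N (J x) = c 0%N x) * (c 2%N (J x) = - c 3%N x)
  * (c 3%N (J x) = c 2%N x) * (c 4%N (J x) = - c 5%N x) * (c 5%N (J x) = c 4%N x).
Proof.
have k y z : metric e y (J z) = - metric e (J y) z by rewrite (su3_skew su3) opprK.
by rewrite !k E0 E1 E2 E3 E4 E5 !metricNl !opprK.
Qed.

Lemma two_form_frame (t : V -> V -> R) :
  (forall c x y z, t (c *: x + y) z = c * t x z + t y z) ->
  (forall x y, t y x = - t x y) -> (forall y, t X y = 0) -> forall x y,
  let c i j := metric e (b i) x * metric e (b j) y - metric e (b j) x * metric e (b i) y in
  t x y = t (b 0%N) (b 1%N) * c 0%N 1%N + t (b 0%N) (b 2%N) * c 0%N 2%N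
    + t (b 0%N) (b 3%N) * c 0%N 3%N + t (b 0%N) (b 4%N) * c 0%N 4%N + t (b 0%N) (b 5%N) * c 0%N 5%N
    + t (b 1%N) (b 2%N) * c 1%N 2%N + t (b 1%N) (b 3%N) * c 1%N 3%N
    + t (b 1%N) (b 4%N) * c 1%N 4%N + t (b 1%N) (b 5%N) * c 1%N 5%N
    + t (b 2%N) (b 3%N) * c 2%N 3%N + t (b 2%N) (b 4%N) * c 2%N 4%N + t (b 2%N) (b 5%N) * c 2%N 5%N
    + t (b 3%N) (b 4%N) * c 3%N 4%N + t (b 3%N) (b 5%N) * c 3%N 5%N + t (b 4%N) (b 5%N) * c 4%N 5%N.
Proof.
move=> tL tC tX x y.
have tp z y' : t (z - metric e X z *: X) y' = t z y'.
  by rewrite addrC -scaleNr tL tX mulr0 add0r.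
have := bilinear_frame u6 bF tL tC (su3_proj su3 x) (su3_proj su3 y).
by rewrite tp tC tp -tC /= !coord_proj.
Qed.

Lemma sE x y : s x y = - (c 0%N x * c 1%N y - c 1%N x * c 0%N y)
    - (c 2%N x * c 3%N y - c 3%N x * c 2%N y) - (c 4%N x * c 5%N y - c 5%N x * c 4%N y).
Proof.
have sp z t : s (z - metric e X z *: X) t = s z t.
  by rewrite addrC -scaleNr s_linear s_X mulr0 add0r.
rewrite -(sp x) s_anti -sp -s_anti (su3_s su3).
by rewrite (metricJ_frame u6 Ju skew JJ bF (su3_proj su3 x) (su3_proj su3 y)) !coord_proj.
Qed.

Lemma vec_frame x : x \in u ->
  x = c 0%N x *: b 0%N + c 1%N x *: b 1%N + c 2%N x *: b 2%N
    + c 3%N x *: b 3%N + c 4%N x *: b 4%N + c 5%N x *: b 5%N.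
Proof. exact: (frame_expand u6 bF). Qed.

(** Since rho is the real part of a complex volume form, its contraction with b_0
    is the real part of a complex volume form of <b_2, ..., b_5>: two real numbers
    determine it. *)
Lemma rho_b0E x y (p := r (b 0%N) (b 2%N) (b 4%N)) (q := r (b 0%N) (b 2%N) (b 5%N)) :
  r (b 0%N) x y = p * (c 2%N x * c 4%N y - c 4%N x * c 2%N y) + q * (c 2%N x * c 5%N y - c 5%N x * c 2%N y)
    + q * (c 3%N x * c 4%N y - c 4%N x * c 3%N y) - p * (c 3%N x * c 5%N y - c 5%N x * c 3%N y).
Proof.
have C1 := su3_rC1 su3; have C2 := su3_rC2 su3; have rJ := su3_rJ su3.
have cy x' y' z' : r y' z' x' = r x' y' z' by rewrite C2 C1 opprK.
have rJ3 x' y' z' : r x' y' (J z') = r x' (J y') z' by rewrite -cy -rJ -rJ cy.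
have rX2 x' y' : r x' X y' = 0 by rewrite C1 (su3_rX su3) oppr0.
have rL2 c' x' y' z' t' : r t' (c' *: x' + y') z' = c' * r t' x' z' + r t' y' z'.
  by rewrite C1 (su3_rL su3) (C1 t') (C1 t' y'); ring.
have rN x' y' z' : r x' (- y') z' = - r x' y' z'.
  have := rL2 1 (- y') y' z' x'; rewrite scale1r addNr mul1r => E.
  have := rL2 1 0 0 z' x'; rewrite scaler0 addr0 mul1r => E'; lra.
rewrite (two_form_frame (t := r (b 0%N)) (fun c' x' y' z' => rL2 c' x' y' z' _)
  (C2 (b 0%N)) (rX2 (b 0%N))).
have r01 z : r (b 0%N) (b 1%N) z = 0 by have := C1 (b 0%N) (b 1%N) z; rewrite -E0 -rJ E0 => h; lra.
have r23 : r (b 0%N) (b 2%N) (b 3%N) = 0.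
  by have := C2 (b 0%N) (b 2%N) (b 3%N); rewrite -E2 rJ3 E2 => h; lra.
have r45 : r (b 0%N) (b 4%N) (b 5%N) = 0.
  by have := C2 (b 0%N) (b 4%N) (b 5%N); rewrite -E4 rJ3 E4 => h; lra.
have r34 : r (b 0%N) (b 3%N) (b 4%N) = q by rewrite -E2 -rJ3 E4.
have r35 : r (b 0%N) (b 3%N) (b 5%N) = - p by rewrite -E4 rJ3 E3 rN.
rewrite !r01 r23 r45 r34 r35 -/p -/q.
have r00 z : r (b 0%N) (b 0%N) z = 0 by have := C1 (b 0%N) (b 0%N) z => h; lra.
by rewrite /= !r00; ring.
Qed.

Lemma rho_b1E x y (p := r (b 0%N) (b 2%N) (b 4%N)) (q := r (b 0%N) (b 2%N) (b 5%N)) :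
  r (b 1%N) x y = q * (c 2%N x * c 4%N y - c 4%N x * c 2%N y) - p * (c 2%N x * c 5%N y - c 5%N x * c 2%N y)
    - p * (c 3%N x * c 4%N y - c 4%N x * c 3%N y) - q * (c 3%N x * c 5%N y - c 5%N x * c 3%N y).
Proof. by rewrite -E0 (su3_rJ su3) rho_b0E !coordJ -/p -/q; ring. Qed.

(** Of the fifteen equations given by the quadruples of frame vectors, twelve
    isolate one off-diagonal component of the two-form each, and the other three form
    an invertible system for the components on the three complex lines. *)
Lemma lefschetz_inj (t : V -> V -> R) :
  (forall c x y z, t (c *: x + y) z = c * t x z + t y z) ->
  (forall x y, t y x = - t x y) -> (forall y, t X y = 0) ->
  (forall x1 x2 x3 x4, wedge2 t s x1 x2 x3 x4 = 0) -> forall x y, t x y = 0.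
Proof.
move=> tL tC tX tw x y.
have sb i j : (i < 6)%N -> (j < 6)%N -> s (b i) (b j) = metric e (b i) (J (b j)).
  by move=> *; rewrite (su3_s su3).
have W i j k l := tw (b i) (b j) (b k) (b l).
have S01 : s (b 0%N) (b 1%N) = -1 by rewrite sb // E1 metricNr o.
have S23 : s (b 2%N) (b 3%N) = -1 by rewrite sb // E3 metricNr o.
have S45 : s (b 4%N) (b 5%N) = -1 by rewrite sb // E5 metricNr o.
have S02 : s (b 0%N) (b 2%N) = 0 by rewrite sb // E2 o.
have S03 : s (b 0%N) (b 3%N) = 0 by rewrite sb // E3 metricNr o // oppr0.
have S04 : s (b 0%N) (b 4%N) = 0 by rewrite sb // E4 o.
have S05 : s (b 0%N) (b 5%N) = 0 by rewrite sb // E5 metricNr o // oppr0.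
have S12 : s (b 1%N) (b 2%N) = 0 by rewrite sb // E2 o.
have S13 : s (b 1%N) (b 3%N) = 0 by rewrite sb // E3 metricNr o // oppr0.
have S14 : s (b 1%N) (b 4%N) = 0 by rewrite sb // E4 o.
have S15 : s (b 1%N) (b 5%N) = 0 by rewrite sb // E5 metricNr o // oppr0.
have S24 : s (b 2%N) (b 4%N) = 0 by rewrite sb // E4 o.
have S25 : s (b 2%N) (b 5%N) = 0 by rewrite sb // E5 metricNr o // oppr0.
have S34 : s (b 3%N) (b 4%N) = 0 by rewrite sb // E4 o.
have S35 : s (b 3%N) (b 5%N) = 0 by rewrite sb // E5 metricNr o // oppr0.
move: (W 0%N 1%N 2%N 3%N) (W 0%N 1%N 4%N 5%N) (W 2%N 3%N 4%N 5%N) (W 0%N 1%N 2%N 4%N) (W 0%N 1%N 2%N 5%N)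
  (W 0%N 1%N 3%N 4%N) (W 0%N 1%N 3%N 5%N) (W 0%N 2%N 3%N 4%N) (W 0%N 2%N 3%N 5%N) (W 1%N 2%N 3%N 4%N) (W 1%N 2%N 3%N 5%N)
  (W 0%N 2%N 4%N 5%N) (W 0%N 3%N 4%N 5%N) (W 1%N 2%N 4%N 5%N) (W 1%N 3%N 4%N 5%N); rewrite /wedge2.
rewrite S01 S23 S45 S02 S03 S04 S05 S12 S13 S14 S15 S24 S25 S34 S35.
move=> w1 w2 w3 w4 w5 w6 w7 w8 w9 w10 w11 w12 w13 w14 w15.
rewrite (two_form_frame tL tC tX x y) /=.
have -> : t (b 0%N) (b 1%N) = 0 by lra.
have -> : t (b 2%N) (b 3%N) = 0 by lra.
have -> : t (b 4%N) (b 5%N) = 0 by lra.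
have -> : t (b 2%N) (b 4%N) = 0 by lra.
have -> : t (b 2%N) (b 5%N) = 0 by lra.
have -> : t (b 3%N) (b 4%N) = 0 by lra.
have -> : t (b 3%N) (b 5%N) = 0 by lra.
have -> : t (b 0%N) (b 4%N) = 0 by lra.
have -> : t (b 0%N) (b 5%N) = 0 by lra.
have -> : t (b 1%N) (b 4%N) = 0 by lra.
have -> : t (b 1%N) (b 5%N) = 0 by lra.
have -> : t (b 0%N) (b 2%N) = 0 by lra.
have -> : t (b 0%N) (b 3%N) = 0 by lra.
have -> : t (b 1%N) (b 2%N) = 0 by lra.
have -> : t (b 1%N) (b 3%N) = 0 by lra.
ring.
Qed.

End InFrame.
End Su3.

(** * The shear equations in a unitary frame *)

(** The properties of f, nu, omega_0 and a used in the frame computations; the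
    last one says that f lies in sp (u, sigma). *)
Record shear_setting (R : realType) (V : vectType R) (u a : {vspace V}) (X : V)
    (s : V -> V -> R) (w : V -> V -> V) (f nu : 'End(V)) : Prop := ShearSetting {
  sh_au : (a <= u)%VS;
  sh_fX : f X = 0;
  sh_fu : forall x, f x \in u;
  sh_fa : forall x, x \in a -> f x \in a;
  sh_nuX : nu X = 0;
  sh_nua : forall x, nu x \in a;
  sh_wL : forall c x y z, w (c *: x + y) z = c *: w x z + w y z;
  sh_wC : forall x y, w y x = - w x y;
  sh_wX : forall y, w X y = 0;
  sh_wA : forall x y, w x y \in a;
  sh_wa : forall x y, x \in a -> w x y = 0;
  sh_tau : forall x y, tau s f x y = 0 }.

(** The Jacobi identity of the sheared bracket, and the closedness of the sheared
    four-form on u and after contraction with X. *)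
Definition shear_equations (R : realType) (V : vectType R) (s : V -> V -> R)
    (r : V -> V -> V -> R) (w : V -> V -> V) (f nu : 'End(V)) : Prop :=
  [/\ forall x y, f (w x y) + nu (w x y) = w (f x) y + w x (f y),
      forall x1 x2 x3 x4 x5, contr_Q s w x1 x2 x3 x4 x5 = 0
    & forall x1 x2 x3 x4, wedge2 (tau s nu) s x1 x2 x3 x4 = - contr_r r w x1 x2 x3 x4].

Section Cases.

Variables (R : realType) (V : vectType R) (n : nat) (e : n.-tuple V)
  (u a : {vspace V}) (X : V) (J : 'End(V)) (s : V -> V -> R) (r : V -> V -> V -> R)
  (w : V -> V -> V) (f nu : 'End(V)) (b : nat -> V).
Hypotheses (su3 : su3_setting e u X J s r) (sh : shear_setting u a X s w f nu)
  (bF : unitary_frame e u J b).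
Local Notation c := (fun i x => metric e (b i) x).

Let eB := su3_basis su3.
Let sE := sE su3 bF.
Let o i j : (i < 6)%N -> (j < 6)%N -> metric e (b i) (b j) = (i == j)%:R.
Proof. exact: (frame_orth bF). Qed.

Let cD i x y : c i (x + y) = c i x + c i y. Proof. exact: metricDr. Qed.
Let cZ i k x : c i (k *: x) = k * c i x. Proof. exact: metricZr. Qed.

Let sL := s_linear su3.
Let sC := s_anti su3.
Let sX := s_X su3.

Lemma tau_linear (T : 'End(V)) k x y z :
  tau s T (k *: x + y) z = k * tau s T x z + tau s T y z.
Proof.
rewrite /tau linearP !sL (sC (k *: x + y)) (sC x) (sC y) sL; ring.
Qed.

Lemma tau_anti (T : 'End(V)) x y : tau s T y x = - tau s T x y.
Proof. by rewrite /tau opprB. Qed.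

Lemma tau_X (T : 'End(V)) y : T X = 0 -> tau s T X y = 0.
Proof.
move=> TX; rewrite /tau TX (sC X) sX oppr0 subr0.
by have := sL 1 0 0 y; rewrite scaler0 addr0 mul1r => E; lra.
Qed.

(** Once one solution T of the equation for the contraction with X is known, the
    injectivity of the wedge product with s shows that the solutions are the nu
    with nu - T in sp (u, s). *)
Lemma tau_eq (T : V -> V) :
  (forall k x y, T (k *: x + y) = k *: T x + T y) -> T X = 0 ->
  (forall x1 x2 x3 x4, wedge2 (tau s T) s x1 x2 x3 x4 = - contr_r r w x1 x2 x3 x4) ->
  (forall x1 x2 x3 x4, wedge2 (tau s nu) s x1 x2 x3 x4 = - contr_r r w x1 x2 x3 x4) <->
  forall x y, tau s nu x y = tau s T x y.
Proof.
move=> TL TX TB; split=> [H x y|H x1 x2 x3 x4]; last by rewrite -TB /wedge2 !H.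
pose A := linfun T; have AE : A =1 T by apply: linfunE.
have tA x' y' : tau s T x' y' = tau s A x' y' by rewrite /tau !AE.
apply/eqP; rewrite -subr_eq0; apply/eqP.
apply: (lefschetz_inj su3 bF (t := fun x y => tau s nu x y - tau s T x y)) => /=.
- by move=> k p q z; rewrite !tA !tau_linear; ring.
- by move=> p q; rewrite tau_anti tA (tau_anti A) -tA; ring.
- by move=> q; rewrite tA !tau_X ?subrr ?(sh_nuX sh) // AE.
move=> x1 x2 x3 x4; have := H x1 x2 x3 x4; rewrite -TB /wedge2 => E.
by apply/eqP; rewrite -subr_eq0 in E *; apply/eqP; rewrite -[RHS](subrr (wedge2 (tau s nu) s x1 x2 x3 x4)) {2}/wedge2; move: E; rewrite /wedge2; lra.
Qed.

(** An element of sp (u, s) satisfies s (f b, J b) + s (b, f (J b)) = 0 for every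
    frame vector b, which is the trace on the line of b and J b. *)
Lemma sp_trace :
  [/\ c 0%N (f (b 0%N)) + c 1%N (f (b 1%N)) = 0, c 2%N (f (b 2%N)) + c 3%N (f (b 3%N)) = 0
    & c 4%N (f (b 4%N)) + c 5%N (f (b 5%N)) = 0].
Proof.
have t := sh_tau sh; split.
- by have := t (b 0%N) (b 1%N); rewrite /tau !sE !o //= => E; lra.
- by have := t (b 2%N) (b 3%N); rewrite /tau !sE !o //= => E; lra.
by have := t (b 4%N) (b 5%N); rewrite /tau !sE !o //= => E; lra.
Qed.

Lemma f_frame i x : (i < 6)%N -> c i (f x)
  = c 0%N x * c i (f (b 0%N)) + c 1%N x * c i (f (b 1%N)) + c 2%N x * c i (f (b 2%N))
  + c 3%N x * c i (f (b 3%N)) + c 4%N x * c i (f (b 4%N)) + c 5%N x * c i (f (b 5%N)).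
Proof.
move=> i6; have -> : f x = f (x - metric e X x *: X).
  by rewrite linearB linearZ /= (sh_fX sh) scaler0 subr0.
rewrite {1}(vec_frame su3 bF (su3_proj su3 x)) !(coord_proj su3 bF) //.
by rewrite !linearD !linearZ /= !cD !cZ.
Qed.

Lemma endZZ (A : 'End(V)) l j v : A (l *: (j *: v)) = l *: (j *: A v).
Proof. by rewrite linearZ /=; congr (_ *: _); rewrite linearZ. Qed.

Section CaseB.

Variable (k : R).
Hypotheses (k0 : k != 0)
  (aE : forall x, x \in a -> c 1%N x = 0 /\ c 2%N x = 0)
  (ab : [/\ b 0%N \in a, b 3%N \in a, b 4%N \in a & b 5%N \in a])
  (wE : forall x y, w x y = (c 1%N x * c 2%N y - c 2%N x * c 1%N y) *: (k *: b 0%N)).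

Let tr := c 0%N (f (b 0%N)) + c 3%N (f (b 3%N)) + c 4%N (f (b 4%N)) + c 5%N (f (b 5%N)).
Let p := r (b 0%N) (b 2%N) (b 4%N).
Let q := r (b 0%N) (b 2%N) (b 5%N).
(** A solution of the third shear equation. *)
Let T x := c 1%N x *: (k *: (p *: b 4%N + q *: b 5%N)).

Lemma contr_r_scale (t : V -> V -> V -> R) j :
  (forall c x y z t', t (c *: x + y) z t' = c * t x z t' + t y z t') ->
  forall l x y, t (l *: (j *: b 0%N)) x y = l * j * t (b 0%N) x y.
Proof.
move=> tL l x y; have t0 : t 0 x y = 0.
  have := tL 1 0 0 x y; rewrite scaler0 addr0 mul1r => E.
  by apply: (addrI (t 0 x y)); rewrite addr0 -E.
by rewrite scalerA -[_ *: _]addr0 tL t0 addr0.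
Qed.

Lemma tauT_B x y : tau s T x y
  = k * (c 1%N x * (q * c 4%N y - p * c 5%N y) - c 1%N y * (q * c 4%N x - p * c 5%N x)).
Proof. by rewrite /tau !sE /T !cZ !cD !cZ !o //=; ring. Qed.

Lemma rho_b0E' x y : r (b 0%N) x y
  = p * (c 2%N x * c 4%N y - c 4%N x * c 2%N y) + q * (c 2%N x * c 5%N y - c 5%N x * c 2%N y)
    + q * (c 3%N x * c 4%N y - c 4%N x * c 3%N y)
    - p * (c 3%N x * c 5%N y - c 5%N x * c 3%N y).
Proof. exact: (rho_b0E su3 bF x y). Qed.

Lemma contr_r_B x1 x2 x3 x4 :
  wedge2 (tau s T) s x1 x2 x3 x4 = - contr_r r w x1 x2 x3 x4.
Proof.
rewrite /contr_r !wE !(contr_r_scale _ (su3_rL su3)) !rho_b0E'.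
rewrite /wedge2 !tauT_B !sE; ring.
Qed.

Lemma contr_Q_B x1 x2 x3 x4 x5 : contr_Q s w x1 x2 x3 x4 x5 = 0.
Proof.
have sw l x : s (l *: (k *: b 0%N)) x = - (l * k * c 1%N x).
  by rewrite sE !cZ !o //=; ring.
rewrite /contr_Q !wE /Qs !sw !sE; ring.
Qed.

(** The Jacobi identity gives (f + nu) b_0 = - tr b_0. The third equation forces
    nu b_0 = 0 separately: s (nu b_0, .) is then zero since T vanishes at b_0 and
    the values of nu, lying in a, have no component on b_1. *)
Lemma shear_equations_orthogonal : shear_equations s r w f nu <->
  [/\ f (b 0%N) = - tr *: b 0%N, nu (b 0%N) = 0 & forall x y, tau s nu x y = tau s T x y].
Proof.
have [t01 t23 t45] := sp_trace.
have [a0 a3 a4 a5] := ab.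
have fi i j : (i < 6)%N -> b j \in a -> (i == 1%N) || (i == 2%N) -> c i (f (b j)) = 0.
  move=> _ ja ii; have [h1 h2] := aE (sh_fa sh ja).
  by case/orP: ii => /eqP ->.
have TL l x y : T (l *: x + y) = l *: T x + T y.
  by rewrite /T cD cZ scalerDl -[(l * _) *: _]scalerA.
have TX : T X = 0 by rewrite /T (coord_X su3 bF) // scale0r.
have iffB := tau_eq TL TX contr_r_B.
pose F i j := c i (f (b j)).
have wf x y : w (f x) y + w x (f y)
    = (c 1%N x * c 2%N y - c 2%N x * c 1%N y) *: (k *: (- tr *: b 0%N)).
  have e1 z : c 1%N (f z) = c 1%N z * F 1%N 1%N + c 2%N z * F 1%N 2%N.
    by rewrite /F (f_frame z (i := 1)) // (fi 1%N 0%N) // (fi 1%N 3%N) // (fi 1%N 4%N) //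
      (fi 1%N 5%N) //; ring.
  have e2 z : c 2%N (f z) = c 1%N z * F 2%N 1%N + c 2%N z * F 2%N 2%N.
    by rewrite /F (f_frame z (i := 2)) // (fi 2%N 0%N) // (fi 2%N 3%N) // (fi 2%N 4%N) //
      (fi 2%N 5%N) //; ring.
  rewrite !wE !e1 !e2 -scalerDl !scalerA; congr (_ *: _).
  have -> : F 1%N 1%N = - F 0%N 0%N by rewrite /F; lra.
  have -> : F 2%N 2%N = - F 3%N 3%N by rewrite /F; lra.
  have : F 5%N 5%N = - F 4%N 4%N by rewrite /F; lra.
  rewrite /tr -!/(F _ _) => ->; ring.
split=> [[S A /iffB B]|[fb nub B]].
  have fn : f (b 0%N) + nu (b 0%N) = - tr *: b 0%N.
    have := S (b 1%N) (b 2%N); rewrite wf wE !o //= !mulr0 mul1r subr0 !endZZ !scale1r.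
    by rewrite -scalerDr => E; apply: (scalerI k0).
  have nub : nu (b 0%N) = 0.
    have nu0 y : s (nu (b 0%N)) y = 0.
      have := B (b 0%N) y; rewrite tauT_B /tau !o //= (sE (nu y)) !o //=.
      by have [-> _] := aE (sh_nua sh y) => E; lra.
    have nuu : nu (b 0%N) \in u by apply: subvP (sh_au sh) _ (sh_nua sh _).
    apply: (metric_eq0 eB).
    by have := nu0 (J (nu (b 0%N))); rewrite (su3_s su3) (su3_JJ su3) // metricNr => E; lra.
  by split=> //; rewrite -fn nub addr0.
split; last exact/iffB.
  by move=> x y; rewrite wf wE !endZZ fb nub !scaler0 addr0.
exact: contr_Q_B.
Qed.

End CaseB.

Section CaseC.

Variable (k : R).
Hypotheses (k0 : k != 0)
  (aE : forall x, x \in a -> c 2%N x = 0 /\ c 4%N x = 0)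
  (ab : [/\ b 0%N \in a, b 1%N \in a, b 3%N \in a & b 5%N \in a])
  (wE : forall x y, w x y = (c 2%N x * c 4%N y - c 4%N x * c 2%N y) *: (k *: b 0%N)).

Let tr := c 0%N (f (b 0%N)) + c 1%N (f (b 1%N)) + c 3%N (f (b 3%N)) + c 5%N (f (b 5%N)).
Let p := r (b 0%N) (b 2%N) (b 4%N).
Let q := r (b 0%N) (b 2%N) (b 5%N).
Let mu := - (k * p) / 2%:R.

(** The solution of the third shear equation that agrees with the value
    - tr b_0 - f b_0 imposed at b_0 by the Jacobi identity. *)
Definition nu_stable x : V := c 0%N x *: (- tr *: b 0%N - f (b 0%N))
  + c 1%N x *: ((- s (f (b 0%N)) (b 1%N) + tr - mu) *: b 1%N)
  + c 3%N x *: (mu *: b 3%N) + c 5%N x *: (mu *: b 5%N)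
  - (c 2%N x * s (f (b 0%N)) (b 2%N) + c 4%N x * s (f (b 0%N)) (b 4%N)) *: b 1%N.
Local Notation T := nu_stable.

Lemma tauT_C x y : tau s T x y
  = mu * ((c 0%N x * c 1%N y - c 1%N x * c 0%N y) - (c 2%N x * c 3%N y - c 3%N x * c 2%N y)
          - (c 4%N x * c 5%N y - c 5%N x * c 4%N y)).
Proof.
have [a0 a1 a3 a5] := ab; have [f2 f4] := aE (sh_fa sh a0).
have h1 : s (f (b 0%N)) (b 1%N) = - c 0%N (f (b 0%N)) by rewrite sE !o //=; ring.
have h2 : s (f (b 0%N)) (b 2%N) = c 3%N (f (b 0%N)) by rewrite sE !o //=; ring.
have h4 : s (f (b 0%N)) (b 4%N) = c 5%N (f (b 0%N)) by rewrite sE !o //=; ring.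
have cT z i : (i < 6)%N -> c i (T z) = c 0%N z * (- tr * (i == 0%N)%:R - c i (f (b 0%N)))
    + c 1%N z * ((c 0%N (f (b 0%N)) + tr - mu) * (i == 1%N)%:R)
    + c 3%N z * (mu * (i == 3)%:R) + c 5%N z * (mu * (i == 5)%:R)
    - (c 2%N z * c 3%N (f (b 0%N)) + c 4%N z * c 5%N (f (b 0%N))) * (i == 1%N)%:R.
  by move=> i6; rewrite /nu_stable h1 h2 h4 opprK !metricE !o.
by rewrite /tau !sE !cT //= f2 f4; ring.
Qed.

Lemma contr_r_C x1 x2 x3 x4 :
  wedge2 (tau s T) s x1 x2 x3 x4 = - contr_r r w x1 x2 x3 x4.
Proof.
have rE x y := rho_b0E su3 bF x y; rewrite -/p -/q in rE.
rewrite /contr_r !wE !(contr_r_scale _ (su3_rL su3)) !rE.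
by rewrite /wedge2 !tauT_C !sE /mu; field.
Qed.

Lemma contr_Q_C x1 x2 x3 x4 x5 : contr_Q s w x1 x2 x3 x4 x5 = 0.
Proof.
have sw l x : s (l *: (k *: b 0%N)) x = - (l * k * c 1%N x).
  by rewrite sE !cZ !o //=; ring.
rewrite /contr_Q !wE /Qs !sw !sE; ring.
Qed.

(** The image of omega_0 is spanned by b_0, so that the Jacobi identity is the
    single condition (f + nu) b_0 = - tr b_0. *)
Lemma shear_equations_stable : shear_equations s r w f nu <->
  nu (b 0%N) = - tr *: b 0%N - f (b 0%N) /\ forall x y, tau s nu x y = tau s T x y.
Proof.
have [t01 t23 t45] := sp_trace.
have [a0 a1 a3 a5] := ab.
have fi i j : b j \in a -> (i == 2%N) || (i == 4%N) -> c i (f (b j)) = 0.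
  move=> ja ii; have [h1 h2] := aE (sh_fa sh ja).
  by case/orP: ii => /eqP ->.
have TL l x y : T (l *: x + y) = l *: T x + T y.
  apply: (metric_inj eB) => z; rewrite /nu_stable !(cD, cZ) !metricE; ring.
have TX : T X = 0.
  by rewrite /nu_stable !(coord_X su3 bF) // !scale0r !mul0r !addr0 scale0r subr0.
have iffB := tau_eq TL TX contr_r_C.
pose F i j := c i (f (b j)).
have wf x y : w (f x) y + w x (f y)
    = (c 2%N x * c 4%N y - c 4%N x * c 2%N y) *: (k *: (- tr *: b 0%N)).
  have e1 z : c 2%N (f z) = c 2%N z * F 2%N 2%N + c 4%N z * F 2%N 4%N.
    rewrite /F (f_frame z (i := 2)) // (fi 2%N 0%N) // (fi 2%N 1%N) // (fi 2%N 3%N) //.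
    by rewrite (fi 2%N 5%N) //; ring.
  have e2 z : c 4%N (f z) = c 2%N z * F 4%N 2%N + c 4%N z * F 4%N 4%N.
    rewrite /F (f_frame z (i := 4)) // (fi 4%N 0%N) // (fi 4%N 1%N) // (fi 4%N 3%N) //.
    by rewrite (fi 4%N 5%N) //; ring.
  rewrite !wE !e1 !e2 -scalerDl !scalerA; congr (_ *: _).
  have -> : F 2%N 2%N = - F 3%N 3%N by rewrite /F; lra.
  have -> : F 4%N 4%N = - F 5%N 5%N by rewrite /F; lra.
  have : F 1%N 1%N = - F 0%N 0%N by rewrite /F; lra.
  rewrite /tr -!/(F _ _) => ->; ring.
split=> [[S A /iffB B]|[nub B]].
  split=> //; apply/eqP; rewrite eq_sym subr_eq eq_sym addrC; apply/eqP.
  have := S (b 2%N) (b 4%N); rewrite wf wE !o //= !mulr0 mul1r subr0 !endZZ !scale1r.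
  by rewrite -scalerDr => E; apply: (scalerI k0).
split; last exact/iffB.
  by move=> x y; rewrite wf wE !endZZ nub -scalerDr -scalerDr addrCA subrr addr0.
exact: contr_Q_C.
Qed.

End CaseC.

(** The primitive (1,1)-forms that vanish on the complex line spanned by b_0 are
    the anti-self-dual two-forms of its orthogonal complement. *)
Definition asd (P Q S : R) (x y : V) : R :=
  P * ((c 2%N x * c 3%N y - c 3%N x * c 2%N y) - (c 4%N x * c 5%N y - c 5%N x * c 4%N y))
  + Q * ((c 2%N x * c 4%N y - c 4%N x * c 2%N y) + (c 3%N x * c 5%N y - c 5%N x * c 3%N y))
  + S * ((c 2%N x * c 5%N y - c 5%N x * c 2%N y) - (c 3%N x * c 4%N y - c 4%N x * c 3%N y)).

(** A J-invariant form annihilated by b_0 is annihilated by b_1 = J b_0; the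
    remaining components are related by J and by the trace condition. *)
Lemma asd_of_primitive11 (t : V -> V -> R) :
  (forall k x y z, t (k *: x + y) z = k * t x z + t y z) ->
  (forall x y, t y x = - t x y) -> (forall y, t X y = 0) ->
  (forall x y, t (J x) (J y) = t x y) -> (forall y, t (b 0%N) y = 0) ->
  t (b 0%N) (b 1%N) + t (b 2%N) (b 3%N) + t (b 4%N) (b 5%N) = 0 ->
  forall x y, t x y = asd (t (b 2%N) (b 3%N)) (t (b 2%N) (b 4%N)) (t (b 2%N) (b 5%N)) x y.
Proof.
move=> tL tC tX tJ t0 tr x y; rewrite (two_form_frame su3 bF tL tC tX x y) /=.
have JJ := su3_JJ su3.
have E0 := frame_J0 bF; have E2 := frame_J2 bF; have E4 := frame_J4 bF.
have E3 := frame_J3 JJ bF; have E5 := frame_J5 JJ bF.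
have tNr z z' : t z (- z') = - t z z'.
  rewrite tC -scaleN1r; have := tL (-1) z' 0 z; have := tL 1 0 0 z.
  by rewrite scaler0 !addr0 mul1r (tC z z') => h ->; lra.
have t1J z : t (b 1%N) (J z) = 0 by rewrite -E0 tJ t0.
have t12 : t (b 1%N) (b 2%N) = 0.
  by apply/eqP; rewrite -oppr_eq0 -tNr -E3 t1J.
have t14 : t (b 1%N) (b 4%N) = 0.
  by apply/eqP; rewrite -oppr_eq0 -tNr -E5 t1J.
have t13 : t (b 1%N) (b 3%N) = 0 by rewrite -E2 t1J.
have t15 : t (b 1%N) (b 5%N) = 0 by rewrite -E4 t1J.
have t35 : t (b 3%N) (b 5%N) = t (b 2%N) (b 4%N) by rewrite -E2 -E4 tJ.
have t34 : t (b 3%N) (b 4%N) = - t (b 2%N) (b 5%N).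
  apply/eqP; rewrite -eqr_oppLR -tNr; apply/eqP.
  by rewrite -E5 -E2 tJ.
have t45 : t (b 4%N) (b 5%N) = - t (b 2%N) (b 3%N) by move: tr; rewrite t0 => h; lra.
rewrite !t0 t12 t13 t14 t15 t35 t34 t45 /asd; ring.
Qed.

Lemma asd_wedge P Q S P' Q' S' x1 x2 x3 x4 :
  wedge2 (asd P Q S) (asd P' Q' S') x1 x2 x3 x4
  = (P * P' + Q * Q' + S * S') * wedge2 (asd 1 0 0) (asd 1 0 0) x1 x2 x3 x4.
Proof. rewrite /wedge2 /asd; ring. Qed.

Lemma asd_basis P Q S : (asd P Q S (b 2%N) (b 3%N) = P) * (asd P Q S (b 2%N) (b 4%N) = Q)
  * (asd P Q S (b 2%N) (b 5%N) = S).
Proof. by rewrite /asd !o //=; do !split; ring. Qed.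

(** An element f of sp (u, s) is traceless on <b_2, ..., b_5>, so it annihilates
    the volume form there and acts by skew endomorphisms with respect to the wedge
    product of two-forms. This product is a multiple of the inner product of the
    coefficients by [asd_wedge]. *)
Lemma asd_skew P Q S P' Q' S' P1 Q1 S1 P1' Q1' S1' :
  (forall x y, asd P Q S (f x) y + asd P Q S x (f y) = asd P1 Q1 S1 x y) ->
  (forall x y, asd P' Q' S' (f x) y + asd P' Q' S' x (f y) = asd P1' Q1' S1' x y) ->
  P1 * P' + Q1 * Q' + S1 * S' + P * P1' + Q * Q1' + S * S1' = 0.
Proof.
move=> H H'; have [_ t23 t45] := sp_trace.
have E :
   wedge2 (asd P1 Q1 S1) (asd P' Q' S') (b 2%N) (b 3%N) (b 4%N) (b 5%N)
   + wedge2 (asd P Q S) (asd P1' Q1' S1') (b 2%N) (b 3%N) (b 4%N) (b 5%N) = 0.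
  rewrite /wedge2 -!H -!H' /asd !o //=.
  have -> : c 3%N (f (b 3%N)) = - c 2%N (f (b 2%N)) by lra.
  have -> : c 5%N (f (b 5%N)) = - c 4%N (f (b 4%N)) by lra.
  ring.
by move: E; rewrite (asd_wedge P1) (asd_wedge P _ _ P1') /wedge2 /asd !o //= => E; lra.
Qed.

Section CaseA.

Variables (P0 Q0 S0 P1 Q1 S1 : R).
Hypothesis (wE : forall x y,
  w x y = asd P0 Q0 S0 x y *: b 0%N + asd P1 Q1 S1 x y *: b 1%N).

(** The contraction is the sum of the wedge products of anti-self-dual forms with
    the contractions of r by b_0 and b_1. The latter are real parts of complex volume
    forms of <b_2, ..., b_5>, hence self-dual, and the products are zero. *)
Lemma contr_r_A x1 x2 x3 x4 : contr_r r w x1 x2 x3 x4 = 0.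
Proof.
have r00 x y : r 0 x y = 0.
  have := su3_rL su3 1 0 0 x y; rewrite scaler0 addr0 mul1r => E.
  by apply: (addrI (r 0 x y)); rewrite addr0 -E.
have rw l j x y : r (l *: b 0%N + j *: b 1%N) x y = l * r (b 0%N) x y + j * r (b 1%N) x y.
  by rewrite (su3_rL su3) -[j *: _]addr0 (su3_rL su3) r00 addr0.
have rE x y := rho_b0E su3 bF x y; have rE1 x y := rho_b1E su3 bF x y.
move: (r (b 0%N) (b 2%N) (b 4%N)) (r (b 0%N) (b 2%N) (b 5%N)) rE rE1 => p q rE rE1.
rewrite /contr_r !wE !rw !rE !rE1 /asd; ring.
Qed.

Lemma contr_Q_A x1 x2 x3 x4 x5 : contr_Q s w x1 x2 x3 x4 x5 = 0.
Proof.
have sw l j x : s (l *: b 0%N + j *: b 1%N) x = - (l * c 1%N x) + j * c 0%N x.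
  by rewrite sE !cD !cZ !o //=; ring.
rewrite /contr_Q !wE /Qs !sw !sE /asd; ring.
Qed.

(** The second equation and the right-hand side of the third vanish because
    anti-self-dual forms wedge to zero with the Kaehler form and with the real and
    imaginary parts of the complex volume form. *)
Lemma shear_equations_primitive : shear_equations s r w f nu <->
  (forall x y, f (w x y) + nu (w x y) = w (f x) y + w x (f y))
  /\ forall x y, tau s nu x y = 0.
Proof.
have s0 y : s 0 y = 0.
  have := sL 1 0 0 y; rewrite scaler0 addr0 mul1r => E.
  by apply: (addrI (s 0 y)); rewrite addr0 -E.
have t0 x y : tau s (fun=> 0) x y = 0 by rewrite /tau !s0 subr0.
have [||H1 H2] := @tau_eq (fun=> 0) _ erefl.
- by move=> *; rewrite scaler0 addr0.
- by move=> *; rewrite contr_r_A /wedge2 !t0; ring.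
split=> [[S _ B]|[S B]]; first by split=> // x y; rewrite H1 // t0.
split=> //; first exact: contr_Q_A.
by apply: H2 => x y; rewrite B t0.
Qed.

End CaseA.

End Cases.

(** * The Jacobi identity for anti-self-dual components *)

Section Jacobi.

Variables (R : realType) (V : vectType R) (n : nat) (e : n.-tuple V)
  (u a : {vspace V}) (X : V) (J : 'End(V)) (s : V -> V -> R) (r : V -> V -> V -> R)
  (w : V -> V -> V) (f nu : 'End(V)) (b : nat -> V).
Hypotheses (su3 : su3_setting e u X J s r) (sh : shear_setting u a X s w f nu)
  (bF : unitary_frame e u J b)
  (jac : forall x y, f (w x y) + nu (w x y) = w (f x) y + w x (f y)).
Local Notation asdb := (asd e b).

Lemma asd_scale k P Q S x y : asdb (k * P) (k * Q) (k * S) x y = k * asdb P Q S x y.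
Proof. rewrite /asd; ring. Qed.

Lemma asd_add P Q S P' Q' S' x y :
  asdb (P + P') (Q + Q') (S + S') x y = asdb P Q S x y + asdb P' Q' S' x y.
Proof. rewrite /asd; ring. Qed.

Lemma sumsq_neq0 (P Q S : R) : P ^+ 2 + Q ^+ 2 + S ^+ 2 != 0 ->
  [|| P != 0, Q != 0 | S != 0].
Proof.
move=> G0; apply: contraNT G0; rewrite !negb_or !negbK => /and3P[/eqP -> /eqP -> /eqP ->].
by rewrite expr0n /= !addr0.
Qed.

(** The Jacobi identity says that f maps the form to a multiple k of itself; by
    skewness k = 0. *)
Lemma jacobi_line (Y : V) P Q S : P ^+ 2 + Q ^+ 2 + S ^+ 2 != 0 -> Y != 0 ->
  (forall x y, w x y = asdb P Q S x y *: Y) ->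
  (forall x y, w (f x) y + w x (f y) = 0) /\ f Y + nu Y = 0.
Proof.
move=> G0 Y0 wE; have [[bP bQ] bS] := asd_basis bF P Q S.
have D x y : asdb P Q S x y *: (f Y + nu Y)
    = (asdb P Q S (f x) y + asdb P Q S x (f y)) *: Y.
  by rewrite [RHS]scalerDl -!wE -jac wE !linearZ /= scalerDr.
have [k kE] : exists k, f Y + nu Y = k *: Y.
  have K x y : asdb P Q S x y != 0 -> exists k, f Y + nu Y = k *: Y.
    move=> t0; exists ((asdb P Q S x y)^-1 * (asdb P Q S (f x) y + asdb P Q S x (f y))).
    by rewrite -scalerA -D scalerA mulVf // scale1r.
  case/or3P: (sumsq_neq0 G0) => h.
  - by apply: (K (b 2%N) (b 3%N)); rewrite bP.
  - by apply: (K (b 2%N) (b 4%N)); rewrite bQ.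
  - by apply: (K (b 2%N) (b 5%N)); rewrite bS.
have H x y : asdb P Q S (f x) y + asdb P Q S x (f y) = asdb (k * P) (k * Q) (k * S) x y.
  apply/eqP; rewrite -subr_eq0 asd_scale; have := D x y; rewrite kE scalerA => /eqP.
  by rewrite -subr_eq0 -scalerBl scaler_eq0 (negbTE Y0) orbF mulrC -oppr_eq0 opprB.
have k0 : k = 0.
  have := asd_skew su3 sh bF H H => E; apply/eqP.
  have : k * (P ^+ 2 + Q ^+ 2 + S ^+ 2) = 0 by lra.
  by move/eqP; rewrite mulf_eq0 (negbTE G0) orbF.
split; last by rewrite kE k0 scale0r.
by move=> x y; rewrite !wE -[LHS]scalerDl H asd_scale k0 mul0r scale0r.
Qed.

(** Gram-Schmidt applied to the two components gives forms W1, W2 of equal length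
    with respect to the wedge product; the basis b_0, b_1 of a is changed
    accordingly. By the Jacobi identity f preserves their span, and by skewness it
    acts there as an infinitesimal rotation of speed k. *)
Lemma jacobi_plane P0 Q0 S0 P1 Q1 S1
    (G00 := P0 ^+ 2 + Q0 ^+ 2 + S0 ^+ 2) (G01 := P0 * P1 + Q0 * Q1 + S0 * S1)
    (G11 := P1 ^+ 2 + Q1 ^+ 2 + S1 ^+ 2) :
  (forall x y, w x y = asdb P0 Q0 S0 x y *: b 0%N + asdb P1 Q1 S1 x y *: b 1%N) ->
  (forall x, x \in a -> x = metric e (b 0%N) x *: b 0%N + metric e (b 1%N) x *: b 1%N) ->
  b 0%N \in a -> b 1%N \in a ->
  0 < G00 -> 0 < G00 * G11 - G01 ^+ 2 ->
  exists (l t k : R) (W1 := asdb P0 Q0 S0)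
      (W2 := fun x y => t * (asdb P1 Q1 S1 x y - l * asdb P0 Q0 S0 x y))
      (Y1 := b 0%N + l *: b 1%N) (Y2 := t^-1 *: b 1%N),
    [/\ 0 < t,
      [/\ forall x y, w x y = W1 x y *: Y1 + W2 x y *: Y2,
          forall x1 x2 x3 x4, wedge2 W1 W2 x1 x2 x3 x4 = 0
        & forall x1 x2 x3 x4, wedge2 W2 W2 x1 x2 x3 x4 = wedge2 W1 W1 x1 x2 x3 x4],
      forall x y, W1 (f x) y + W1 x (f y) = - k * W2 x y,
      forall x y, W2 (f x) y + W2 x (f y) = k * W1 x y
    & nu Y1 = k *: Y2 - f Y1 /\ nu Y2 = - k *: Y1 - f Y2].
Proof.
move=> wE aE a0 a1 G0 Gram.
(* W2 is the component of the second form orthogonal to the first, rescaled by t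
   to the same length. *)
pose l := G01 / G00; pose D := G00 * G11 - G01 ^+ 2; pose t := G00 / Num.sqrt D.
have D0 : 0 < Num.sqrt D by rewrite sqrtr_gt0.
have t0 : 0 < t by rewrite divr_gt0.
have tD : t ^+ 2 * D = G00 ^+ 2.
  by rewrite /t expr_div_n sqr_sqrtr ?ltW // divfK // gt_eqF.
have lG : l * G00 = G01 by rewrite /l divfK // gt_eqF.
clearbody t l; pose P2 := t * (P1 - l * P0); pose Q2 := t * (Q1 - l * Q0); pose S2 := t * (S1 - l * S0).
have G02 : P0 * P2 + Q0 * Q2 + S0 * S2 = 0.
  transitivity (t * (G01 - l * G00)); first by rewrite /P2 /Q2 /S2 /G00 /G01; ring.
  by rewrite lG subrr mulr0.
have G22 : P2 ^+ 2 + Q2 ^+ 2 + S2 ^+ 2 = G00.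
  have -> : P2 ^+ 2 + Q2 ^+ 2 + S2 ^+ 2 = t ^+ 2 * (G11 - 2%:R * l * G01 + l * (l * G00)).
    by rewrite /P2 /Q2 /S2 /G00 /G01 /G11; ring.
  rewrite lG; apply: (mulfI (lt0r_neq0 G0)).
  transitivity (t ^+ 2 * (G00 * G11 - l * G00 * G01)); first by ring.
  by rewrite lG -expr2 tD expr2.
pose W1 := asdb P0 Q0 S0; pose W2 x y := t * (asdb P1 Q1 S1 x y - l * asdb P0 Q0 S0 x y).
have W2E x y : W2 x y = asdb P2 Q2 S2 x y by rewrite /W2 /P2 /Q2 /S2 /asd; ring.
pose Y1 := b 0%N + l *: b 1%N; pose Y2 := t^-1 *: b 1%N.
have b1Y : b 1%N = t *: Y2 by rewrite /Y2 scalerA mulfV ?scale1r // gt_eqF.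
have b0Y : b 0%N = Y1 - (l * t) *: Y2 by rewrite -scalerA -b1Y /Y1 addrK.
have wY x y : w x y = W1 x y *: Y1 + W2 x y *: Y2.
  rewrite wE b0Y b1Y /W2 /W1; apply: (metric_inj (su3_basis su3)) => z; rewrite !metricE.
  by move: (t^-1) => ti; ring.
have indep p q p' q' : p *: Y1 + q *: Y2 = p' *: Y1 + q' *: Y2 -> p = p' /\ q = q'.
  have o := frame_orth bF.
  have c1 v v' : metric e (b 0%N) (v *: Y1 + v' *: Y2) = v.
    by rewrite /Y1 /Y2 !metricE !o //=; ring.
  have c2 v v' : metric e (b 1%N) (v *: Y1 + v' *: Y2) = v * l + v' * t^-1.
    by rewrite /Y1 /Y2 !metricE !o //=; ring.
  move=> E; have pp : p = p' by rewrite -(c1 p q) E c1.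
  split=> //; have := c2 p q; rewrite E c2 pp => /addrI /mulIf -> //.
  by rewrite invr_neq0 // gt_eqF.
have dec x : x \in a -> exists p q, x = p *: Y1 + q *: Y2.
  move=> /aE ->; move: (metric e _ x) (metric e _ x) => q p.
  exists p, (q * t - p * (l * t)); rewrite b0Y b1Y; apply: (metric_inj (su3_basis su3)) => z.
  by rewrite !metricE; ring.
pose H x := f x + nu x.
have HL p q x y : H (p *: x + q *: y) = p *: H x + q *: H y.
  have AL (A : 'End(V)) : A (p *: x + q *: y) = p *: A x + q *: A y.
    by rewrite linearP linearZ.
  by rewrite /H !AL !scalerDr addrACA.
have Ha x : x \in a -> H x \in a by move=> xa; rewrite memvD ?(sh_fa sh) ?(sh_nua sh).
have [m11 [m21 H1]] : exists p q, H Y1 = p *: Y1 + q *: Y2.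
  by apply: dec; apply: Ha; rewrite memvD ?memvZ.
have [m12 [m22 H2]] : exists p q, H Y2 = p *: Y1 + q *: Y2.
  by apply: dec; apply: Ha; rewrite memvZ.
have DW x y : W1 (f x) y + W1 x (f y) = m11 * W1 x y + m12 * W2 x y
    /\ W2 (f x) y + W2 x (f y) = m21 * W1 x y + m22 * W2 x y.
  apply: indep; transitivity (w (f x) y + w x (f y)).
    by rewrite !wY; apply: (metric_inj (su3_basis su3)) => z; rewrite !metricE; ring.
  rewrite -jac -/(H _) wY HL H1 H2.
  by apply: (metric_inj (su3_basis su3)) => z; rewrite !metricE; ring.
have A1 x y : asdb P0 Q0 S0 (f x) y + asdb P0 Q0 S0 x (f y)
    = asdb (m11 * P0 + m12 * P2) (m11 * Q0 + m12 * Q2) (m11 * S0 + m12 * S2) x y.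
  by rewrite asd_add (asd_scale m11) (asd_scale m12) -W2E; have [] := DW x y.
have A2 x y : asdb P2 Q2 S2 (f x) y + asdb P2 Q2 S2 x (f y)
    = asdb (m21 * P0 + m22 * P2) (m21 * Q0 + m22 * Q2) (m21 * S0 + m22 * S2) x y.
  by rewrite asd_add (asd_scale m21) (asd_scale m22) -!W2E; have [] := DW x y.
have z11 : m11 = 0.
  have E := asd_skew su3 sh bF A1 A1.
  have : 2%:R * m11 * G00 = 0.
    rewrite -[RHS]E -[LHS]addr0 -(mulr0 (2%:R * m12)) -G02 /G00; ring.
  by move/eqP; rewrite !mulf_eq0 pnatr_eq0 (gt_eqF G0) orbF => /eqP.
have z22 : m22 = 0.
  have E := asd_skew su3 sh bF A2 A2.
  have : 2%:R * m22 * G00 = 0.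
    rewrite -[RHS]E -[LHS]addr0 -(mulr0 (2%:R * m21)) -{1}G02 -G22; ring.
  by move/eqP; rewrite !mulf_eq0 pnatr_eq0 (gt_eqF G0) orbF => /eqP.
have z12 : m12 = - m21.
  have E := asd_skew su3 sh bF A1 A2.
  have : (m12 + m21) * G00 = 0.
    transitivity (m12 * (P2 ^+ 2 + Q2 ^+ 2 + S2 ^+ 2) + m21 * G00
       + (m11 + m22) * (P0 * P2 + Q0 * Q2 + S0 * S2)); first by rewrite G22 G02; ring.
    by rewrite -[RHS]E /G00; ring.
  by move/eqP; rewrite mulf_eq0 (gt_eqF G0) orbF addr_eq0 => /eqP.
exists l, t, m21; split=> //.
- split=> //.
    by move=> x1 x2 x3 x4; rewrite /wedge2 -!/(W2 _ _) !W2E -/(wedge2 _ _ _ _ _ _) (asd_wedge _ _ P0) G02 mul0r.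
  move=> x1 x2 x3 x4; rewrite /wedge2 -!/(W2 _ _) !W2E.
  rewrite -!/(wedge2 _ _ _ _ _ _) (asd_wedge _ _ P2) (asd_wedge _ _ P0) -!expr2.
  by rewrite G22.
- by move=> x y; have [-> _] := DW x y; rewrite z11 z12 mul0r add0r.
- by move=> x y; have [_ ->] := DW x y; rewrite z22 mul0r addr0.
have nuE x : nu x = H x - f x by rewrite /H addrAC subrr add0r.
by rewrite !nuE H1 H2 z11 z22 z12 !scale0r add0r addr0.
Qed.

End Jacobi.

(** * From the cocalibrated structure to the frame equations *)

Section Induced.

Variables (R : realType) (g : vectType R) (u : {vspace g}) (e : 7.-tuple g)
  (alpha : 'Hom(g, R^o)) (X : g).
Hypotheses (eB : basis_of fullv e) (g7 : \dim {:g} = 7%N) (u6 : \dim u = 6%N)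
  (alu : forall Y, Y \in u -> alpha Y = 0)
  (al1 : \sum_(i < 7) (alpha e`_i : R) ^+ 2 = 1)
  (Xu : is_orth e X u) (alX : alpha X = 1).

Lemma alpha_proj x : x - (alpha x : R) *: X \in u.
Proof.
have XN0 : X != 0 by apply: contra_eq_neq alX => ->; rewrite linear0 eq_sym oner_neq0.
have cap0 : (u :&: <[X]>)%VS = 0%VS.
  apply/eqP; rewrite -subv0; apply/subvP => y /memv_capP[yu /vlineP[k yk]].
  have := alu yu; rewrite yk linearZ /= alX => k0.
  have -> : k = 0 by rewrite -[k]mulr1; exact: k0.
  by rewrite scale0r mem0v.
have full : (u + <[X]>)%VS = fullv.
  apply/eqP; rewrite eqEdim subvf g7 -(leq_add2r (\dim (u :&: <[X]>))).
  by rewrite dimv_sum_cap u6 dim_vline XN0 cap0 dimv0 addn0.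
have : x \in (u + <[X]>)%VS by rewrite full memvf.
case/memv_addP => y yu [_ /vlineP[k ->] ->].
have -> : alpha (y + k *: X) = k :> R.
  by rewrite linearD linearZ /= alu // alX add0r; exact: mulr1.
by rewrite addrK.
Qed.

Lemma metric_X x : metric e X x = (alpha x : R) * metric e X X.
Proof.
rewrite -[x in LHS](subrK ((alpha x : R) *: X)) metricDr metricZr.
by rewrite (Xu (alpha_proj x)) add0r.
Qed.

(** X is metrically dual to a multiple of alpha, so its length is determined by
    the length of alpha. *)
Lemma metric_XX : metric e X X = 1.
Proof.
have E : metric e X X = metric e X X ^+ 2.
  rewrite {1}/metric -[RHS]mulr1 -al1 mulr_sumr; apply: eq_bigr => i _.
  by rewrite (coord_metric eB) metricC metric_X; ring.
have XX : metric e X X != 0.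
  apply: contra_eq_neq alX => /(metric_eq0 eB) ->.
  by rewrite linear0 eq_sym oner_neq0.
by apply: (mulfI XX); rewrite mulr1 -expr2 -E.
Qed.

Lemma alpha_metric x : alpha x = metric e X x :> R.
Proof. by rewrite metric_X metric_XX mulr1. Qed.

End Induced.

Lemma lie_act2E (R : realType) (V W : vectType R) (A : V -> V) (b : ('I_2 -> V) -> W) x y :
  app2 (lie_act A b) x y = - (app2 b (A x) y + app2 b x (A y)).
Proof.
by rewrite /app2 /lie_act !big_ord_recl big_ord0 addr0 !(tnth_nth 0) /= set2_0 set2_1.
Qed.

(** For a decomposable form the contraction does not depend on the basis of u
    used to define it. *)
Lemma kappa_decomposable (R : realType) (V : vectType R) (u : {vspace V}) k
    (beta : ('I_k.+1 -> V) -> V) (t : ('I_k.+1 -> V) -> R^o) (Z : V) (v : 'I_k -> V) :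
  Z \in u -> (forall v', beta v' = (t v' : R) *: Z) ->
  (forall c x y, t (fcat (fun _ : 'I_1 => c *: x + y) v)
     = c * t (fcat (fun _ : 'I_1 => x) v) + t (fcat (fun _ : 'I_1 => y) v) :> R) ->
  kappa u beta v = t (fcat (fun _ : 'I_1 => Z) v).
Proof.
move=> Zu bE tL; pose F x : R := t (fcat (fun _ : 'I_1 => x) v).
have F0 : F 0 = 0.
  by have := tL 1 0 0; rewrite scaler0 addr0 mul1r => E; apply: (addrI (F 0)); rewrite addr0 -E.
have FD x y : F (x + y) = F x + F y by rewrite -[x in LHS]scale1r /F tL mul1r.
rewrite -[RHS]/(F Z) [Z in RHS](coord_vbasis Zu) (big_morph F FD F0).
have FZ c x : F (c *: x) = c * F x by rewrite -[c *: x]addr0 /F tL -/(F 0) F0 addr0.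
by apply: eq_bigr => i _; rewrite FZ /interior bE linearZ mulrC.
Qed.

Lemma form_inner2E (R : realType) (V : vectType R) (n : nat) (e : n.-tuple V)
    (t t' : ('I_2 -> V) -> R^o) :
  form_inner e t t' = (2%:R)^-1 * \sum_(i < n) \sum_(j < n) (app2 t e`_i e`_j * app2 t' e`_i e`_j : R).
Proof.
rewrite /form_inner; congr (_ * _); rewrite pair_bigA /=.
rewrite (reindex (fun p : 'I_n * 'I_n => [ffun i : 'I_2 => if i == ord0 then p.1 else p.2])) /=.
  by apply: eq_bigr => -[i j] _; rewrite (fun2E t) (fun2E t') !ffunE.
exists (fun h : {ffun 'I_2 -> 'I_n} => (h ord0, h (lift ord0 ord0))) => [[i j]|h] _.
  by rewrite !ffunE.
apply/ffunP => i; rewrite !ffunE; case: eqP => [->//|/eqP i0].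
by congr (h _); apply: val_inj; case: i i0 => [[|[|]]].
Qed.

Lemma bilinear_expand (R : realType) (V : vectType R) (n : nat) (e : n.-tuple V)
    (t : V -> V -> R) : basis_of fullv e ->
  (forall k x y z, t (k *: x + y) z = k * t x z + t y z) ->
  (forall k x y z, t z (k *: x + y) = k * t z x + t z y) -> forall x y,
  \sum_(i < n) \sum_(j < n) (metric e x e`_i * metric e y e`_j) * t e`_i e`_j = t x y.
Proof.
move=> eB tL tR x y; rewrite [x in RHS](coord_expand eB) [y in RHS](coord_expand eB).
have t0 z : t 0 z = 0.
  by have := tL 1 0 0 z; rewrite scaler0 addr0 mul1r => E; apply: (addrI (t 0 z)); rewrite addr0 -E.
have t0r z : t z 0 = 0.
  by have := tR 1 0 0 z; rewrite scaler0 addr0 mul1r => E; apply: (addrI (t z 0)); rewrite addr0 -E.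
have tD z : {morph t^~ z : p q / p + q >-> p + q}.
  by move=> p q; rewrite -[p]scale1r tL mul1r scale1r.
have tDr z : {morph t z : p q / p + q >-> p + q}.
  by move=> p q; rewrite -[p]scale1r tR mul1r scale1r.
rewrite (big_morph _ (tD _) (t0 _)); apply: eq_bigr => i _.
rewrite (big_morph _ (tDr _) (t0r _)); apply: eq_bigr => j _.
rewrite -[_ *: e`_i]addr0 tL t0 addr0 -[_ *: e`_j]addr0 tR t0r addr0.
by rewrite !(coord_metric eB) (metricC e x) (metricC e y) mulrA.
Qed.

Lemma metric_sumr (R : realType) (V : vectType R) (n : nat) (e : n.-tuple V) m
    (F : 'I_m -> V) z : metric e z (\sum_i F i) = \sum_i metric e z (F i).
Proof. by rewrite metricC metric_suml; apply: eq_bigr => i _; rewrite metricC. Qed.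

Lemma mulf_left_eq0 (R : fieldType) (k x : R) : k != 0 -> k * x = 0 -> x = 0.
Proof. by move=> k0 /eqP; rewrite mulf_eq0 (negbTE k0) => /eqP. Qed.

Lemma guarded_iff (P D E : Prop) : (P -> D) -> (D -> (P <-> E)) -> (P <-> D /\ E).
Proof. by move=> PD DPE; split=> [p|[d e]]; [split; [exact: PD|apply/DPE => //; exact: PD] | exact/DPE]. Qed.

Section Main.

Variables (R : realType) (g : vectType R) (br : g -> g -> g)
    (u : {vspace g}) (phi : ('I_3 -> g) -> R^o) (e : 7.-tuple g)
    (alpha : 'Hom(g, R^o)) (X : g) (J : 'End(g))
    (sigma : ('I_2 -> g) -> R^o) (rho : ('I_3 -> g) -> R^o)
    (a : {vspace g}) (omega0 : ('I_2 -> g) -> g) (nu : 'End(g))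
    (I : {vspace g}).
Local Notation f := (ad br X).
Local Notation star_phi := (@hodge R g 3 4 e phi).
Local Notation omega := (shear_form alpha a omega0 nu).
Local Notation gam := (tensor_endo alpha (restrict_endo a f)).
Local Notation eta := (tensor_endo alpha (restrict_endo a (f + nu))).
Local Notation shears := (shears_to_cocalibrated br phi e omega gam eta).
Local Notation s := (fun x y => app2 sigma x y : R).
Local Notation r := (fun x y z => app3 rho x y z : R).
Local Notation w := (app2 omega0).
Hypotheses (brL : is_lie_bracket br) (g7 : \dim {:g} = 7%N)
  (uI : is_codim1_abelian_ideal br u) (G2 : G2_adapted_basis phi e)
  (coc : forall v, dCE br star_phi v = 0)
  (alu : forall Y, Y \in u -> alpha Y = 0)
  (al1 : \sum_(i < 7) (alpha e`_i : R) ^+ 2 = 1)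
  (Xu : is_orth e X u) (alX : alpha X = 1)
  (sF : form_on X sigma) (rF : form_on X rho)
  (PhiE : forall v, star_phi v = 2%:R^-1 * wedge (@smul R) sigma sigma v
                          + wedge (@smul R) rho (form1 alpha) v)
  (JE : endo_on X u J)
  (sJ : forall Y Z, Y \in u -> Z \in u -> app2 sigma Y Z = metric e Y (J Z))
  (au : (a <= u)%VS) (fa : (f @: a <= a)%VS)
  (wT : in_tensor (fun b => form_on X b) a omega0)
  (nuX : nu X = 0) (nua : (limg nu <= a)%VS)
  (IE : is_span_of_values omega0 I) (w0 : exists v, omega0 v <> 0)
  (wa0 : forall Z Y, Z \in a -> Y \in u -> app2 omega0 Z Y = 0).

Let eB : basis_of fullv e := G2.1.

Lemma u6 : \dim u = 6%N.
Proof. by case: uI; rewrite g7 => -[]. Qed.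

Let alD x : x - (alpha x : R) *: X \in u := alpha_proj g7 u6 alu alX x.
Let X1 : metric e X X = 1 := metric_XX eB g7 u6 alu al1 Xu alX.
Let alE x : alpha x = metric e X x :> R := alpha_metric eB g7 u6 alu al1 Xu alX x.

Lemma Jmem x : J x \in u.
Proof.
case: JE => JX Ju; have JZ k : J (k *: X) = 0 by rewrite linearZ /= JX scaler0.
have -> : J x = J (x - (alpha x : R) *: X) by rewrite linearB /= JZ subr0.
by apply: subvP Ju _ (memv_img J (alD x)).
Qed.

(** Transfers the structure obtained on u to forms and endomorphisms of g that
    vanish on X, by projecting each argument to u. *)
Lemma su3_of_G2 : su3_setting e u X J s r.
Proof.
have JX : J X = 0 by case: JE.
have pr x : x - metric e X x *: X \in u by rewrite -alE.
have Ju x : x \in u -> J x \in u by move=> _; apply: Jmem.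
have sL := s_lin sF; have sC x y : s y x = - s x y by exact: (form2C sF.1).
have Ppr x : J (x - metric e X x *: X) = J x by rewrite linearB linearZ /= JX scaler0 subr0.
have sp x y : s (x - metric e X x *: X) y = s x y.
  by rewrite addrC -scaleNr sL (Xs sF) mulr0 add0r.
have sE x y : s x y = metric e x (J y).
  rewrite -sp sC -sp -sC sJ // Ppr !metricE (Xu (Jmem y)); ring.
have PhiQE x y z t : app4 star_phi x y z t = PhiQ alpha s r x y z t :> R.
  exact: (app4_Phi sF rF PhiE).
have alu0 x : x \in u -> alpha x = 0 :> R by exact: alu.
have QPhi x y z t : x \in u -> y \in u -> z \in u -> t \in u -> Qs s x y z t = app4 star_phi x y z t.
  by move=> xu yu zu tu; rewrite PhiQE /PhiQ !alu0 //; ring.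
have rPhi x y z : x \in u -> y \in u -> z \in u -> r x y z = app4 star_phi x y z X.
  move=> xu yu zu; rewrite PhiQE /PhiQ /Qs (alu0 _ xu) (alu0 _ yu) (alu0 _ zu) (alX : alpha X = 1 :> R) !(sX sF).
  by ring.
have JJ := J_squared G2 u6 g7 X1 Xu Ju sL sC (fun x y _ _ => sE x y) QPhi.
have rJ := rho_J_symmetric G2 u6 g7 X1 Xu Ju sL sC (fun x y _ _ => sE x y) QPhi rPhi.
have rL := r_lin rF.
have rC1 x y z : r y x z = - r x y z by exact: (form3C rF.1).
have rC2 x y z : r x z y = - r x y z by exact: (form3Cr rF.1).
have rX x y : r X x y = 0 by exact: (rX1 rF).
have rp x y z : r (x - metric e X x *: X) y z = r x y z.
  by rewrite addrC -scaleNr rL rX mulr0 add0r.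
split=> //.
- exact: u6.
- exact: Jmem.
- by move=> x y; rewrite metricC -sE sC sE.
move=> x y z.
have := rJ _ _ _ (pr x) (pr y) (pr z); rewrite !Ppr => h.
have e1 : r (J x) (y - metric e X y *: X) (z - metric e X z *: X) = r (J x) y z.
  by rewrite rC1 rp -rC1 rC2 rC1 rp -rC1 -rC2.
have e2 : r (x - metric e X x *: X) (J y) (z - metric e X z *: X) = r x (J y) z.
  by rewrite rp rC2 rC1 rp -rC1 -rC2.
by rewrite -e1 h e2.
Qed.

Lemma exists_frame b0 : b0 \in u -> metric e b0 b0 = 1 ->
  exists b, unitary_frame e u J b /\ b 0%N = b0.
Proof.
move=> b0u b01; have su := su3_of_G2.
have [b2 [m2 n2 o2]] : exists W, [/\ W \in u, metric e W W = 1 &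
    forall s, s \in <<[:: b0; J b0]>>%VS -> metric e s W = 0].
  by apply: (exists_unit_orth eB); rewrite u6; apply: leq_ltn_trans (dim_span _) _.
have [||b [bF b0E _]] := @exists_unitary_frame _ _ _ e u J eB u6 (fun x _ => Jmem x)
    (fun x y _ _ => su3_skew su x y) (su3_JJ su) b0 b2 b0u m2 b01 n2.
- by apply: o2; apply: memv_span; rewrite !inE eqxx.
- by apply: o2; apply: memv_span; rewrite !inE eqxx orbT.
by exists b.
Qed.

Lemma shear_of_main : shear_setting u a X s w f nu.
Proof.
have su := su3_of_G2.
have [b0 [m0 n0 _]] : exists W, [/\ W \in u, metric e W W = 1 &
    forall s, s \in 0%VS -> metric e s W = 0].
  by apply: (exists_unit_orth eB); rewrite dimv0 u6.
have [b [bF _]] := exists_frame m0 n0.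
have [tw _] := shears_iff eB brL uI alu alX alD sF rF PhiE au fa wT nuX nua wa0 coc.
have fX0 := fX X brL.
split=> //.
- by move=> x; rewrite -[f x]subr0 -(scale0r X) -(al_f brL uI alu alD x); apply: alD.
- exact: (f_mem fa).
- exact: (nu_mem nua).
- exact: (wL wT).
- exact: (wC wT).
- exact: (Xw wT).
- by move=> x y; apply: (omega0_mem wT).
- by move=> x y; apply: (wa alD wT wa0).
move=> x y; apply: (lefschetz_inj su bF (t := tau s f)).
- exact: (tau_linear su).
- by move=> p q; rewrite /tau opprB.
- by move=> q; apply: (tau_X su).
exact: tw.
Qed.

Lemma shears_equations : shears <-> shear_equations s r w f nu.
Proof. exact: (shears_iff eB brL uI alu alX alD sF rF PhiE au fa wT nuX nua wa0 coc).2. Qed.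

Lemma in_sp_tau (A : 'End(g)) : A X = 0 -> (forall x, A x \in u) ->
  in_sp X u sigma A <-> forall x y, tau s A x y = 0.
Proof.
move=> AX Au; have sC x y : s y x = - s x y by exact: (form2C sF.1).
have E x y : app2 (lie_act A sigma) x y = - tau s A x y :> R.
  by rewrite lie_act2E /tau (sC x) opprK.
split=> [[_ H] x y|H].
  by apply/eqP; rewrite -oppr_eq0 -E /app2 H.
split; first by split=> //; apply/subvP => _ /memv_imgP[x _ ->].
by move=> v; rewrite (fun2E (lie_act A sigma)) E H oppr0.
Qed.

Lemma I_sub_a : (I <= a)%VS.
Proof. by apply: IE.2 => v; apply: (omega0_mem wT). Qed.

Lemma exists_unit_I : exists x y b0 k, [/\ w x y = k *: b0, k != 0, b0 \in I & metric e b0 b0 = 1].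
Proof.
case: w0 => v /eqP v0; exists (v ord0), (v (lift ord0 ord0)).
rewrite -(fun2E omega0); set T := omega0 v.
have TT : 0 < metric e T T.
  rewrite lt_neqAle metric_ge0 // andbT eq_sym; apply: contra_neq v0; exact: metric_eq0.
have nz : Num.sqrt (metric e T T) != 0 by rewrite gt_eqF // sqrtr_gt0.
exists ((Num.sqrt (metric e T T))^-1 *: T), (Num.sqrt (metric e T T)); split=> //.
- by rewrite scalerA mulfV // scale1r.
- by rewrite memvZ //; apply: IE.1.
by rewrite !metricE mulrA -invfM -expr2 sqr_sqrtr ?ltW // mulVf // gt_eqF.
Qed.

(** * The case of four-dimensional a with J(im omega_0) orthogonal to a *)

Let su := su3_of_G2.
Let sh := shear_of_main.

Definition nu_class (tnu : 'End(g)) := exists hnu : 'End(g),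
  [/\ in_sp X u sigma hnu, (hnu @: u <= a)%VS,
      forall Y, Y \in I -> hnu Y = 0 & nu = tnu + hnu].

(** For tnu with values in a, the affine class of solutions in the theorem consists
    of the nu with the same [tau] as tnu and the same values on im omega_0. *)
Lemma nu_class_intro (tnu : 'End(g)) : tnu X = 0 -> (forall x, tnu x \in a) ->
  (forall x y, tau s nu x y = tau s tnu x y) -> (forall Y, Y \in I -> nu Y = tnu Y) ->
  nu_class tnu.
Proof.
move=> tX ta tE tI; have ha x : (nu - tnu) x \in a.
  by rewrite add_lfunE opp_lfunE memvB ?(sh_nua sh).
exists (nu - tnu); split.
- apply/in_sp_tau; first by rewrite add_lfunE opp_lfunE nuX tX subrr.
    by move=> x; apply: subvP au _ (ha x).
  move=> x y; have := tE x y; rewrite /tau !add_lfunE !opp_lfunE => E.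
  rewrite -!scaleN1r ![_ + -1 *: _]addrC !(s_linear su); lra.
- by apply/subvP => _ /memv_imgP[x _ ->].
- by move=> Y /tI E; rewrite add_lfunE opp_lfunE E subrr.
by rewrite addrC subrK.
Qed.

Lemma nu_class_elim (tnu : 'End(g)) : nu_class tnu ->
  (forall x y, tau s nu x y = tau s tnu x y) /\ (forall Y, Y \in I -> nu Y = tnu Y).
Proof.
case=> h [hsp ha hI nuE]; case: (hsp) => -[hX hu] _.
have hm x : h x \in u.
  have hZ k : h (k *: X) = 0 by rewrite linearZ /= hX scaler0.
  have -> : h x = h (x - (alpha x : R) *: X) by rewrite linearB /= hZ subr0.
  by apply: subvP hu _ (memv_img h (alD x)).
split=> [x y|Y YI]; last by rewrite nuE add_lfunE hI // addr0.
have := (in_sp_tau hX hm).1 hsp x y; rewrite /tau nuE !add_lfunE => E.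
rewrite -[tnu x]scale1r -[tnu y]scale1r !(s_linear su) !scale1r; lra.
Qed.

Lemma span_mem (S : {vspace g}) (L : seq g) : (forall x, x \in S -> x \in <<L>>%VS) ->
  (size L <= \dim S)%N -> forall y, y \in L -> y \in S.
Proof.
move=> SL LS y yL; have /eqP -> : S == <<L>>%VS; last exact: memv_span.
rewrite eqEdim (leq_trans (dim_span _) LS) andbT; exact/subvP.
Qed.

Lemma I_line Z : (forall v, omega0 v \in <[Z]>%VS) -> forall Y, Y \in I -> exists l, Y = l *: Z.
Proof. by move=> H Y YI; apply/vlineP; apply: (subvP (IE.2 _ H)). Qed.

Lemma dim_add_line (U : {vspace g}) (v : g) k : (\dim U + 1 < k)%N -> (\dim (U + <[v]>) < k)%N.
Proof.
apply: leq_ltn_trans; apply: leq_trans (dimv_add_leqif _ _).1 _.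
by rewrite leq_add2l dim_vline; case: (v != 0).
Qed.

Section WithFrame.
Variable (b : nat -> g).
Hypothesis (bF : unitary_frame e u J b).
Local Notation c := (fun i x => metric e (b i) x).

Lemma w_component z : let t x y := metric e z (w x y) in
  [/\ forall k x y q, t (k *: x + y) q = k * t x q + t y q,
      forall x y, t y x = - t x y & forall y, t X y = 0].
Proof.
split=> [k x y q|x y|y] /=.
- by rewrite (sh_wL sh) metricDr metricZr.
- by rewrite (sh_wC sh) metricNr.
by rewrite (sh_wX sh) metric0r.
Qed.

(** If a is the orthogonal complement of two frame vectors, then omega_0 descends
    to the plane u / a and has only one component. *)
Lemma w_decomposable i j : (i < j < 6)%N ->
  (forall k, (k < 6)%N -> k != i -> k != j -> b k \in a) ->
  forall x y, w x y = (c i x * c j y - c j x * c i y) *: w (b i) (b j).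
Proof.
move=> /andP[ij j6] ka x y; apply: (metric_inj eB) => z.
have [tL tC tX] := w_component z; rewrite metricC (two_form_frame su bF tL tC tX) /=.
set D := metric e z (w (b i) (b j)).
have T k l : (k < l < 6)%N -> metric e z (w (b k) (b l)) = if (k == i) && (l == j) then D else 0.
  move=> /andP[kl l6]; have k6 := ltn_trans kl l6.
  have z0 q x' : (q < 6)%N -> q != i -> q != j -> w (b q) x' = 0.
    by move=> *; rewrite (sh_wa sh) // ka.
  case: eqP => [->|/eqP ki] /=.
    case: eqP => [->//|/eqP lj]; case: (eqVneq l i) => [->|li].
      by rewrite (form2_alt (omega0_form wT)) metric0r.
    by rewrite (sh_wC sh) z0 // oppr0 metric0r.
  case: (eqVneq k j) => [kj|kj]; last by rewrite z0 // metric0r.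
  rewrite (sh_wC sh) z0 ?oppr0 ?metric0r //; last by rewrite gtn_eqF // -kj.
  by rewrite gtn_eqF // (ltn_trans ij) // -kj.
rewrite metricZl [metric e (w _ _) z]metricC -/D !T //.
clear T; clearbody D.
by move: i j ij j6 {ka} => [|[|[|[|[|[|i]]]]]] [|[|[|[|[|[|j]]]]]] //= _ _; ring.
Qed.

End WithFrame.

Section CaseBMain.
Hypotheses (a4 : \dim a = 4%N) (JI : forall Y, Y \in I -> is_orth e (J Y) a).

(** Take b_0 in im omega_0 and for b_2 a unit vector orthogonal to a and to
    b_1 = J b_0. As b_1 is itself orthogonal to a, the space a is spanned by the
    other four frame vectors. *)
Lemma frame_B : exists b k, [/\ unitary_frame e u J b, k != 0,
  forall x, x \in a -> metric e (b 1%N) x = 0 /\ metric e (b 2%N) x = 0,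
  [/\ b 0%N \in a, b 3%N \in a, b 4%N \in a & b 5%N \in a] &
  (forall x y, w x y = (metric e (b 1%N) x * metric e (b 2%N) y
                        - metric e (b 2%N) x * metric e (b 1%N) y) *: (k *: b 0%N))
  /\ b 0%N \in I].
Proof.
have [x0 [y0 [b0 [k0 [w0E k00 b0I b01]]]]] := exists_unit_I.
have b0a : b0 \in a by apply: subvP I_sub_a _ b0I.
have b0u : b0 \in u by apply: subvP au _ b0a.
have [b2 [m2 n2 o2]] : exists W, [/\ W \in u, metric e W W = 1 &
    forall s, s \in (a + <[J b0]>)%VS -> metric e s W = 0].
  by apply: (exists_unit_orth eB); rewrite u6; apply: dim_add_line; rewrite a4.
have [||b [bF b0E b2E]] := @exists_unitary_frame _ _ _ e u J eB u6 (fun x _ => Jmem x)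
    (fun x y _ _ => su3_skew su x y) (su3_JJ su) b0 b2 b0u m2 b01 n2.
- by apply: o2; apply: subvP (addvSl _ _) _ b0a.
- by apply: o2; apply: subvP (addvSr _ _) _ (memv_line _).
have aE x : x \in a -> metric e (b 1%N) x = 0 /\ metric e (b 2%N) x = 0.
  move=> xa; split; first by rewrite -(frame_J0 bF) b0E; apply: JI.
  by rewrite b2E metricC; apply: o2; apply: subvP (addvSl _ _) _ xa.
have ab : forall y, y \in [:: b 0%N; b 3%N; b 4%N; b 5%N] -> y \in a.
  apply: span_mem; last by rewrite a4.
  move=> x xa; have [c1 c2] := aE x xa.
  rewrite (vec_frame su bF (subvP au _ xa)) c1 c2 !scale0r !addr0.
  by apply: memvD; [apply: memvD; [apply: memvD|]|]; apply: memvZ; apply: memv_span; rewrite !inE eqxx ?orbT.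
have wE : forall x y, w x y = (metric e (b 1%N) x * metric e (b 2%N) y
    - metric e (b 2%N) x * metric e (b 1%N) y) *: w (b 1%N) (b 2%N).
  apply: (w_decomposable bF) => // -[|[|[|[|[|[|k]]]]]] //= _ _ _;
    by apply: ab; rewrite !inE eqxx ?orbT.
pose l := metric e (b 1%N) x0 * metric e (b 2%N) y0 - metric e (b 2%N) x0 * metric e (b 1%N) y0.
have lE : l *: w (b 1%N) (b 2%N) = k0 *: b 0%N by rewrite b0E -w0E [RHS]wE.
have l0 : l != 0.
  apply: contra_neq k00 => l0; move: lE; rewrite l0 scale0r => /esym/eqP.
  rewrite scaler_eq0 => /orP[/eqP //|/eqP b00]; move: b01; rewrite -b0E b00 metric0l.
  by move/eqP; rewrite eq_sym oner_eq0.
have TE : w (b 1%N) (b 2%N) = (l^-1 * k0) *: b 0%N.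
  by rewrite -scalerA -lE scalerA mulVf // scale1r.
exists b, (l^-1 * k0); split=> //.
- by rewrite mulf_neq0 // invr_neq0.
- by split; apply: ab; rewrite !inE eqxx ?orbT.
by split; [move=> x y; rewrite -TE | rewrite b0E].
Qed.

Lemma trace_frame (b : nat -> g) (L : seq nat) : unitary_frame e u J b -> uniq L ->
  all (fun k => k < 6)%N L -> size L = \dim a -> (forall k, k \in L -> b k \in a) ->
  trace_on a f = \sum_(k <- L) metric e (b k) (f (b k)).
Proof.
move=> bF Lu L6 Ls La; rewrite (@trace_orthonormal _ _ _ e _ (fun i => b (nth 0%N L i)) a f (esym Ls)).
- by rewrite (big_nth 0%N) big_mkord.
- by move=> i; apply: La; rewrite mem_nth.
- move=> i j; rewrite (frame_orth bF) ?(allP L6) ?mem_nth //.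
  by rewrite nth_uniq.
exact: fa.
Qed.

(** Identifies the endomorphism of the theorem on the line of b_1 with the
    solution found in the frame: kappa (J o omega_0) is the contraction of a
    decomposable form with b_1. *)
Lemma tnu_B_value (b : nat -> g) (k : R) W : unitary_frame e u J b ->
  (forall x y, w x y = (metric e (b 1%N) x * metric e (b 2%N) y
      - metric e (b 2%N) x * metric e (b 1%N) y) *: (k *: b 0%N)) ->
  (exists l, W = l *: b 1%N) ->
  - sharp e (form1 (app3 rho (J W) (sharp e (kappa u (fun v => J (omega0 v))))))
  = metric e (b 1%N) W *: (k *: (r (b 0%N) (b 2%N) (b 4%N) *: b 4%N
                                  + r (b 0%N) (b 2%N) (b 5%N) *: b 5%N)).
Proof.
move=> bF wE [l ->]; have o := frame_orth bF.
have kapE z : kappa u (fun v => J (omega0 v)) (fun=> z) = k * metric e (b 2%N) z :> R.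
  pose t (v : 'I_2 -> g) : R^o := k * (metric e (b 1%N) (v ord0) * metric e (b 2%N) (v (lift ord0 ord0))
    - metric e (b 2%N) (v ord0) * metric e (b 1%N) (v (lift ord0 ord0))).
  rewrite (@kappa_decomposable _ _ u 1 _ t (b 1%N)).
  - by rewrite /t fcat_ord0 fcat_lift !o //=; ring.
  - by apply: (frame_mem bF).
  - move=> v; rewrite (fun2E omega0) wE !linearZ /= (frame_J0 bF) /t.
    by rewrite scalerA mulrC.
  by move=> p x y; rewrite /t !fcat_ord0 !fcat_lift !metricE; ring.
have kapV : sharp e (kappa u (fun v => J (omega0 v))) = k *: b 2%N.
  apply: (metric_inj eB) => z; rewrite (metric_sharp eB) ?kapE ?metricZl // => p x y.
  by rewrite !kapE !metricE; ring.
have rL2 p q x y z : r z (p *: x + q) y = p * r z x y + r z q y.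
  have rC1 := su3_rC1 su; rewrite rC1 (su3_rL su) (rC1 z) (rC1 z q); ring.
have rL3 p q x y z : r z y (p *: x + q) = p * r z y x + r z y q.
  have rC2 := su3_rC2 su; rewrite rC2 rL2 (rC2 z y) (rC2 z y q); ring.
rewrite kapV; apply: (metric_inj eB) => z; rewrite metricNl (metric_sharp eB); last first.
  by move=> p x y; rewrite /form1 rL3.
rewrite /form1 linearZ /= (frame_J1 (su3_JJ su) bF).
have r0 y x : r 0 x y = 0.
  have := su3_rL su 1 0 0 x y; rewrite scaler0 addr0 mul1r => E.
  by apply: (addrI (r 0 x y)); rewrite addr0 -E.
have r02 y x : r x 0 y = 0 by rewrite (su3_rC1 su) r0 oppr0.
have -> : app3 rho (l *: - b 0%N) (k *: b 2%N) z = - (l * k) * r (b 0%N) (b 2%N) z :> R.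
  rewrite scalerN -scaleNr -[- l *: _]addr0 (su3_rL su) r0 addr0.
  by rewrite -[k *: _]addr0 rL2 r02 addr0; ring.
rewrite (rho_b0E su bF) !o //= !metricE !o //=; ring.
Qed.

Lemma shears_J_orthogonal : shears <->
  (forall Y, Y \in I -> f Y = - trace_on a f *: Y)
  /\ exists tnu : 'End(g),
     [/\ endo_on X u tnu,
         forall W, W \in (J @: I)%VS ->
           tnu W = - sharp e (form1 (app3 rho (J W)
             (sharp e (kappa u (fun v => J (omega0 v)))))),
         forall W, W \in u -> is_orth e W (J @: I)%VS -> tnu W = 0
       & nu_class tnu].
Proof.
have [b [k [bF k0 aE ab [wE b0I]]]] := frame_B.
have o := frame_orth bF; have [a0 a3 a4' a5] := ab.
rewrite shears_equations (shear_equations_orthogonal su sh bF k0 aE ab wE).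
set p := r (b 0%N) (b 2%N) (b 4%N); set q := r (b 0%N) (b 2%N) (b 5%N).
set T := fun x => _ *: (k *: (p *: b 4%N + q *: b 5%N)).
have trE : trace_on a f = metric e (b 0%N) (f (b 0%N)) + metric e (b 3%N) (f (b 3%N))
    + metric e (b 4%N) (f (b 4%N)) + metric e (b 5%N) (f (b 5%N)).
  rewrite (trace_frame (L := [:: 0; 3; 4; 5]%N) bF) // ?a4 //.
    by rewrite !big_cons big_nil addr0 !addrA.
  by move=> j; rewrite !inE => /or4P[] /eqP ->.
have Il : forall Y, Y \in I -> exists l, Y = l *: b 0%N.
  by apply: I_line => v; rewrite (fun2E omega0) wE !memvZ // memv_line.
have JIl W : W \in (J @: I)%VS -> exists l, W = l *: b 1%N.
  by case/memv_imgP => Y /Il[l ->] ->; exists l; rewrite linearZ /= (frame_J0 bF).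
have val W : W \in (J @: I)%VS -> - sharp e (form1 (app3 rho (J W)
    (sharp e (kappa u (fun v => J (omega0 v)))))) = T W.
  by move=> /JIl WE; apply: tnu_B_value.
have TL : forall l x y, T (l *: x + y) = l *: T x + T y.
  by move=> l x y; rewrite /T metricDr metricZr scalerDl -[(l * _) *: _]scalerA.
have T0 : T (b 0%N) = 0 by rewrite /T o // scale0r.
have b1JI : b 1%N \in (J @: I)%VS by rewrite -(frame_J0 bF) memv_img.
rewrite -trE; split=> [[fb nub tE]|[fI [tnu [tend tJ t0 tcl]]]].
  split=> [Y /Il[l ->]|]; first by rewrite linearZ /= fb !scalerA mulrC.
  have tnuE : linfun T =1 T by exact: linfunE.
  have Ta x : T x \in a by rewrite !memvZ // memvD // memvZ.
  have TX : T X = 0 by rewrite /T (coord_X su bF) // scale0r.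
  exists (linfun T); split.
  - split; first by rewrite tnuE.
    by apply/subvP => _ /memv_imgP[x _ ->]; rewrite tnuE; apply: subvP au _ (Ta x).
  - by move=> W WJ; rewrite val // tnuE.
  - move=> W Wu WJ; rewrite tnuE /T; have := WJ _ b1JI; rewrite metricC => ->.
    by rewrite scale0r.
  apply: nu_class_intro.
  - by rewrite tnuE.
  - by move=> x; rewrite tnuE.
  - by move=> x y; rewrite tE /tau !tnuE.
  by move=> Y /Il[l ->]; rewrite !linearZ /= nub tnuE T0.
have [tE tI] := nu_class_elim tcl.
have tnuT x : tnu x = T x.
  have tu z : z \in u -> tnu z = T z.
    move=> zu; have zE : z = metric e (b 1%N) z *: b 1%N + (z - metric e (b 1%N) z *: b 1%N).
      by rewrite addrC subrK.
    rewrite {1}zE linearD linearZ /= tJ // val // [X in _ + X]t0.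
    - by rewrite addr0 /T o // scale1r.
    - by rewrite memvB // memvZ // (frame_mem bF).
    by move=> y /JIl[l ->]; rewrite !metricE o //= (metricC e z); ring.
  have tX k' : tnu (k' *: X) = 0 by rewrite linearZ /= tend.1 scaler0.
  have -> : tnu x = tnu (x - (alpha x : R) *: X) by rewrite linearB /= tX subr0.
  rewrite tu // /T alE; congr (_ *: _); rewrite metricDr metricNr metricZr (coord_X su bF) //.
  by rewrite mulr0 subr0.
split.
- by rewrite fI.
- by rewrite tI // tnuT.
by move=> x y; rewrite tE /tau !tnuT.
Qed.

End CaseBMain.

(** * The case of four-dimensional a with J(im omega_0) inside a *)

Section CaseCMain.
Hypotheses (a4 : \dim a = 4%N) (JI : (J @: I <= a)%VS).

(** Compares the contraction that fixes mu with sigma^2, both being four-forms on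
    the span of b_2, ..., b_5: this gives the value of mu. *)
Lemma kappa_C (b : nat -> g) (k : R) (v : 'I_4 -> g) : unitary_frame e u J b ->
  (forall x y, w x y = (metric e (b 2%N) x * metric e (b 4%N) y
      - metric e (b 4%N) x * metric e (b 2%N) y) *: (k *: b 0%N)) ->
  (forall i, metric e (b 0%N) (v i) = 0 /\ metric e (b 1%N) (v i) = 0) ->
  kappa u (wedge (fun (y : g) (d : R^o) => vscale d y) omega0 rho) v
  = k * r (b 0%N) (b 2%N) (b 4%N) * (2%:R^-1 * wedge (@smul R) sigma sigma v) :> R.
Proof.
move=> bF wE v0; have o := frame_orth bF.
pose t (v : 'I_2 -> g) : R^o := k * (metric e (b 2%N) (v ord0) * metric e (b 4%N) (v (lift ord0 ord0))
    - metric e (b 4%N) (v ord0) * metric e (b 2%N) (v (lift ord0 ord0))).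
have tE x y : app2 t x y = k * (metric e (b 2%N) x * metric e (b 4%N) y
    - metric e (b 4%N) x * metric e (b 2%N) y) :> R by rewrite /app2 /t !(tnth_nth 0).
have tF : is_form t.
  apply: is_form2 => [l x y z|l x y z|x]; rewrite !tE /GRing.scale /= ?metricE; ring.
have wedgeE v' : wedge (fun (y : g) (d : R^o) => vscale d y) omega0 rho v'
    = (wedge (@smul R) t rho v' : R) *: b 0%N.
  rewrite /wedge -scalerA; congr (_ *: _); rewrite scaler_suml; apply: eq_bigr => sg _.
  rewrite -scalerA; congr (_ *: _); rewrite (fun2E omega0) wE /vscale /smul /t !scalerA.
  by congr (_ *: _); ring.
pose z0 := v ord0; pose z1 := v (lift ord0 ord0); pose z2 := v (lift ord0 (lift ord0 ord0)).
pose z3 := v (lift ord0 (lift ord0 (lift ord0 ord0))).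
have fE x : wedge (@smul R) t rho (fcat (fun _ : 'I_1 => x) v)
    = app5 (wedge (@smul R) t rho) x z0 z1 z2 z3 :> R.
  by rewrite (fun5E (wedge (k := 2) (l := 3) (@smul R) t rho)) fcat_ord0 !fcat_lift.
have rL := su3_rL su.
rewrite (kappa_decomposable (frame_mem bF (i := 0) erefl) wedgeE) => [|l x y]; last first.
  rewrite !fE !(wedge23E _ _ _ _ _ tF rF.1) !tE !rL !metricE; ring.
rewrite fE (wedge23E _ _ _ _ _ tF rF.1) !tE.
have rE x y := rho_b0E su bF x y.
move: (r (b 0%N) (b 2%N) (b 4%N)) (r (b 0%N) (b 2%N) (b 5%N)) rE => p q rE.
have W4 : wedge (@smul R) sigma sigma v
    = app4 (wedge (k := 2) (l := 2) (@smul R) sigma sigma) z0 z1 z2 z3 by exact: fun4E.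
rewrite !rE !o //= W4 (wedge22E _ _ _ _ sF.1 sF.1) !(sE su bF) -/z0 -/z1 -/z2 -/z3.
have [-> ->] : metric e (b 0%N) z0 = 0 /\ metric e (b 1%N) z0 = 0 by exact: v0.
have [-> ->] : metric e (b 0%N) z1 = 0 /\ metric e (b 1%N) z1 = 0 by exact: v0.
have [-> ->] : metric e (b 0%N) z2 = 0 /\ metric e (b 1%N) z2 = 0 by exact: v0.
have [-> ->] : metric e (b 0%N) z3 = 0 /\ metric e (b 1%N) z3 = 0 by exact: v0.
by field.
Qed.

(** Let z be a unit vector of a orthogonal to b_0 and J b_0. Evaluating the second
    shear equation at J b_0, z, an element y of a orthogonal to the same two vectors
    and two vectors on which omega_0 is a nonzero multiple of b_0 leaves a nonzero
    multiple of sigma (z, y), since omega_0 vanishes as soon as one argument is in a. *)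
Lemma degenerate_of_closed :
  (forall x1 x2 x3 x4 x5, contr_Q s w x1 x2 x3 x4 x5 = 0) -> is_degenerate_on sigma a.
Proof.
move=> A; have [x0 [y0 [b0 [k [w0E k0 b0I b01]]]]] := exists_unit_I.
have b0a : b0 \in a by apply: subvP I_sub_a _ b0I.
have b0u : b0 \in u by apply: subvP au _ b0a.
have b1a : J b0 \in a by apply: subvP JI _ (memv_img J b0I).
have JJ := su3_JJ su; have sk := su3_skew su.
have [z [za zz oz]] : exists W, [/\ W \in a, metric e W W = 1 &
    forall s, s \in <<[:: b0; J b0]>>%VS -> metric e s W = 0].
  by apply: (exists_unit_orth eB); rewrite a4; apply: leq_ltn_trans (dim_span _) _.
have z0 : metric e b0 z = 0 by apply: oz; apply: memv_span; rewrite !inE eqxx.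
have z1 : metric e (J b0) z = 0 by apply: oz; apply: memv_span; rewrite !inE eqxx orbT.
exists z; split=> //; first by apply: contra_eq_neq zz => ->; rewrite metric0l eq_sym oner_neq0.
move=> y ya; pose y' := y - metric e b0 y *: b0 - metric e (J b0) y *: J b0.
have b11 : metric e (J b0) (J b0) = 1 by rewrite sk JJ // metricNr b01 opprK.
have b10 : metric e (J b0) b0 = 0.
  by have := sk b0 b0; rewrite (metricC e b0) => E; lra.
have y0' : metric e b0 y' = 0 by rewrite /y' !metricE b01 (metricC e b0 (J b0)) b10; ring.
have y1' : metric e (J b0) y' = 0 by rewrite /y' !metricE b11 b10; ring.
have sE := su3_s su.
have wz x x' : x \in a -> w x x' = 0 by move=> *; apply: (sh_wa sh).
have wz' x x' : x \in a -> w x' x = 0 by move=> *; rewrite (sh_wC sh) wz ?oppr0.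
have y'a : y' \in a by rewrite !memvB // memvZ.
have s0 x : s 0 x = 0.
  by have := s_linear su 1 0 0 x; rewrite scaler0 addr0 mul1r => E; apply: (addrI (s 0 x)); rewrite addr0 -E.
have sz : s z y' = 0.
  (* x0 and y0 are vectors at which omega_0 is a nonzero multiple of b0. *)
  have := A x0 y0 (J b0) z y'; rewrite /contr_Q.
  rewrite !(wz' (J b0) _ b1a) !(wz' z _ za) !(wz' y' _ y'a) w0E /Qs !s0.
  have sk0 x : s (k *: b0) x = k * s b0 x.
    by rewrite -[k *: b0]addr0 (s_linear su) s0 addr0.
  rewrite !sk0 !(sE b0) JJ // metricNr b01 -(opprK (metric e b0 (J z))) -sk z1.
  rewrite -(opprK (metric e b0 (J y'))) -sk y1' => E.
  have : k * s z y' = 0 by rewrite -[RHS]E; ring.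
  by move/eqP; rewrite mulf_eq0 (negbTE k0) => /eqP.
have yE : y = metric e (J b0) y *: J b0 + (metric e b0 y *: b0 + y').
  by apply: (metric_inj eB) => t; rewrite /y' !metricE; ring.
have sR l x x' : s z (l *: x + x') = l * s z x + s z x'.
  by rewrite (s_anti su) (s_linear su) (s_anti su z x) (s_anti su z x'); ring.
change (s z y = 0); rewrite yE !sR sz (sE z b0) (sE z (J b0)) JJ // metricNr.
by rewrite (metricC e z b0) z0 (metricC e z (J b0)) z1; ring.
Qed.

(** A vector z in the radical of sigma on a is such that J z is orthogonal to a;
    normalized, it is taken as b_2. The remaining direction orthogonal to a is
    b_4. *)
Lemma frame_C : is_degenerate_on sigma a -> exists b k, [/\ unitary_frame e u J b, k != 0,
  forall x, x \in a -> metric e (b 2%N) x = 0 /\ metric e (b 4%N) x = 0,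
  [/\ b 0%N \in a, b 1%N \in a, b 3%N \in a & b 5%N \in a] &
  (forall x y, w x y = (metric e (b 2%N) x * metric e (b 4%N) y
                        - metric e (b 4%N) x * metric e (b 2%N) y) *: (k *: b 0%N))
  /\ b 0%N \in I].
Proof.
case=> z [za z0 sz]; have [x0 [y0 [b0 [k0 [w0E k00 b0I b01]]]]] := exists_unit_I.
have b0a : b0 \in a by apply: subvP I_sub_a _ b0I.
have b0u : b0 \in u by apply: subvP au _ b0a.
have b1a : J b0 \in a by apply: subvP JI _ (memv_img J b0I).
have JJ := su3_JJ su; have sk := su3_skew su.
have zu : z \in u by apply: subvP au _ za.
have zz : 0 < metric e z z.
  by rewrite lt_neqAle metric_ge0 andbT eq_sym; apply: contra_neq z0; exact: metric_eq0.
pose l := (Num.sqrt (metric e z z))^-1.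
have ll : l * l * metric e z z = 1.
  by rewrite /l -invfM -expr2 sqr_sqrtr ?ltW // mulVf // gt_eqF.
pose b2 := l *: J z.
have Jb2 : J b2 = - l *: z by rewrite linearZ /= JJ // scalerN scaleNr.
have b2a x : x \in a -> metric e x b2 = 0.
  move=> xa; rewrite metricZr -(su3_s su) (s_anti su) (sz x xa : s z x = 0) oppr0.
  exact: mulr0.
have b2u : b2 \in u by rewrite memvZ // Jmem.
have n2 : metric e b2 b2 = 1.
  by rewrite metricZl metricZr sk JJ // metricNr opprK mulrA ll.
have [b4 [m4 n4 o4]] : exists W, [/\ W \in u, metric e W W = 1 &
    forall s, s \in (a + <[b2]>)%VS -> metric e s W = 0].
  by apply: (exists_unit_orth eB); rewrite u6; apply: dim_add_line; rewrite a4.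
have o4a x : x \in a -> metric e x b4 = 0 by move=> xa; apply: o4; apply: subvP (addvSl _ _) _ xa.
have [b [bF b0E b2E b4E]] : exists b, [/\ unitary_frame e u J b, b 0%N = b0, b 2%N = b2 & b 4%N = b4].
  exists (nth 0 [:: b0; J b0; b2; J b2; b4; J b4]); split=> //.
  apply: (unitary_frame_of (fun x _ => Jmem x) (fun x y _ _ => sk x y) JJ) => //.
  - exact: b2a.
  - exact: b2a.
  - exact: o4a.
  - exact: o4a.
  - by apply: o4; apply: subvP (addvSr _ _) _ (memv_line _).
  by rewrite Jb2 metricZl o4a // mulr0.
have aE x : x \in a -> metric e (b 2%N) x = 0 /\ metric e (b 4%N) x = 0.
  by move=> xa; rewrite b2E b4E !(metricC e _ x) b2a // o4a.
have ab : forall y, y \in [:: b 0%N; b 1%N; b 3%N; b 5%N] -> y \in a.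
  apply: span_mem; last by rewrite a4.
  move=> x xa; have [c1 c2] := aE x xa.
  rewrite (vec_frame su bF (subvP au _ xa)) c1 c2 !scale0r !addr0.
  by apply: memvD; [apply: memvD; [apply: memvD|]|]; apply: memvZ; apply: memv_span; rewrite !inE eqxx ?orbT.
have wE : forall x y, w x y = (metric e (b 2%N) x * metric e (b 4%N) y
    - metric e (b 4%N) x * metric e (b 2%N) y) *: w (b 2%N) (b 4%N).
  apply: (w_decomposable bF) => // -[|[|[|[|[|[|k]]]]]] //= _ _ _;
    by apply: ab; rewrite !inE eqxx ?orbT.
pose h := metric e (b 2%N) x0 * metric e (b 4%N) y0 - metric e (b 4%N) x0 * metric e (b 2%N) y0.
have hE : h *: w (b 2%N) (b 4%N) = k0 *: b 0%N by rewrite b0E -w0E [RHS]wE.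
have h0 : h != 0.
  apply: contra_neq k00 => h0; move: hE; rewrite h0 scale0r => /esym/eqP.
  rewrite scaler_eq0 => /orP[/eqP //|/eqP b00]; move: b01; rewrite -b0E b00 metric0l.
  by move/eqP; rewrite eq_sym oner_eq0.
have TE : w (b 2%N) (b 4%N) = (h^-1 * k0) *: b 0%N.
  by rewrite -scalerA -hE scalerA mulVf // scale1r.
exists b, (h^-1 * k0); split=> //.
- by rewrite mulf_neq0 // invr_neq0.
- by split; apply: ab; rewrite !inE eqxx ?orbT.
by split; [move=> x y; rewrite -TE | rewrite b0E].
Qed.

Lemma shears_J_stable : shears <->
  is_degenerate_on sigma a
  /\ exists (tnu : 'End(g)) (mu : R),
     [/\ endo_on X u tnu,
         forall Y, Y \in I -> metric e Y Y = 1 ->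
           [/\ forall v : 'I_4 -> g,
                 (forall i, v i \in u /\ metric e (v i) Y = 0
                            /\ metric e (v i) (J Y) = 0) ->
                 kappa u (wedge (fun (y : g) (d : R^o) => vscale d y) omega0 rho) v
                 = - mu * wedge (@smul R) sigma sigma v,
               tnu Y = - trace_on a f *: Y - f Y,
               tnu (J Y) = (- app2 sigma (f Y) (J Y) + trace_on a f - mu) *: J Y
             & forall W, W \in u -> is_orth e W a ->
                 tnu W = - (app2 sigma (f Y) W : R) *: J Y],
         forall W, W \in a -> is_orth e W (I + J @: I)%VS -> tnu W = mu *: W
       & nu_class tnu].
Proof.
apply: guarded_iff => [|deg].
  by case/shears_equations => _ A _; apply: degenerate_of_closed.
have [b [k [bF k0 aE ab [wE b0I]]]] := frame_C deg.
have o := frame_orth bF; have [a0 a1 a3 a5] := ab.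
rewrite shears_equations (shear_equations_stable su sh bF k0 aE ab wE).
have trE : trace_on a f = metric e (b 0%N) (f (b 0%N)) + metric e (b 1%N) (f (b 1%N))
    + metric e (b 3%N) (f (b 3%N)) + metric e (b 5%N) (f (b 5%N)).
  rewrite (trace_frame (L := [:: 0; 1; 3; 5]%N) bF) // ?a4 //.
    by rewrite !big_cons big_nil addr0 !addrA.
  by move=> j; rewrite !inE => /or4P[] /eqP ->.
rewrite -trE; set T := nu_stable _ _ _ _ _ _.
pose mu0 := - (k * r (b 0%N) (b 2%N) (b 4%N)) / 2%:R.
have TE x : T x = metric e (b 0%N) x *: (- trace_on a f *: b 0%N - f (b 0%N))
  + metric e (b 1%N) x *: ((- s (f (b 0%N)) (b 1%N) + trace_on a f - mu0) *: b 1%N)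
  + metric e (b 3%N) x *: (mu0 *: b 3%N) + metric e (b 5%N) x *: (mu0 *: b 5%N)
  - (metric e (b 2%N) x * s (f (b 0%N)) (b 2%N)
     + metric e (b 4%N) x * s (f (b 0%N)) (b 4%N)) *: b 1%N.
  by rewrite trE.
have Il : forall Y, Y \in I -> exists l, Y = l *: b 0%N.
  by apply: I_line => v; rewrite (fun2E omega0) wE !memvZ // memv_line.
have b1JI : b 1%N \in (J @: I)%VS by rewrite -(frame_J0 bF) memv_img.
have fZ (A : 'End(g)) l x : A (l *: x) = l *: A x by exact: linearZ.
have sZ l x y : s (l *: x) y = l * s x y.
  have := s_linear su l x 0 y; have := s_linear su 1 0 0 y.
  by rewrite scaler0 !addr0 mul1r => h ->; lra.
have sZr l x y : s x (l *: y) = l * s x y.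
  by rewrite (s_anti su) sZ (s_anti su x); ring.
have TL : forall l x y, T (l *: x + y) = l *: T x + T y.
  by move=> l x y; apply: (metric_inj eB) => z; rewrite !TE !metricE; ring.
have TX : T X = 0.
  by rewrite TE !(coord_X su bF) // !scale0r !mul0r !addr0 scale0r subr0.
have Ta x : T x \in a.
  by rewrite TE; rewrite memvB ?memvZ // ?memvD ?memvZ // memvB ?memvZ // (f_mem fa).
have T0 : T (b 0%N) = - trace_on a f *: b 0%N - f (b 0%N).
  rewrite TE !o //= scale1r !scale0r !mul0r !addr0 scale0r subr0 //.
have T1 : T (b 1%N) = (- s (f (b 0%N)) (b 1%N) + trace_on a f - mu0) *: b 1%N.
  by rewrite TE !o //= scale1r !scale0r !mul0r !addr0 scale0r subr0 add0r.
have Tperp W : metric e (b 0%N) W = 0 -> metric e (b 1%N) W = 0 -> metric e (b 3%N) W = 0 ->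
    metric e (b 5%N) W = 0 -> W \in u -> T W = - s (f (b 0%N)) W *: b 1%N.
  move=> h0 h1 h3 h5 Wu; rewrite TE h0 h1 h3 h5 !scale0r !addr0 add0r -scaleNr.
  congr (- _ *: _).
  have sR l x x' z : s z (l *: x + x') = l * s z x + s z x'.
    by rewrite (s_anti su) (s_linear su) (s_anti su z x) (s_anti su z x'); ring.
  rewrite [in RHS](vec_frame su bF Wu) h0 h1 h3 h5 !scale0r !addr0 !add0r.
  by rewrite sR sZr.
have TU W : W \in a -> metric e (b 0%N) W = 0 -> metric e (b 1%N) W = 0 -> T W = mu0 *: W.
  move=> Wa h0 h1; have [h2 h4] := aE _ Wa.
  rewrite TE h0 h1 h2 h4 !mul0r addr0 !scale0r subr0 !add0r.
  rewrite [in RHS](vec_frame su bF (subvP au _ Wa)) h0 h1 h2 h4 !scale0r !add0r addr0.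
  by rewrite scalerDr !scalerA [_ * mu0]mulrC [_ * mu0]mulrC.
have TZ l x : T (l *: x) = l *: T x.
  have T0' : T 0 = 0 by have := TL (-1) 0 0; rewrite scaler0 addr0 scaleN1r addNr.
  by have := TL l x 0; rewrite !addr0 T0' addr0.
have JZ l : J (l *: b 0%N) = l *: b 1%N by rewrite fZ (frame_J0 bF).
split=> [[nub tE]|[tnu [mu [tend tI tU tcl]]]].
  have tnuE : linfun T =1 T by exact: linfunE.
  exists (linfun T), mu0; split.
  - split; first by rewrite tnuE.
    by apply/subvP => _ /memv_imgP[x _ ->]; rewrite tnuE; apply: subvP au _ (Ta x).
  - move=> Y /Il[l ->] ll; have {}ll : l * l = 1.
      by move: ll; rewrite !metricE o //= mulr1.
    have l0 : l != 0 by apply: contra_eq_neq ll => ->; rewrite mul0r eq_sym oner_neq0.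
    split.
    + move=> v vP; rewrite (kappa_C bF wE) => [|i]; first by rewrite /mu0; field.
      have [vu [h0 h1]] := vP i; rewrite JZ in h1.
      by split; apply: (mulfI l0); rewrite mulr0 metricC -metricZr.
    + by rewrite tnuE TZ T0 fZ scalerBr !scalerA mulrC.
    + rewrite JZ tnuE TZ T1 fZ sZ sZr mulrA ll mul1r !scalerA; congr (_ *: _); ring.
    move=> W Wu Wa; have W0 y : y \in a -> metric e y W = 0 by move=> ya; rewrite metricC Wa.
    rewrite tnuE Tperp ?W0 // JZ fZ sZ scalerA; congr (_ *: _).
    by rewrite mulNr mulrAC ll mul1r.
  - move=> W Wa Wo; rewrite tnuE TU // metricC Wo //.
      exact: subvP (addvSl _ _) _ b0I.
    exact: subvP (addvSr _ _) _ b1JI.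
  apply: nu_class_intro.
  - by rewrite tnuE.
  - by move=> x; rewrite tnuE.
  - by move=> x y; rewrite tE /tau !tnuE.
  by move=> Y /Il[l ->]; rewrite fZ nub tnuE TZ T0.
have [tE tI'] := nu_class_elim tcl.
have b01 : metric e (b 0%N) (b 0%N) = 1 by rewrite o.
have [kap tb0 tb1 tperp] := tI _ b0I b01; rewrite (frame_J0 bF) in kap tb1 tperp.
have bm i : (i < 6)%N -> b i \in u by exact: (frame_mem bF).
have muE : mu = mu0.
  have := kap (tnth [tuple b 2%N; b 3%N; b 4%N; b 5%N]).
  rewrite (kappa_C bF wE); last by case=> [[|[|[|[|]]]]] //= ?; rewrite (tnth_nth 0) /= !o.
  have -> : wedge (@smul R) sigma sigma (tnth [tuple b 2%N; b 3%N; b 4%N; b 5%N]) = 2%:R :> R.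
    rewrite -[LHS]/(app4 (wedge (k := 2) (l := 2) (@smul R) sigma sigma) (b 2%N) (b 3%N) (b 4%N) (b 5%N)).
    by rewrite (wedge22E _ _ _ _ sF.1 sF.1) !(sE su bF) !o //=; ring.
  move=> E; have {}E := E _; rewrite /mu0.
  have /E : forall i, tnth [tuple b 2%N; b 3%N; b 4%N; b 5%N] i \in u /\
    metric e (tnth [tuple b 2%N; b 3%N; b 4%N; b 5%N] i) (b 0%N) = 0 /\
    metric e (tnth [tuple b 2%N; b 3%N; b 4%N; b 5%N] i) (b 1%N) = 0.
    by case=> [[|[|[|[|]]]]] //= ?; rewrite (tnth_nth 0) /= !o // bm.
  by lra.
have tnuT x : tnu x = T x.
  have tX k' : tnu (k' *: X) = 0 by rewrite fZ tend.1 scaler0.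
  have -> : tnu x = tnu (x - (alpha x : R) *: X) by rewrite linearB /= tX subr0.
  have -> : T x = T (x - (alpha x : R) *: X).
    by rewrite addrC -scaleNr TL TX scaler0 add0r.
  move: (x - _) (alD x) => z zu; rewrite (vec_frame su bF zu).
  have TD y y' : T (y + y') = T y + T y' by have := TL 1 y y'; rewrite !scale1r.
  have aoJ i : (i < 6)%N -> i != 0%N -> i != 1%N -> is_orth e (b i) (I + J @: I)%VS.
    move=> i6 i0 i1 _ /memv_addP[_ /Il[l ->] [_ /memv_imgP[_ /Il[l' ->] ->] ->]].
    by rewrite JZ metricDr !metricZr !o // (negbTE i0) (negbTE i1) !mulr0 addr0.
  have oa i : (i == 2%N) || (i == 4%N) -> is_orth e (b i) a.
    by move=> ii y /aE[h2 h4]; case/orP: ii => /eqP ->.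
  rewrite !linearD /= !TD !fZ !TZ tb0 tb1 T0 T1 muE.
  have t24 i : (i == 2%N) || (i == 4%N) -> tnu (b i) = T (b i).
    by move=> ii; rewrite (tperp _ _ (oa i ii)) ?Tperp ?o ?bm //; case/orP: ii => /eqP ->.
  have t35 i : (i == 3%N) || (i == 5%N) -> tnu (b i) = T (b i).
    move=> ii; have ba : b i \in a by case/orP: ii => /eqP ->.
    rewrite (tU _ ba) ?(TU _ ba) ?o ?muE //; case/orP: ii => /eqP -> //; exact: aoJ.
  by rewrite (t24 2%N) ?(t24 4%N) ?(t35 3%N) ?(t35 5%N).
split; first by rewrite tI' // tb0.
by move=> x y; rewrite tE /tau !tnuT.
Qed.

End CaseCMain.

(** * The case of primitive (1,1)-forms *)

Section CaseAMain.
Hypothesis wA : in_tensor (is_primitive11 X u e J sigma) a omega0.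

Lemma type11_J t x y : form_on X t -> is_type11 u J t ->
  app2 t (J x) (J y) = app2 t x y :> R.
Proof.
move=> tF tJ; have tL := s_lin tF; have tC p q : app2 t q p = - app2 t p q :> R by exact: (form2C tF.1).
have JX k : J (k *: X) = 0 by rewrite linearZ /= JE.1 scaler0.
have tp p q : app2 t (p - (alpha p : R) *: X) q = app2 t p q :> R.
  by rewrite addrC -scaleNr tL (Xs tF) mulr0 add0r.
have Jp p : J (p - (alpha p : R) *: X) = J p by rewrite linearB /= JX subr0.
have -> : app2 t x y = app2 t (x - (alpha x : R) *: X) (y - (alpha y : R) *: X) :> R.
  by rewrite tp tC -(tp y) -tC.
rewrite -(Jp x) -(Jp y).
have [_ [h _]] := tJ _ _ (alD x) (alD y).
by apply/esym/eqP; rewrite -subr_eq0; apply/eqP.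
Qed.

Section InFrame.
Variable b : nat -> g.
Hypothesis bF : unitary_frame e u J b.
Local Notation c := (fun i x => metric e (b i) x).
Let o i j : (i < 6)%N -> (j < 6)%N -> metric e (b i) (b j) = (i == j)%:R.
Proof. exact: (frame_orth bF). Qed.

(** The inner product with sigma is computed in the basis e; since sigma is the sum
    of three decomposable forms of the unitary frame, it is the trace of the form
    over the three complex lines. *)
Lemma primitive_frame t : form_on X t -> form_inner e t sigma = 0 ->
  app2 t (b 0%N) (b 1%N) + app2 t (b 2%N) (b 3%N) + app2 t (b 4%N) (b 5%N) = 0 :> R.
Proof.
move=> tF; rewrite form_inner2E.
have tL := s_lin tF; have tC p q : app2 t q p = - app2 t p q :> R by exact: (form2C tF.1).
pose B x y : R := \sum_(i < 7) \sum_(j < 7) (metric e x e`_i * metric e y e`_j) * app2 t e`_i e`_j.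
have BE x y : B x y = app2 t x y.
  apply: (bilinear_expand eB (t := fun x y => app2 t x y : R)) => // l p q z.
  by rewrite tC tL (tC z p) (tC z q); ring.
have -> : \sum_(i < 7) \sum_(j < 7) (app2 t e`_i e`_j * app2 sigma e`_i e`_j : R)
    = - (B (b 0%N) (b 1%N) - B (b 1%N) (b 0%N)) - (B (b 2%N) (b 3%N) - B (b 3%N) (b 2%N))
      - (B (b 4%N) (b 5%N) - B (b 5%N) (b 4%N)).
  rewrite /B -!sumrB -!sumrN -!big_split; apply: eq_bigr => i _ /=.
  rewrite -!sumrB -!sumrN -!big_split; apply: eq_bigr => j _ /=.
  by rewrite (sE su bF); ring.
rewrite !BE (tC (b 0%N)) (tC (b 2%N)) (tC (b 4%N)).
have h : (2%:R^-1 : R) != 0 by rewrite invr_neq0 // pnatr_eq0.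
by move=> /(mulf_left_eq0 h) E; lra.
Qed.

Lemma w_asd : b 0%N \in a -> forall z, exists P Q S, forall x y,
  metric e z (w x y) = asd e b P Q S x y.
Proof.
move=> b0a z; have [tL tC tX] := w_component z.
have [n [sg [A [sA wE]]]] := wA.
have wE' x y : metric e z (w x y) = \sum_i (app2 (sg i) x y : R) * metric e z (A i).
  rewrite /app2 wE metric_sumr; apply: eq_bigr => i _.
  exact: metricZr.
do 3 eexists; apply: (asd_of_primitive11 su bF tL tC tX).
- move=> x y; rewrite !wE'; apply: eq_bigr => i _; congr (_ * _).
  by have [[tF t11 _] _] := sA i; apply: type11_J.
- by move=> y; rewrite (sh_wa sh) // metric0r.
rewrite !wE' -!big_split big1 // => i _ /=.
have [[tF _ tP] _] := sA i; have := primitive_frame tF tP.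
by rewrite -!mulrDl => ->; rewrite mul0r.
Qed.

(** The square of a nonzero anti-self-dual form is a nonzero volume form; the
    linear combinations used invert it explicitly. *)
Lemma asd_nondegenerate P Q S x : P ^+ 2 + Q ^+ 2 + S ^+ 2 != 0 ->
  (forall y, asd e b P Q S x y = 0) -> [/\ c 2%N x = 0, c 3%N x = 0, c 4%N x = 0 & c 5%N x = 0].
Proof.
move=> G0 H; have tac t : t = 0 -> forall k, (P ^+ 2 + Q ^+ 2 + S ^+ 2) * k = t -> k = 0.
  by move=> -> k; apply: mulf_left_eq0.
split.
- by apply: (tac (P * asd e b P Q S x (b 3%N) + Q * asd e b P Q S x (b 4%N) + S * asd e b P Q S x (b 5%N)));
    [rewrite !H; ring | rewrite /asd !o //=; ring].
- by apply: (tac (- P * asd e b P Q S x (b 2%N) + Q * asd e b P Q S x (b 5%N) - S * asd e b P Q S x (b 4%N)));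
    [rewrite !H; ring | rewrite /asd !o //=; ring].
- by apply: (tac (- Q * asd e b P Q S x (b 2%N) + S * asd e b P Q S x (b 3%N) - P * asd e b P Q S x (b 5%N)));
    [rewrite !H; ring | rewrite /asd !o //=; ring].
by apply: (tac (- S * asd e b P Q S x (b 2%N) + P * asd e b P Q S x (b 4%N) - Q * asd e b P Q S x (b 3%N)));
    [rewrite !H; ring | rewrite /asd !o //=; ring].
Qed.

Lemma asd_form P Q S : form_on X (fun v : 'I_2 -> g => asd e b P Q S (v ord0) (v (lift ord0 ord0)) : R^o).
Proof.
split.
  by apply: is_form2 => [l x y z|l x y z|x]; rewrite /app2 !(tnth_nth 0) /asd /GRing.scale /= ?metricE; ring.
move=> v i vi; have vX j : v j = X -> forall k, (k < 6)%N -> c k (v j) = 0.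
  by move=> -> k k6; exact: (coord_X su bF).
have {vi} [vi|vi] : v ord0 = X \/ v (lift ord0 ord0) = X.
- by case: i vi => [[|[|]]] //= ? <-; [left|right]; congr v; apply: val_inj.
- by rewrite /asd !(vX _ vi) //; ring.
by rewrite /asd !(vX _ vi) //; ring.
Qed.

Lemma free_pair (Y1 Y2 : g) : Y2 != 0 -> (forall k, Y1 <> k *: Y2) -> free [:: Y1; Y2].
Proof.
move=> Y20 H; rewrite free_cons seq1_free Y20 andbT span_seq1.
by apply/negP => /vlineP[k /H].
Qed.

Lemma w_components : b 0%N \in I -> (exists x y k, w x y = k *: b 0%N /\ k != 0) ->
  exists P0 Q0 S0 P1 Q1 S1, [/\ P0 ^+ 2 + Q0 ^+ 2 + S0 ^+ 2 != 0,
    forall x, x \in a -> x = c 0%N x *: b 0%N + c 1%N x *: b 1%N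
  & forall x y, w x y = asd e b P0 Q0 S0 x y *: b 0%N + asd e b P1 Q1 S1 x y *: b 1%N].
Proof.
move=> b0I [x0 [y0 [k0 [w0E k00]]]]; have b0a : b 0%N \in a by apply: subvP I_sub_a _ b0I.
have [P0 [Q0 [S0 E0]]] := w_asd b0a (b 0%N); have [P1 [Q1 [S1 E1]]] := w_asd b0a (b 1%N).
have G0 : P0 ^+ 2 + Q0 ^+ 2 + S0 ^+ 2 != 0.
  apply: contra_neq k00 => G; have := E0 x0 y0; rewrite w0E metricZr o // mulr1 => ->.
  have : P0 ^+ 2 = 0 /\ Q0 ^+ 2 = 0 /\ S0 ^+ 2 = 0.
    have := sqr_ge0 P0; have := sqr_ge0 Q0; have := sqr_ge0 S0; move: G.
    by move: (P0 ^+ 2) (Q0 ^+ 2) (S0 ^+ 2) => p q t; lra.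
  by case=> /eqP + [/eqP + /eqP]; rewrite !sqrf_eq0 => /eqP -> /eqP -> /eqP ->; rewrite /asd; ring.
have aE x : x \in a -> x = c 0%N x *: b 0%N + c 1%N x *: b 1%N.
  move=> xa; have [c2 c3 c4 c5] : [/\ c 2%N x = 0, c 3%N x = 0, c 4%N x = 0 & c 5%N x = 0].
    by apply: (asd_nondegenerate G0) => y; rewrite -E0 (sh_wa sh) // metric0r.
  by rewrite {1}(vec_frame su bF (subvP au _ xa)) c2 c3 c4 c5 !scale0r !addr0.
have wE x y : w x y = asd e b P0 Q0 S0 x y *: b 0%N + asd e b P1 Q1 S1 x y *: b 1%N.
  by rewrite (aE _ (sh_wA sh x y)) E0 E1.
by exists P0, Q0, S0, P1, Q1, S1.
Qed.

Lemma dim_a_le2 : (forall x, x \in a -> x = c 0%N x *: b 0%N + c 1%N x *: b 1%N) -> (\dim a <= 2)%N.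
Proof.
move=> aE; apply: (@leq_trans (\dim <<[:: b 0%N; b 1%N]>>)); last exact: dim_span.
apply: dimvS; apply/subvP => x /aE ->.
by rewrite memvD ?memvZ ?memv_span ?inE ?eqxx ?orbT.
Qed.

(** The dichotomy is whether the Gram determinant of the two components vanishes,
    that is, whether they are proportional. *)
Lemma jacobi_cases : (forall x y, f (w x y) + nu (w x y) = w (f x) y + w x (f y)) ->
  b 0%N \in I -> (exists x y k, w x y = k *: b 0%N /\ k != 0) -> 
  [/\ \dim I = 1%N, forall v, lie_act f omega0 v = 0 & forall Y, Y \in I -> nu Y = - f Y]
  \/
  (\dim I = 2%N
   /\ exists (w1 w2 : ('I_2 -> g) -> R^o) (Y1 Y2 : g) (c : R),
        [/\ form_on X w1 /\ form_on X w2,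
            basis_of a [:: Y1; Y2]
            /\ (forall v, omega0 v = vscale (w1 v) Y1 + vscale (w2 v) Y2),
            (forall v, wedge (@smul R) w1 w2 v = 0)
            /\ (forall v, wedge (@smul R) w2 w1 v = 0)
            /\ (forall v, wedge (@smul R) w2 w2 v = wedge (@smul R) w1 w1 v),
            (forall v, lie_act f w1 v = c * w2 v)
            /\ (forall v, lie_act f w2 v = - c * w1 v)
          & nu Y1 = c *: Y2 - f Y1 /\ nu Y2 = - c *: Y1 - f Y2]).
Proof.
move=> jac b0I w0I; have b0a : b 0%N \in a by apply: subvP I_sub_a _ b0I.
have b00 : b 0%N != 0.
  by apply/eqP => E; have := o (i := 0) (j := 0) erefl erefl; rewrite E metric0l => /eqP; rewrite eq_sym oner_eq0.
have [P0 [Q0 [S0 [P1 [Q1 [S1 [G0 aE wE]]]]]]] := w_components b0I w0I.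
pose G00 := P0 ^+ 2 + Q0 ^+ 2 + S0 ^+ 2.
pose G01 := P0 * P1 + Q0 * Q1 + S0 * S1.
pose G11 := P1 ^+ 2 + Q1 ^+ 2 + S1 ^+ 2.
have G00p : 0 < G00 by rewrite lt_neqAle eq_sym G0 /= !addr_ge0 ?sqr_ge0.
have GE : G00 * G11 - G01 ^+ 2 = (P0 * Q1 - Q0 * P1) ^+ 2 + (P0 * S1 - S0 * P1) ^+ 2
    + (Q0 * S1 - S0 * Q1) ^+ 2 by rewrite /G00 /G01 /G11; ring.
have : 0 <= G00 * G11 - G01 ^+ 2 by rewrite GE !addr_ge0 ?sqr_ge0.
rewrite le_eqVlt => /orP[/eqP Gram|Gram]; [left|right].
  pose l := G01 / G00; pose Z := b 0%N + l *: b 1%N.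
  have [lP lQ lS] : [/\ P1 = l * P0, Q1 = l * Q0 & S1 = l * S0].
    move: GE; rewrite -Gram => /esym GE.
    have [q1 q2 q3] : [/\ P0 * Q1 - Q0 * P1 = 0, P0 * S1 - S0 * P1 = 0 & Q0 * S1 - S0 * Q1 = 0].
      have : (P0 * Q1 - Q0 * P1) ^+ 2 = 0 /\ (P0 * S1 - S0 * P1) ^+ 2 = 0 /\ (Q0 * S1 - S0 * Q1) ^+ 2 = 0.
        have := sqr_ge0 (P0 * Q1 - Q0 * P1); have := sqr_ge0 (P0 * S1 - S0 * P1).
        have := sqr_ge0 (Q0 * S1 - S0 * Q1); move: GE.
        by move: (_ ^+ 2) (_ ^+ 2) (_ ^+ 2) => p q t; lra.
      by case=> /eqP + [/eqP + /eqP]; rewrite !sqrf_eq0 => /eqP -> /eqP -> /eqP ->.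
    have lG : l * G00 = G01 by rewrite /l divfK.
    clearbody l; split; apply/eqP; rewrite -subr_eq0; apply/eqP; apply: (mulf_left_eq0 G0); rewrite -/G00.
    - transitivity (P1 * G00 - l * G00 * P0); [by ring|rewrite lG /G00 /G01].
      transitivity (- Q0 * (P0 * Q1 - Q0 * P1) - S0 * (P0 * S1 - S0 * P1)); [by ring|by rewrite q1 q2 !mulr0 subr0].
    - transitivity (Q1 * G00 - l * G00 * Q0); [by ring|rewrite lG /G00 /G01].
      transitivity (P0 * (P0 * Q1 - Q0 * P1) - S0 * (Q0 * S1 - S0 * Q1)); [by ring|by rewrite q1 q3 !mulr0 subr0].
    transitivity (S1 * G00 - l * G00 * S0); [by ring|rewrite lG /G00 /G01].
    transitivity (P0 * (P0 * S1 - S0 * P1) + Q0 * (Q0 * S1 - S0 * Q1)); [by ring|by rewrite q2 q3 !mulr0 addr0].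
  have wZ x y : w x y = asd e b P0 Q0 S0 x y *: Z.
    rewrite wE lP lQ lS /Z scalerDr scalerA; congr (_ + _ *: _); rewrite /asd; ring.
  have IZ : forall Y, Y \in I -> exists k, Y = k *: Z.
    by apply: I_line => v; rewrite (fun2E omega0) wZ memvZ // memv_line.
  have Z0 : Z != 0.
    by apply: contra_neq b00 => Z0; have [k ->] := IZ _ b0I; rewrite Z0 scaler0.
  have [H1 H2] := jacobi_line su sh bF jac G0 Z0 wZ.
  split.
  - apply/eqP; rewrite eqn_leq; apply/andP; split.
      apply: (@leq_trans (\dim <[Z]>)); last by rewrite dim_vline Z0.
      by apply: dimvS; apply/subvP => Y /IZ[k ->]; rewrite memvZ // memv_line.
    by rewrite lt0n dimv_eq0; apply: contra_neq b00 => I0; move: b0I; rewrite I0 memv0 => /eqP.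
  - by move=> v; rewrite (fun2E (lie_act _ _)) lie_act2E H1 oppr0.
  have fZ (A : 'End(g)) k x : A (k *: x) = k *: A x by exact: linearZ.
  move=> Y /IZ[k ->]; rewrite !fZ -scalerN; congr (_ *: _).
  by apply/eqP; rewrite -addr_eq0 addrC H2.
have b1I : b 1%N \in I.
  have N1 : [|| P1 != 0, Q1 != 0 | S1 != 0].
    apply: contraTT Gram; rewrite !negb_or !negbK => /and3P[/eqP p /eqP q /eqP t].
    by rewrite GE p q t !mulr0 !subr0 !expr0n /= !addr0 ltxx.
  have K x y : asd e b P1 Q1 S1 x y != 0 -> b 1%N \in I.
    move=> t0; have : w x y - asd e b P0 Q0 S0 x y *: b 0%N \in I.
      by rewrite memvB ?memvZ //; apply: (IE.1 _ : w x y \in I).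
    by rewrite wE addrC addKr => /(memvZ (asd e b P1 Q1 S1 x y)^-1); rewrite scalerA mulVf // scale1r.
  have [[bP bQ] bS] := asd_basis bF P1 Q1 S1.
  case/or3P: N1 => h.
  - by apply: (K (b 2%N) (b 3%N)); rewrite bP.
  - by apply: (K (b 2%N) (b 4%N)); rewrite bQ.
  - by apply: (K (b 2%N) (b 5%N)); rewrite bS.
have b1a : b 1%N \in a by apply: subvP I_sub_a _ b1I.
have [l [t [k [t0 [wY W12 W22] D1 D2 nuY]]]] := jacobi_plane su sh bF jac wE aE b0a b1a G00p Gram.
have a2 := dim_a_le2 aE.
pose Y1 := b 0%N + l *: b 1%N; pose Y2 := t^-1 *: b 1%N.
pose W1 := asd e b P0 Q0 S0; pose W2 x y := t * (asd e b P1 Q1 S1 x y - l * asd e b P0 Q0 S0 x y).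
have fr : free [:: Y1; Y2].
  apply: free_pair => [|q /(congr1 (metric e (b 0%N)))].
    rewrite scaler_eq0 invr_eq0 gt_eqF //=; apply/eqP => E.
    by have := o (i := 1) (j := 1) erefl erefl; rewrite E metric0l => /eqP; rewrite eq_sym oner_eq0.
  by rewrite /Y1 /Y2 !metricE !o //= !mulr0 addr0 => /eqP; rewrite oner_eq0.
have spI : (<<[:: Y1; Y2]>> <= I)%VS.
  apply/span_subvP => y; rewrite !inE => /orP[] /eqP ->; last exact: memvZ.
  by rewrite memvD ?memvZ.
have I2 : (2 <= \dim I)%N by have := dimvS spI; rewrite (eqP fr).
split.
  apply/eqP; rewrite eqn_leq I2 andbT; apply: leq_trans a2; exact: dimvS I_sub_a.
have W2E x y : W2 x y = asd e b (t * (P1 - l * P0)) (t * (Q1 - l * Q0)) (t * (S1 - l * S0)) x y.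
  by rewrite /W2 /asd; ring.
pose w1 (v : 'I_2 -> g) : R^o := W1 (v ord0) (v (lift ord0 ord0)); pose w2 (v : 'I_2 -> g) : R^o := W2 (v ord0) (v (lift ord0 ord0)).
have F1 : form_on X w1 by exact: asd_form.
have F2 : form_on X w2.
  have -> : w2 = fun v => asd e b (t * (P1 - l * P0)) (t * (Q1 - l * Q0)) (t * (S1 - l * S0)) (v ord0) (v (lift ord0 ord0)).
    by apply: funext => v; rewrite /w2 W2E.
  exact: asd_form.
have w1E x y : app2 w1 x y = W1 x y by rewrite /app2 /w1 !(tnth_nth 0).
have w2E x y : app2 w2 x y = W2 x y by rewrite /app2 /w2 !(tnth_nth 0).
exists w1, w2, Y1, Y2, k; split=> //.
- split; last by move=> v; rewrite (fun2E omega0) wY.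
  by rewrite basisEfree fr (subv_trans spI I_sub_a).
- have sym x1 x2 x3 x4 : wedge2 W2 W1 x1 x2 x3 x4 = 0.
    by transitivity (wedge2 W1 W2 x1 x2 x3 x4); [rewrite /wedge2; ring | exact: W12].
  split=> [v|]; [|split=> v].
  + rewrite (fun4E (wedge (k := 2) (l := 2) (@smul R) w1 w2)) (wedge22E _ _ _ _ F1.1 F2.1) !w1E !w2E.
    exact: W12.
  + rewrite (fun4E (wedge (k := 2) (l := 2) (@smul R) w2 w1)) (wedge22E _ _ _ _ F2.1 F1.1) !w1E !w2E.
    exact: sym.
  rewrite (fun4E (wedge (k := 2) (l := 2) (@smul R) w2 w2)) (wedge22E _ _ _ _ F2.1 F2.1) !w2E.
  rewrite (fun4E (wedge (k := 2) (l := 2) (@smul R) w1 w1)) (wedge22E _ _ _ _ F1.1 F1.1) !w1E.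
  exact: W22.
split=> v.
  by rewrite (fun2E (lie_act _ _)) lie_act2E !w1E D1 mulNr opprK.
by rewrite (fun2E (lie_act _ _)) lie_act2E !w2E D2 mulNr.
Qed.

End InFrame.

Lemma shears_primitive11 : shears <->
  [/\ (\dim a <= 2)%N,
      in_sp X u sigma nu
    & [/\ \dim I = 1%N,
          forall v, lie_act f omega0 v = 0
        & forall Y, Y \in I -> nu Y = - f Y]
      \/
      (\dim I = 2%N
       /\ exists (w1 w2 : ('I_2 -> g) -> R^o) (Y1 Y2 : g) (c : R),
            [/\ form_on X w1 /\ form_on X w2,
                basis_of a [:: Y1; Y2]
                /\ (forall v, omega0 v = vscale (w1 v) Y1 + vscale (w2 v) Y2),
                (forall v, wedge (@smul R) w1 w2 v = 0)
                /\ (forall v, wedge (@smul R) w2 w1 v = 0)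
                /\ (forall v, wedge (@smul R) w2 w2 v = wedge (@smul R) w1 w1 v),
                (forall v, lie_act f w1 v = c * w2 v)
                /\ (forall v, lie_act f w2 v = - c * w1 v)
              & nu Y1 = c *: Y2 - f Y1 /\ nu Y2 = - c *: Y1 - f Y2])].
Proof.
have [x0 [y0 [b0 [k0 [w0E k00 b0I b01]]]]] := exists_unit_I.
have b0a : b0 \in a by apply: subvP I_sub_a _ b0I.
have [b [bF b0E]] := exists_frame (subvP au _ b0a) b01; rewrite -b0E in w0E b0I b0a.
have [P0 [Q0 [S0 [P1 [Q1 [S1 [_ aE wE]]]]]]] := w_components bF b0I (ex_intro _ x0 (ex_intro _ y0 (ex_intro _ k0 (conj w0E k00)))).
rewrite shears_equations (shear_equations_primitive su sh bF wE); split=> [[jac tE]|[_ nsp ii]].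
  split; first by apply: dim_a_le2 aE.
    by apply/(in_sp_tau nuX) => // x; apply: subvP au _ (sh_nua sh x).
  by apply: (jacobi_cases bF jac b0I); exists x0, y0, k0.
split; last by apply/(in_sp_tau nuX) => // x; apply: subvP au _ (sh_nua sh x).
move=> x y; case: ii => [[_ lw nuI]|[_ [w1 [w2 [Y1 [Y2 [c [_ [_ wY] _ [l1 l2] [n1 n2]]]]]]]]].
  have := lw (tnth [tuple x; y]); rewrite -[LHS]/(app2 _ x y) lie_act2E => /eqP.
  rewrite oppr_eq0 => /eqP ->; rewrite nuI ?subrr //; exact: (IE.1 (tnth [tuple x; y])).
have wE2 p q : w p q = (app2 w1 p q : R) *: Y1 + (app2 w2 p q : R) *: Y2 by exact: wY.
have m1 : app2 w1 (f x) y + app2 w1 x (f y) = - (c * app2 w2 x y) :> R.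
  have := l1 (tnth [tuple x; y]); rewrite -[lie_act f w1 _]/(app2 _ x y) lie_act2E => E.
  by rewrite -[LHS]opprK E.
have m2 : app2 w2 (f x) y + app2 w2 x (f y) = c * app2 w1 x y :> R.
  have := l2 (tnth [tuple x; y]); rewrite -[lie_act f w2 _]/(app2 _ x y) lie_act2E => E.
  by rewrite -[LHS]opprK E mulNr opprK.
have AL (A : 'End(g)) p q z z' : A (p *: z + q *: z') = p *: A z + q *: A z'.
  by rewrite linearP linearZ.
have -> : w (f x) y + w x (f y) = (app2 w1 (f x) y + app2 w1 x (f y) : R) *: Y1
    + (app2 w2 (f x) y + app2 w2 x (f y) : R) *: Y2.
  by rewrite !wE2 !scalerDl addrACA.
rewrite m1 m2 wE2 !AL n1 n2; apply: (metric_inj eB) => z; rewrite !metricE; ring.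
Qed.

End CaseAMain.
End Main.

Theorem proposition4p4 (R : realType) (g : vectType R) (br : g -> g -> g)
    (u : {vspace g}) (phi : ('I_3 -> g) -> R^o) (e : 7.-tuple g)
    (alpha : 'Hom(g, R^o)) (X : g) (J : 'End(g))
    (sigma : ('I_2 -> g) -> R^o) (rho : ('I_3 -> g) -> R^o)
    (a : {vspace g}) (omega0 : ('I_2 -> g) -> g) (nu : 'End(g))
    (I : {vspace g}) :
  let f := ad br X in
  let star_phi : ('I_4 -> g) -> R^o := @hodge R g 3 4 e phi in
  let omega : ('I_2 -> g) -> subvs_of a := fun v =>
    vsproj a (omega0 v
      + wedge (@vscale R g) (form1 alpha) (form1 nu) v) in
  let gam := tensor_endo alpha (restrict_endo a f) in
  let eta := tensor_endo alpha (restrict_endo a (f + nu)) in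
  let shears := shears_to_cocalibrated br phi e omega gam eta in
  let in_nu_class (tnu : 'End(g)) := exists hnu : 'End(g),
    [/\ in_sp X u sigma hnu, (hnu @: u <= a)%VS,
        forall Y, Y \in I -> hnu Y = 0
      & nu = tnu + hnu] in
  (* the almost Abelian Lie algebra and its cocalibrated G_2-structure *)
  is_lie_bracket br ->
  \dim {:g} = 7%N ->
  is_codim1_abelian_ideal br u ->
  G2_adapted_basis phi e ->
  (forall v, dCE br star_phi v = 0) ->
  (* the induced data *)
  (forall Y, Y \in u -> alpha Y = 0) ->
  \sum_(i < 7) (alpha e`_i : R) ^+ 2 = 1 ->
  is_orth e X u ->
  alpha X = 1 ->
  form_on X sigma ->
  form_on X rho ->
  (forall v, star_phi v = 2%:R^-1 * wedge (@smul R) sigma sigma v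
                          + wedge (@smul R) rho (form1 alpha) v) ->
  endo_on X u J ->
  (forall Y Z, Y \in u -> Z \in u -> app2 sigma Y Z = metric e Y (J Z)) ->
  (* the shear data *)
  (a <= u)%VS ->
  (f @: a <= a)%VS ->
  in_tensor (fun b => form_on X b) a omega0 ->
  nu X = 0 -> (limg nu <= a)%VS ->
  is_span_of_values omega0 I ->
  (exists v, omega0 v <> 0) ->
  (forall Z Y, Z \in a -> Y \in u -> app2 omega0 Z Y = 0) ->
  [/\ (* (a) *)
      in_tensor (is_primitive11 X u e J sigma) a omega0 ->
      (shears <->
       [/\ (\dim a <= 2)%N,
           in_sp X u sigma nu
         & [/\ \dim I = 1%N,
               forall v, lie_act f omega0 v = 0
             & forall Y, Y \in I -> nu Y = - f Y]
           \/
           (\dim I = 2%N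
            /\ exists (w1 w2 : ('I_2 -> g) -> R^o) (Y1 Y2 : g) (c : R),
                 [/\ form_on X w1 /\ form_on X w2,
                     basis_of a [:: Y1; Y2]
                     /\ (forall v, omega0 v = vscale (w1 v) Y1
                                              + vscale (w2 v) Y2),
                     (forall v, wedge (@smul R) w1 w2 v = 0)
                     /\ (forall v, wedge (@smul R) w2 w1 v = 0)
                     /\ (forall v, wedge (@smul R) w2 w2 v
                                   = wedge (@smul R) w1 w1 v),
                     (forall v, lie_act f w1 v = c * w2 v)
                     /\ (forall v, lie_act f w2 v = - c * w1 v)
                   & nu Y1 = c *: Y2 - f Y1 /\ nu Y2 = - c *: Y1 - f Y2])]),
      (* (b) *)
      \dim a = 4%N ->
      (forall Y, Y \in I -> is_orth e (J Y) a) ->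
      (shears <->
       (forall Y, Y \in I -> f Y = - trace_on a f *: Y)
       /\ exists tnu : 'End(g),
            [/\ endo_on X u tnu,
                forall W, W \in (J @: I)%VS ->
                  tnu W = - sharp e (form1 (app3 rho (J W)
                    (sharp e (kappa u (fun v => J (omega0 v)))))),
                forall W, W \in u -> is_orth e W (J @: I)%VS -> tnu W = 0
              & in_nu_class tnu])
    & (* (c) *)
      \dim a = 4%N ->
      (J @: I <= a)%VS ->
      (shears <->
       is_degenerate_on sigma a
       /\ exists (tnu : 'End(g)) (mu : R),
            [/\ endo_on X u tnu,
                forall Y, Y \in I -> metric e Y Y = 1 ->
                  [/\ forall v : 'I_4 -> g,
                        (forall i, v i \in u /\ metric e (v i) Y = 0
                                   /\ metric e (v i) (J Y) = 0) ->
                        kappa u (wedge (fun (y : g) (d : R^o) => vscale d y)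
                                       omega0 rho) v
                        = - mu * wedge (@smul R) sigma sigma v,
                      tnu Y = - trace_on a f *: Y - f Y,
                      tnu (J Y) = (- app2 sigma (f Y) (J Y)
                                   + trace_on a f - mu) *: J Y
                    & forall W, W \in u -> is_orth e W a ->
                        tnu W = - (app2 sigma (f Y) W : R) *: J Y],
                forall W, W \in a -> is_orth e W (I + J @: I)%VS ->
                  tnu W = mu *: W
              & in_nu_class tnu])].
Proof.
move=> f star_phi omega gam eta shears in_nu_class.
move=> brL g7 uI G2 coc alu al1 Xu alX sF rF PhiE JE sJ au fa wT nuX nua IE w0 wa0.
split=> [wA|a4 JI|a4 JI].
- exact: (shears_primitive11 brL g7 uI G2 coc alu al1 Xu alX sF rF PhiE JE sJ au fa wT nuX nua IE w0 wa0 wA).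
- exact: (shears_J_orthogonal brL g7 uI G2 coc alu al1 Xu alX sF rF PhiE JE sJ au fa wT nuX nua IE w0 wa0 a4 JI).
exact: (shears_J_stable brL g7 uI G2 coc alu al1 Xu alX sF rF PhiE JE sJ au fa wT nuX nua IE w0 wa0 a4 JI).
Qed.
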